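(* Let $\zeta$ be a primitive, aperiodic substitution of Salem type on the alphabet $\mathcal{A}=\{1,\dots,d\}$, let $\alpha$ (a Salem number of degree $d$) be the Perron–Frobenius eigenvalue of its substitution matrix and $\vec p$ the positive left eigenvector, and let $(\mathfrak{X}^{\vec p}_\zeta,(h_t)_{t\in\mathbb{R}})$ be the corresponding self-similar suspension flow. For $a\in\mathcal{A}$ let $\nu_a$ be the correlation measure associated to $a$. Let $\sigma_0:\mathbb{Q}(\alpha)\hookrightarrow\mathbb{C}$ be the embedding with $\sigma_0(\alpha)=\alpha^{-1}$. Then there exists a constant $c=c(\zeta)>0$, depending only on $\zeta$, such that for all $A,B,C>1$ there exists $\gamma=\gamma(A,B,C)>0$ (depending, for the given $\zeta$, only on $A,B,C$) with the following property. For every real number $\omega$ such that $|\omega|\in\mathbb{Q}(\alpha)\cap[B^{-1},B]$, $|\sigma_0(\omega)|\le C$ and $L\le A$, where $L\in\mathbb{N}$ is the denominator in the reduced form $\omega=\frac1L(l_0+l_1\alpha+\dots+l_{d-1}\alpha^{d-1})$, there exists $r_0=r_0(\omega)>0$ such that $$\nu_a([\omega-r,\omega+r])\le c\,r^{\gamma}\qquad\text{for all } 0<r<r_0 \text{ and all } a\in\mathcal{A}.$$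
   Context: Salem number: a real algebraic integer $\alpha>1$ all of whose other Galois conjugates lie in the closed unit disk, with at least one on the unit circle. (Then $\alpha^{-1}$ is a conjugate, and all conjugates other than $\alpha,\alpha^{-1}$ lie on the unit circle; the degree $d$ is even and $\ge 4$.) Reduced form: for $\eta\in\mathbb{Q}(\alpha)$ with $\alpha$ of degree $d$, the expression $\eta=\frac1L(l_0+\dots+l_{d-1}\alpha^{d-1})$ with $L\in\mathbb{N}$, $L\ge1$, $l_0,\dots,l_{d-1}\in\mathbb{Z}$ is in reduced form if $\gcd(l_0,\dots,l_{d-1},L)=1$. Substitutions: $d\ge4$ is an even integer and $\mathcal{A}=\{1,\dots,d\}$. A substitution is a map $\zeta:\mathcal{A}\to\mathcal{A}^+$ (finite nonempty words), extended to words and sequences by concatenation. Its substitution matrix is $M_\zeta(a,b)=|\zeta(b)|_a$, the number of occurrences of the letter $a$ in $\zeta(b)$; $\zeta$ is primitive if $M_\zeta$ is primitive. It is of Salem type if it is primitive and the dominant (Perron–Frobenius) eigenvalue of $M_\zeta$ is a Salem number. The substitution subshift $\mathfrak{X}_\zeta\subset\mathcal{A}^{\mathbb{Z}}$ is the set of $(x_n)_{n\in\mathbb{Z}}$ such that every finite block $x_i\dots x_{i+k}$ is a subword of $\zeta^n(a)$ for some $a\in\mathcal{A}$, $n\in\mathbb{N}$; $T$ is the left shift $T((x_n)_n)=(x_{n+1})_n$. For primitive $\zeta$, aperiodic means $\mathfrak{X}_\zeta$ is infinite. Self-similar suspension flow: $\vec p=(p_a)_{a\in\mathcal{A}}$ is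 a fixed positive left eigenvector of $M_\zeta$ for the Perron–Frobenius eigenvalue $\alpha$, normalized so that all $p_a\in\mathbb{Z}[\alpha]$. Let $F:\mathfrak{X}_\zeta\times\mathbb{R}\to\mathfrak{X}_\zeta\times\mathbb{R}$, $F(x,t)=(T(x),t-p_{x_0})$. Then $\mathfrak{X}^{\vec p}_\zeta=(\mathfrak{X}_\zeta\times\mathbb{R})/\sim$, where $(x,t)\sim(x',t')$ iff $F^n(x,t)=(x',t')$ for some $n\in\mathbb{Z}$, and $h_t(x,t')=(x,t'+t)$ mod $\sim$. The space is identified with the fundamental domain $\{(x,t): x\in\mathfrak{X}_\zeta,\ 0\le t<p_{x_0}\}$. The flow is uniquely ergodic; $\mu$ denotes its unique invariant Borel probability measure. For $a\in\mathcal{A}$, $\mathfrak{X}^{\vec p}_a=\{(x,t)\in\mathfrak{X}^{\vec p}_\zeta: x_0=a\}$ (in the fundamental domain). Correlation measure: for $f\in L^2(\mathfrak{X}^{\vec p}_\zeta,\mu)$ the spectral measure $\nu_f$ is the finite positive Borel measure on $\mathbb{R}$ with $\int_{\mathbb{R}}e^{2\pi i t\omega}\,d\nu_f(\omega)=\langle f\circ h_t,f\rangle_{L^2(\mu)}$ for all $t\in\mathbb{R}$; $\nu_a:=\nu_f$ for $f=\mathbf{1}_{\mathfrak{X}^{\vec p}_a}$. *)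

(* Defs.v *)
From HB Require Import structures.
From mathcomp Require Import all_boot all_order all_algebra.
From mathcomp Require Import all_classical all_reals all_analysis.
From mathcomp Require Import complex.

Set Implicit Arguments.
Unset Strict Implicit.
Unset Printing Implicit Defensive.

Import Order.TTheory GRing.Theory Num.Theory.
Import numFieldNormedType.Exports.

Local Open Scope classical_set_scope.
Local Open Scope ring_scope.
Local Open Scope complex_scope.
Local Open Scope quotient_scope.

Definition is_minpoly (K : numFieldType) (q : {poly rat}) (x : K) : Prop :=
  [/\ q \is monic, irreducible_poly q & root (map_poly ratr q) x].

Definition galois_conj (K : numFieldType) (x y : K) : Prop :=
  exists2 q : {poly rat}, is_minpoly q x & root (map_poly ratr q) y.

Definition has_degree (K : numFieldType) (x : K) (n : nat) : Prop :=
  exists2 q : {poly rat}, is_minpoly q x & size q = n.+1.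

Definition salem_number (R : realType) (alpha : R) : Prop :=
  [/\ 1 < alpha,
      integralOver (intr : int -> R) alpha,
      forall z : R[i], galois_conj alpha%:C z -> z != alpha%:C -> `|z| <= 1
    & exists2 z : R[i], galois_conj alpha%:C z & `|z| = 1].

(* Q(alpha) as the field of rational expressions in alpha; a vanishing
   denominator gives the value 0, so no side condition is needed. *)
Definition Qadjoin (R : realType) (alpha : R) : set R :=
  [set x | exists q r : {poly rat},
     x = (map_poly ratr q).[alpha] / (map_poly ratr r).[alpha]].

(* s restricts to a field embedding of the subfield K of R into the complex
   numbers; the values of s outside K are irrelevant. *)
Definition field_embedding (R : realType) (K : set R) (s : R -> R[i]) : Prop :=
  [/\ s 1 = 1,
      forall x y, K x -> K y -> s (x + y) = s x + s y
    & forall x y, K x -> K y -> s (x * y) = s x * s y].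

Definition reduced_form (R : realType) (d : nat) (alpha eta : R)
    (L : nat) (l : 'I_d -> int) : Prop :=
  [/\ (1 <= L)%N,
      gcdn (\big[gcdn/0%N]_(i < d) absz (l i)) L = 1%N
    & eta = L%:R^-1 * \sum_(i < d) (l i)%:~R * alpha ^+ i].

Record substitution (d : nat) := Substitution {
  subst_letter :> 'I_d -> seq 'I_d;
  subst_letter_neq0 : forall a, subst_letter a != [::] }.

Definition subst_word d (zeta : substitution d) (w : seq 'I_d) : seq 'I_d :=
  flatten [seq zeta a | a <- w].

Definition subst_mx d (zeta : substitution d) : 'M[nat]_d :=
  \matrix_(a, b) count_mem a (zeta b).

Definition primitive_subst d (zeta : substitution d) : Prop :=
  exists2 k : nat, (0 < k)%N & forall a b, (0 < (subst_mx zeta ^+ k) a b)%N.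

Definition subst_mxR (R : pzSemiRingType) d (zeta : substitution d) : 'M[R]_d :=
  map_mx (fun n : nat => n%:R) (subst_mx zeta).

(* [eigenvalue] refers to row vectors; left and right spectra agree. *)
Definition perron_eigenvalue (R : realType) d (zeta : substitution d)
    (alpha : R) : Prop :=
  [/\ 0 < alpha, eigenvalue (subst_mxR R zeta) alpha
    & forall z : R[i], eigenvalue (subst_mxR R[i] zeta) z ->
        z != alpha%:C -> `|z| < alpha%:C].

Definition roof_vector (R : realType) d (zeta : substitution d) (alpha : R)
    (p : 'rV[R]_d) : Prop :=
  [/\ p *m subst_mxR R zeta = alpha *: p,
      forall a, 0 < p 0 a
    & forall a, exists q : {poly int}, p 0 a = (map_poly intr q).[alpha]].

Definition full_shift (d : nat) : topologicalType :=
  prod_topology (fun _ : int => discrete_topology 'I_d).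

Definition block d (x : full_shift d) (i : int) (k : nat) : seq 'I_d :=
  [seq x (i + j%:Z) | j <- iota 0 k.+1].

Definition subshift d (zeta : substitution d) : set (full_shift d) :=
  [set x | forall (i : int) (k : nat), exists (a : 'I_d) (n : nat),
     infix (block x i k) (iter n (subst_word zeta) [:: a])].

Definition aperiodic d (zeta : substitution d) : Prop :=
  infinite_set (subshift zeta).

Definition lshift_seq d (x : full_shift d) : full_shift d :=
  fun n => x (n + 1).

Lemma lshift_subshift d (zeta : substitution d) (x : full_shift d) :
  x \in subshift zeta -> lshift_seq x \in subshift zeta.
Proof.
rewrite !inE => Xx i k; have [a [n H]] := Xx (i + 1) k.
exists a, n; apply: etrans H; congr (infix _ _).
by apply: eq_map => j; rewrite /lshift_seq addrAC.
Qed.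

Definition shift d (zeta : substitution d) (x : subshift zeta) :
  subshift zeta := SigSub (lshift_subshift (valP x)).

Section Suspension.
Context (R : realType) (d : nat) (zeta : substitution d) (p : 'rV[R]_d).

Definition letter0 (x : subshift zeta) : 'I_d := (set_val x : full_shift d) 0.

Definition roof_map (u : subshift zeta * R) : subshift zeta * R :=
  (shift u.1, u.2 - p 0 (letter0 u.1)).

(* F ^ n u = v for some integer n, with F := roof_map invertible; a negative
   power is expressed by exchanging u and v. *)
Definition same_orbit (u v : subshift zeta * R) : Prop :=
  exists n : nat, iter n roof_map u = v \/ iter n roof_map v = u.

Definition same_orbitb : rel (subshift zeta * R) :=
  fun u v => `[< same_orbit u v >].

Lemma roof_map_inj : injective roof_map.
Proof.
move=> [x s] [y t] [] /= exy.
have ex : x = y.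
  apply: val_inj; apply/funext => n /=.
  by have := congr1 (@^~ (n - 1)) exy; rewrite /lshift_seq subrK.
by rewrite ex => /addIr ->.
Qed.

Lemma iter_roof_map_inj n : injective (iter n roof_map).
Proof. by elim: n => [|n IHn] u v //= /roof_map_inj/IHn. Qed.

Lemma same_orbit_refl : reflexive same_orbitb.
Proof. by move=> u; apply/asboolP; exists 0; left. Qed.

Lemma same_orbit_sym : symmetric same_orbitb.
Proof.
by move=> u v; apply/asboolP/asboolP => -[n [H|H]]; exists n; [right|left|right|left].
Qed.

Lemma same_orbit_trans : transitive same_orbitb.
Proof.
move=> v u w /asboolP[m Hm] /asboolP[n Hn]; apply/asboolP.
case: Hm Hn => [<-|Hm] [|]; rewrite -?iterD.
- by move=> <-; exists (n + m)%N; left; rewrite iterD.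
- case: (leqP n m) => [le_nm|/ltnW le_mn].
    rewrite -(subnKC le_nm) iterD => /iter_roof_map_inj ->.
    by exists (m - n)%N; left.
  rewrite -(subnKC le_mn) iterD => /iter_roof_map_inj <-.
  by exists (n - m)%N; right.
- move=> Hn; case: (leqP n m) => [le_nm|/ltnW le_mn].
    exists (m - n)%N; right; rewrite -Hm -Hn -iterD subnK //.
  exists (n - m)%N; left; rewrite -Hn -Hm -iterD subnK //.
- by move=> Hn; exists (m + n)%N; right; rewrite iterD Hn.
Qed.

Definition same_orbit_equiv : equiv_rel (subshift zeta * R)%type :=
  EquivRel same_orbitb same_orbit_refl same_orbit_sym same_orbit_trans.

(* Aperiodicity only serves to exhibit the base point which is part of the
   structure of measurable space. *)
Definition suspension (aper : aperiodic zeta) : Type :=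
  quotient_topology {eq_quot same_orbit_equiv}.

Context (aper : aperiodic zeta).

HB.instance Definition _ := Topological.on (suspension aper).
HB.instance Definition _ := Quotient.on (suspension aper).

Lemma suspension_point : {u : suspension aper | True}.
Proof.
apply: cid; have [x Xx] := infinite_setN0 aper.
by exists (\pi_(suspension aper) (SigSub (mem_set Xx), 0)).
Qed.

HB.instance Definition _ :=
  isPointed.Build (suspension aper) (sval suspension_point).

Definition borel_suspension : measurableType _ :=
  g_sigma_algebraType (@open (suspension aper)).

(* Independent of the representative, as roof_map commutes with translations of
   the second coordinate. *)
Definition flow (t : R) (q : suspension aper) : suspension aper :=
  \pi_(suspension aper) ((repr q).1, (repr q).2 + t).

(* The points (x, s) of the fundamental domain 0 <= s < p_(x_0) with x_0 = a *)
Definition letter_set (a : 'I_d) : set (suspension aper) :=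
  \pi_(suspension aper) @`
    [set u : subshift zeta * R | letter0 u.1 = a /\ 0 <= u.2 < p 0 a].

Definition flow_invariant (mu : set borel_suspension -> \bar R) : Prop :=
  forall (t : R) (B : set borel_suspension),
    measurable B -> mu (flow t @^-1` B) = mu B.

End Suspension.
Arguments flow {R d zeta} p aper t q.
Arguments letter_set {R d zeta} p aper a.

Definition Cintegral (R : realType) disp (T : measurableType disp)
    (mu : {measure set T -> \bar R}) (f : T -> R[i]) : R[i] :=
  (\int[mu]_x complex.Re (f x)) +i* (\int[mu]_x complex.Im (f x)).

Definition expi (R : realType) (x : R) : R[i] := cos x +i* sin x.

Definition spectral_measure (R : realType) disp (T : measurableType disp)
    (mu : {measure set T -> \bar R}) (h : R -> T -> T) (f : T -> R[i])
    (nu : {finite_measure set (measurableTypeR R) -> \bar R}) : Prop :=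
  forall t : R,
    Cintegral nu (fun w : measurableTypeR R => expi (2 * pi * t * w)) =
    Cintegral mu (fun x => f (h t x) * conjc (f x)).

Definition correlation_measure (R : realType) d (zeta : substitution d)
    (p : 'rV[R]_d) (aper : aperiodic zeta)
    (mu : {measure set (borel_suspension p aper) -> \bar R}) (a : 'I_d)
    (nu : {finite_measure set (measurableTypeR R) -> \bar R}) : Prop :=
  spectral_measure mu (flow p aper)
    (fun x => (\1_(letter_set p aper a) x)%:C) nu.

(* Main.v *)
(* Write e(x) = exp(2 pi i x).  Expanding |sum_(k < N) e(k tau (w' - w))|^2 and
   integrating against nu_a gives, by invariance of mu,
     nu_a [w - r, w + r] * (N / 2)^2 <= int |S_N|^2 dmu,
   where S_N samples the twisted ergodic sum of the indicator of the letter a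
   at the times k tau, so a uniform power saving for S_N suffices.  Cutting an
   orbit into tiles reduces S_N to the sums of e(- w * position) over the
   occurrences of a in a word of the language.  A return word of length v
   occurring in all zeta^k(b) makes such a sum over zeta^(n+k)(b) smaller than
   the trivial bound by a factor 1 - c (1 - cos(2 pi w alpha^n v)), so everything
   rests on a lower bound for the mean over n of 1 - cos(2 pi w alpha^n v).
   Up to the bounded denominator L, w v is g(alpha) with g an integer
   polynomial.  As the trace of g(alpha) alpha^n is an integer, w v alpha^n is,
   modulo 1 and up to an exponentially small term, minus the sum of the
   conjugates over the unit circle.  These conjugates are multiplicatively
   independent, so by Weyl the mean of the cosine is a product of values
   J_0(4 pi |g(z_j)|).  Finally, the norm of g(alpha) is a nonzero integer and
   the bounds on w and sigma_0(w) bound its two real factors, so some |g(z_j)|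
   is bounded below in terms of A, B, C only, which makes the product uniformly
   smaller than 1. *)
Require Import Defs.
From HB Require Import structures.
From mathcomp Require Import all_boot all_order all_algebra.
From mathcomp Require Import all_classical all_reals all_analysis.
From mathcomp Require Import complex.
From mathcomp Require Import separable measurable_realfun.
From mathcomp Require Import ring lra zify.

Set Implicit Arguments.
Unset Strict Implicit.
Unset Printing Implicit Defensive.

Import Order.TTheory GRing.Theory Num.Theory.
Import numFieldNormedType.Exports.

Local Open Scope classical_set_scope.
Local Open Scope ring_scope.
Local Open Scope complex_scope.

(** The Bessel factors must therefore be controlled on a whole half-line: |J_0| <= 1 everywhere for
    the unknown factors, and |J_0| <= 1 - kappa beyond any positive threshold for the known one.
    Both follow from a decreasing energy attached to the Bessel equation.

    The speed of convergence in Weyl's theorem, in contrast, depends on omega. It enters only the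
    constant in front of the power of r. The spectral bound obtained has the form Q r^(2 gamma),
    with Q depending on omega; half of the exponent is given up to absorb Q for r below r_0(omega),
    which is why c = 1 serves all omega.

    The sampling uses M^2 points with step 1 / (4 |omega| M). The window then has length of order M,
    and the discretization error, of order 1/M on each tile, stays bounded in total. *)

Definition cabs (R : rcfType) (z : R[i]) : R := complex.Re `|z|.

(** * The complex modulus with values in the base field *)

Section Cabs.
Context (R : rcfType).
Implicit Types (x y z : R[i]) (r : R).

Lemma cabsE z : (cabs z)%:C = `|z|.
Proof. by rewrite /cabs normc_def. Qed.

Lemma cabs_ge0 z : 0 <= cabs z.
Proof. by rewrite -lecR cabsE normr_ge0. Qed.

Lemma cabsM x y : cabs (x * y) = cabs x * cabs y.
Proof. by apply: complexI; rewrite rmorphM /= !cabsE normrM. Qed.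

Lemma cabsX x n : cabs (x ^+ n) = cabs x ^+ n.
Proof. by apply: complexI; rewrite rmorphXn /= !cabsE normrX. Qed.

Lemma cabsD x y : cabs (x + y) <= cabs x + cabs y.
Proof. by rewrite -lecR rmorphD /= !cabsE ler_normD. Qed.

Lemma cabsN x : cabs (- x) = cabs x.
Proof. by rewrite /cabs normrN. Qed.

Lemma cabs1 : cabs (1 : R[i]) = 1.
Proof. by apply: complexI; rewrite cabsE normr1. Qed.

Lemma cabs0 : cabs (0 : R[i]) = 0.
Proof. by apply: complexI; rewrite cabsE normr0. Qed.

Lemma cabs_real r : cabs r%:C = `|r|.
Proof.
by apply: complexI; rewrite cabsE normc_def /= expr0n addr0 sqrtr_sqr.
Qed.

Lemma cabs_nat n : cabs (n%:R : R[i]) = n%:R.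
Proof. by rewrite -(rmorph_nat (real_complex R)) cabs_real ger0_norm. Qed.

Lemma cabsV z : cabs z^-1 = (cabs z)^-1.
Proof. by apply: complexI; rewrite fmorphV /= !cabsE normfV. Qed.

Lemma cabs_i : cabs ('i%C : R[i]) = 1.
Proof. by rewrite /cabs normc_def /= expr0n add0r expr1n sqrtr1. Qed.

Lemma cabs_conj z : cabs z^*%C = cabs z.
Proof. by rewrite /cabs normcJ. Qed.

Lemma cabs_sum I (s : seq I) (P : pred I) (F : I -> R[i]) :
  cabs (\sum_(i <- s | P i) F i) <= \sum_(i <- s | P i) cabs (F i).
Proof.
elim/big_rec2: _ => [|i a b _ IH]; first by rewrite cabs0.
by rewrite (le_trans (cabsD _ _)) // lerD2l.
Qed.

Lemma cabs_prod I (s : seq I) (P : pred I) (F : I -> R[i]) :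
  cabs (\prod_(i <- s | P i) F i) = \prod_(i <- s | P i) cabs (F i).
Proof.
elim/big_rec2: _ => [|i a b _ IH]; first by rewrite cabs1.
by rewrite cabsM IH.
Qed.

Lemma Re_le_cabs z : `|complex.Re z| <= cabs z.
Proof. by rewrite -lecR cabsE normc_ge_Re. Qed.

Lemma Im_le_cabs z : `|complex.Im z| <= cabs z.
Proof.
by have := Re_le_cabs (z * 'i%C); rewrite ReiNIm normrN cabsM cabs_i mulr1.
Qed.

Lemma sqr_cabs z : cabs z ^+ 2 = complex.Re z ^+ 2 + complex.Im z ^+ 2.
Proof. by apply: complexI; rewrite add_Re2_Im2 rmorphXn /= cabsE. Qed.

Lemma cabs_le_sqrt2 z : cabs z <= `|complex.Re z| + `|complex.Im z|.
Proof.
rewrite -(@ler_pXn2r _ 2) ?nnegrE ?cabs_ge0 ?addr_ge0 // sqr_cabs sqrrD.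
by rewrite !real_normK ?num_real // addrAC lerDl mulrn_wge0 // mulr_ge0.
Qed.

End Cabs.

(** * Conjugates of a Salem number *)

Section RationalRoots.
Context (C : numClosedFieldType).
Implicit Types (q H : {poly rat}) (x y z t : C).

Local Notation "p ^Q" := (map_poly (ratr : rat -> C) p) (at level 2).

Lemma irreducible_dvd_root q H x :
  irreducible_poly q -> root q^Q x -> root H^Q x -> q %| H.
Proof.
move=> qirr qx Hx; have [cop|ncop] := boolP (coprimep q H); last first.
  have [_ /(_ (gcdp q H))] := qirr.
  rewrite /coprimep in ncop; move=> /(_ ncop (dvdp_gcdl _ _)) qg.
  by rewrite -(eqp_dvdl _ qg) dvdp_gcdr.
move: cop; rewrite -(coprimep_map (ratr : {rmorphism rat -> C})).
by move=> /coprimep_root /(_ qx); move: Hx; rewrite rootE => ->.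
Qed.

Lemma irreducible_root_transfer q H x t :
  irreducible_poly q -> root q^Q x -> root q^Q t -> root H^Q x -> root H^Q t.
Proof.
move=> qirr qx qt /(irreducible_dvd_root qirr qx) /dvdpP[r ->].
by rewrite rmorphM /= rootM qt orbT.
Qed.

Lemma algebraic_irreducible_poly x : algebraicOver (ratr : rat -> C) x ->
  exists2 q, irreducible_poly q & root q^Q x.
Proof.
move=> [p p0 px].
pose P n := `[< exists r : {poly rat}, [/\ r != 0, root r^Q x & size r = n] >].
have exP : exists n, P n by exists (size p); apply/asboolP; exists p.
case: (ex_minnP exP) => n /asboolP[q [q0 qx sq]] qmin.
exists q => //; split=> [|d d1 /dvdpP[r qE]].
  rewrite ltnNge; apply/negP => /size1_polyC qC; move: q0 qx.
  rewrite qC map_polyC rootC polyC_eq0 fmorph_eq0 => /negP; exact.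
have r0 : r != 0 by apply: contraNneq q0 => r0; rewrite qE r0 mul0r.
have d0 : d != 0 by apply: contraNneq q0 => d0; rewrite qE d0 mulr0.
have sqE : size q = (size r + size d).-1 by rewrite qE size_mul.
have := qx; rewrite qE rmorphM /= rootM => /orP[rx|dx]; last first.
  have : (n <= size d)%N by apply: qmin; apply/asboolP; exists d.
  have dq : d %| q by rewrite qE dvdp_mull.
  by rewrite -sq => sqd; rewrite -qE -(dvdp_size_eqp dq) eqn_leq sqd andbT dvdp_leq //.
have : (n <= size r)%N by apply: qmin; apply/asboolP; exists r.
by move: r0 d0 d1; rewrite -sq sqE -!size_poly_gt0; lia.
Qed.

Lemma primitive_element (s : seq C) :
  {in s, forall z, algebraicOver (ratr : rat -> C) z} ->
  exists2 theta, algebraicOver (ratr : rat -> C) theta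
    & {in s, forall z, exists h : {poly rat}, h^Q.[theta] = z}.
Proof.
elim: s => [|x s IHs] algs.
  by exists 0; [exists 'X; rewrite ?polyX_eq0 // map_polyX rootE hornerX|].
have [z zs|y yalg ys] := IHs; first by apply: algs; rewrite inE zs orbT.
have xalg : algebraicOver (ratr : rat -> C) x by apply: algs; rewrite mem_head.
have [px px0 rpx] := xalg; have [py py0 rpy] := yalg.
have [n [[hx hxE] [hy hyE]]] :=
  pchar0_PET (iota := ratr : {rmorphism rat -> C}) px0 rpx py0 rpy (pchar_num _).
exists (y *+ n - x).
  have yn : algebraicOver (ratr : rat -> C) (y *+ n).
    by rewrite -mulr_natr; apply: algebraic_mul => //; rewrite -(ratr_nat C n); apply: algebraic_id.
  exact: algebraic_sub.
move=> z; rewrite inE => /predU1P[->|/ys[h <-]]; first by exists hx.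
by exists (h \Po hy); rewrite map_comp_poly horner_comp hyE.
Qed.

Lemma horner_mx_eigenvalue (F : fieldType) n (A : 'M[F]_n.+1) (h : {poly F}) a :
  eigenvalue A a -> eigenvalue (horner_mx A h) h.[a].
Proof.
move=> /eigenvalueP[v vA v0]; apply/eigenvalueP; exists v => //.
elim/poly_ind: h => [|h c IHh].
  by rewrite rmorph0 mulmx0 horner0 scale0r.
rewrite rmorphD rmorphM /= horner_mx_X horner_mx_C mulmxDr mulmxA IHh.
rewrite -scalemxAl vA mul_mx_scalar hornerD hornerM hornerX hornerC.
by rewrite scalerA scalerDl.
Qed.

Lemma eigenvalue_mul_XsubC (F : fieldType) n (A : 'M[F]_n.+1) (rs : seq F) (v : 'rV_n.+1) :
  v != 0 -> v *m horner_mx A (\prod_(r <- rs) ('X - r%:P)) = 0 ->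
  exists2 r, r \in rs & eigenvalue A r.
Proof.
elim: rs v => [|r rs IHrs] v v0.
  by rewrite big_nil rmorph1 mulmx1 => /eqP; rewrite (negPf v0).
rewrite big_cons rmorphM /= rmorphB /= horner_mx_X horner_mx_C mulmxA => vrs.
have [w0|w0] := eqVneq (v *m (A - r%:M)) 0; last first.
  have [a ars Aa] := IHrs _ w0 vrs; exists a => //.
  by rewrite inE ars orbT.
exists r; first exact: mem_head.
apply/eigenvalueP; exists v => //; apply/eqP.
by rewrite -subr_eq0 -mul_mx_scalar -mulmxBr w0.
Qed.

(** Spectral mapping: [h - b] splits into linear factors, and applying these to the eigenvector one
    after the other must give zero at some factor [A - r]. When [h] is the constant [b], any root of
    the characteristic polynomial serves. *)
Lemma eigenvalue_horner_mx (F : closedFieldType) n (A : 'M[F]_n.+1) (h : {poly F}) b :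
  eigenvalue (horner_mx A h) b -> exists2 a, eigenvalue A a & h.[a] = b.
Proof.
have hbE a : (h - b%:P).[a] = h.[a] - b by rewrite hornerD hornerN hornerC.
move=> /eigenvalueP[v hv v0]; have [h0|h0] := eqVneq (h - b%:P) 0.
  have /closed_rootP[a Aa] : size (char_poly A) != 1%N by rewrite size_char_poly.
  exists a; first by rewrite eigenvalue_root_char.
  by apply/eqP; rewrite -subr_eq0 -hbE h0 horner0.
have [rs hE] := closed_field_poly_normal (h - b%:P).
have [|a ars Aa] := @eigenvalue_mul_XsubC _ _ A rs v v0.
  have lc0 : lead_coef (h - b%:P) != 0 by rewrite lead_coef_eq0.
  apply: (scalerI lc0); rewrite scaler0 scalemxAr -linearZ /= -hE.
  by rewrite rmorphB /= horner_mx_C mulmxBr hv mul_mx_scalar subrr.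
exists a => //; apply/eqP; rewrite -subr_eq0 -hbE hE hornerZ mulf_eq0.
by apply/orP; right; rewrite -rootE root_prod_XsubC.
Qed.

(** The characteristic polynomial of [h(A)] is rational and vanishes at [h(t)], hence at each
    conjugate [y]; spectral mapping then writes [y] as [h(u)]. In this way a conjugation of [h(t)]
    is lifted to [t] without a Galois group. *)
Lemma root_of_horner_conjugate n (A : 'M[rat]_n.+1) h p t y :
  irreducible_poly p -> eigenvalue (map_mx (ratr : rat -> C) A) t ->
  root p^Q h^Q.[t] -> root p^Q y ->
  exists2 u, eigenvalue (map_mx (ratr : rat -> C) A) u & h^Q.[u] = y.
Proof.
move=> pirr At pht py; apply: eigenvalue_horner_mx.
rewrite -map_horner_mx eigenvalue_root_char -map_char_poly.
apply: irreducible_root_transfer pirr pht py _.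
by rewrite map_char_poly map_horner_mx -eigenvalue_root_char horner_mx_eigenvalue.
Qed.

Lemma irreducible_char_poly q : irreducible_poly q ->
  exists n (A : 'M[rat]_n.+1), char_poly A %= q.
Proof.
move=> qirr; have q0 := irredp_neq0 qirr.
have lc0 : (lead_coef q)^-1 != 0 by rewrite invr_eq0 lead_coef_eq0.
pose q1 := (lead_coef q)^-1 *: q.
have q1E : q1 %= q by apply: eqp_scale.
have q1m : q1 \is monic by rewrite monicE lead_coefZ mulVf // lead_coef_eq0.
have [A AE] : exists A : 'M[rat]_((size q1).-1), char_poly A = q1.
  by exists (companionmx q1); apply: companionmxK.
have q1s : (1 < size q1)%N by rewrite size_scale //; case: qirr.
move: A AE; have -> : (size q1).-1 = (size q1).-2.+1 by lia.
by move=> A AE; exists (size q1).-2, A; rewrite AE.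
Qed.

(** Plays the role of a field automorphism sending [x] to [y]: all of [s] is expressed through a
    primitive element [theta], and replacing [theta] by its conjugate [u] moves each [z] to the
    value of [h z] at [u]. The last clause transports rational relations. *)
Lemma conjugate_transfer (s : seq C) p x y :
  {in s, forall z, algebraicOver (ratr : rat -> C) z} -> x \in s ->
  irreducible_poly p -> root p^Q x -> root p^Q y ->
  exists (h : C -> {poly rat}) (theta u : C),
    [/\ {in s, forall z, (h z)^Q.[theta] = z}, (h x)^Q.[u] = y
      & forall H, root H^Q theta = root H^Q u].
Proof.
move=> salg xs pirr px py; have [theta talg th] := primitive_element salg.
have [q qirr qt] := algebraic_irreducible_poly talg.
have /choice[h hE] z : exists hz : {poly rat}, z \in s -> hz^Q.[theta] = z.
  by case: (boolP (z \in s)) => [/th[hz]|_]; [exists hz | exists 0].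
have [n [A AE]] := irreducible_char_poly qirr.
have At v : eigenvalue (map_mx (ratr : rat -> C) A) v = root q^Q v.
  rewrite eigenvalue_root_char -map_char_poly.
  apply: eqp_root; rewrite eqp_map; exact: AE.
have [||||u Au hu] := @root_of_horner_conjugate _ A (h x) p theta y => //.
- by rewrite At.
- by rewrite hE.
have qu : root q^Q u by rewrite -At.
exists h, theta, u; split => // H.
by apply/idP/idP; apply: irreducible_root_transfer qirr _ _ => //.
Qed.

(* A relation between the z's is transported to one in which a chosen z has
   become alpha while the others stay on the unit circle; taking absolute
   values isolates the exponent of that z. *)
Lemma salem_conjugates_independent q alpha (zs : seq C) (k l : C -> nat) :
  irreducible_poly q -> root q^Q alpha -> 1 < alpha ->
  (forall z, root q^Q z -> [\/ z = alpha, z = alpha^-1 | `|z| = 1]) ->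
  {in zs, forall z, root q^Q z} -> uniq zs ->
  {in zs &, forall z w, z * w != 1} ->
  \prod_(z <- zs) z ^+ k z = \prod_(z <- zs) z ^+ l z ->
  {in zs, forall z, k z = l z}.
Proof.
move=> qirr qa a1 rootsP zsq zsU zsV rel z0 z0s.
have zsalg : {in zs, forall z, algebraicOver (ratr : rat -> C) z}.
  by move=> z /zsq qz; exists q; rewrite ?irredp_neq0.
have [h [theta [u [hth hu tr]]]] :=
  conjugate_transfer zsalg z0s qirr (zsq _ z0s) qa.
(* The image of [z] is again a conjugate. It is not [alpha], since [z != z0], and not [alpha^-1],
   since [z * z0 != 1]; so it is on the unit circle. *)
have uz z : z \in zs -> z != z0 -> `|(h z)^Q.[u]| = 1.
  move=> zs' zz0.
  have : root q^Q ((h z)^Q.[u]).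
    rewrite -[root _ _]/(_ == 0) -horner_comp -map_comp_poly -rootE -tr.
    by rewrite rootE map_comp_poly horner_comp hth // -rootE zsq.
  case/rootsP => // E.
    have : root (h z - h z0)^Q theta.
      by rewrite tr rmorphB rootE /= hornerD hornerN E hu subrr.
    by rewrite rootE rmorphB /= hornerD hornerN !hth // subr_eq0 (negPf zz0).
  have : root (h z * h z0 - 1)^Q theta.
    rewrite tr rmorphB rmorphM rmorph1 rootE /= hornerD hornerN hornerM hornerC E hu.
    by rewrite mulVf ?subrr // gt_eqF // (lt_trans ltr01).
  rewrite rootE rmorphB rmorphM rmorph1 /= hornerD hornerN hornerM hornerC !hth //.
  by rewrite subr_eq0 (negPf (zsV _ _ _ _)).
have hp (m : C -> nat) v :
    (\prod_(z <- zs) (h z) ^+ m z)^Q.[v] = \prod_(z <- zs) (h z)^Q.[v] ^+ m z.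
  by rewrite rmorph_prod horner_prod; apply: eq_bigr => z _; rewrite rmorphXn horner_exp.
have relh : \prod_(z <- zs) (h z)^Q.[u] ^+ k z = \prod_(z <- zs) (h z)^Q.[u] ^+ l z.
  apply/eqP; rewrite -subr_eq0 -!hp -hornerN -hornerD -rmorphB -rootE -tr.
  rewrite rootE rmorphB /= hornerD hornerN !hp subr_eq0.
  have E (m : C -> nat) : \prod_(z <- zs) (h z)^Q.[theta] ^+ m z = \prod_(z <- zs) z ^+ m z.
    by rewrite big_seq [RHS]big_seq; apply: eq_bigr => z zzs; rewrite hth.
  by rewrite !E rel.
have nE (m : C -> nat) : `|\prod_(z <- zs) (h z)^Q.[u] ^+ m z| = alpha ^+ m z0.
  rewrite (bigD1_seq z0) //= normrM hu normrX gtr0_norm ?(lt_trans ltr01) //.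
  rewrite normr_prod big_seq_cond big1 ?mulr1 // => z /andP[zzs zz0].
  by rewrite normrX uz // expr1n.
have kl : alpha ^+ l z0 = alpha ^+ k z0 by rewrite -!nE relh.
by apply/eqP; rewrite eqn_leq -!(ler_eXn2l a1) kl lexx.
Qed.

End RationalRoots.

(** * Traces and determinants of polynomials in a matrix *)

Lemma char_poly_conj (F : fieldType) n (V A : 'M[F]_n) :
  V \in unitmx -> char_poly (V *m A *m invmx V) = char_poly A.
Proof.
move=> Vu; pose W (B : 'M[F]_n) := map_mx (polyC : F -> {poly F}) B.
have WV : W V *m W (invmx V) = 1%:M by rewrite /W -map_mxM mulmxV // map_mx1.
have -> : char_poly (V *m A *m invmx V) = \det (W V *m char_poly_mx A *m W (invmx V)).
  congr (\det _); rewrite /char_poly_mx mulmxBr mulmxBl.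
  rewrite (scalar_mxC 'X (W V)) -(mulmxA 'X%:M) WV mulmx1; congr (_ - _).
  by rewrite /W -!map_mxM.
by rewrite !det_mulmx mulrAC -det_mulmx WV det1 mul1r.
Qed.

Lemma horner_mx_simple_spectrum (F : fieldType) n (A : 'M[F]_n.+1) (rs : seq F) (g : {poly F}) :
  uniq rs -> char_poly A = \prod_(r <- rs) ('X - r%:P) ->
  \tr (horner_mx A g) = \sum_(r <- rs) g.[r] /\
  \det (horner_mx A g) = \prod_(r <- rs) g.[r].
Proof.
move=> rsU AE.
have [P Pu /similar_diagPex[D AP]] :
    exists2 P, P \in unitmx & similar_diag P A.
  by apply/diagonalizableP; exists rs => //; rewrite -AE mxminpoly_dvd_char.
have {AP}DE : diag_mx D = P *m A *m invmx P by apply/similarRL.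
have rsD : perm_eq rs [seq D 0 i | i <- enum 'I_n.+1].
  apply: prod_XsubC_eq; rewrite big_map -AE -(char_poly_conj A Pu) -DE.
  rewrite char_poly_trig ?diag_mx_is_trig // big_enum /=.
  by apply: eq_bigr => i _; rewrite mxE eqxx mulr1n.
have gE : P *m horner_mx A g *m invmx P = diag_mx (map_mx (horner g) D).
  by rewrite -horner_mx_diag DE horner_mx_uconj.
split; rewrite (perm_big _ rsD) big_map big_enum /=.
  rewrite -(mulmx1 (horner_mx A g)) -(mulVmx Pu) mulmxA mxtrace_mulC mulmxA gE.
  by rewrite mxtrace_diag; apply: eq_bigr => i _; rewrite mxE.
have -> : \det (horner_mx A g) = \det (diag_mx (map_mx (horner g) D)).
  by rewrite -gE !det_mulmx mulrAC -det_mulmx mulmxV // det1 mul1r.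
by rewrite det_diag; apply: eq_bigr => i _; rewrite mxE.
Qed.

(** Source of all integrality: [horner_mx A g] has integer entries, so the sum and the product of
    [g] over the spectrum are integers. *)
Lemma int_mx_simple_spectrum (F : numFieldType) n (A : 'M[int]_n.+1) (rs : seq F)
    (g : {poly int}) : uniq rs ->
  map_poly intr (char_poly A) = \prod_(r <- rs) ('X - r%:P) ->
  (\tr (horner_mx A g))%:~R = \sum_(r <- rs) (map_poly intr g).[r] /\
  (\det (horner_mx A g))%:~R = \prod_(r <- rs) (map_poly intr g).[r].
Proof.
move=> rsU AE; rewrite -trace_map_mx -det_map_mx map_horner_mx.
by apply: horner_mx_simple_spectrum => //; rewrite -map_char_poly.
Qed.

Lemma irreducible_separable (q : {poly rat}) : irreducible_poly q -> separable_poly q.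
Proof.
move=> qirr; rewrite unlock; apply/negPn/negP => ncop.
have [q1 /(_ _ ncop (dvdp_gcdl _ _)) gq] := qirr.
have qq' : q %| q^`() by rewrite -(eqp_dvdl _ gq) dvdp_gcdr.
have q'0 : q^`() != 0.
  apply: contraTneq q1 => q'0; have := coef_deriv q (size q).-2.
  rewrite q'0 coef0 => /esym/eqP; rewrite mulrn_eq0 /= => /eqP q0.
  apply/negP => q1; move: q0.
  rewrite (_ : (size q).-2.+1 = (size q).-1); last by case: (size q) q1 => [|[|m]].
  by move/eqP; rewrite -/(lead_coef q) lead_coef_eq0 (negPf (irredp_neq0 qirr)).
by have := dvdp_leq q'0 qq'; rewrite leqNgt lt_size_deriv // irredp_neq0.
Qed.

(** The reciprocal polynomial [H] vanishes at [a], because [a^-1] is a root of [q]; by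
    irreducibility it vanishes at every root of [q]. *)
Lemma irreducible_inv_root (C : numClosedFieldType) (q : {poly rat}) (a z : C) :
  irreducible_poly q -> z != 0 -> a != 0 -> root (map_poly ratr q) a ->
  root (map_poly ratr q) a^-1 ->
  root (map_poly ratr q) z -> root (map_poly ratr q) z^-1.
Proof.
move=> qirr z0 a0 qa qaV qz.
have [m sq] : exists m, size q = m.+1.
  by case: qirr => s1 _; exists (size q).-1; case: (size q) s1.
pose H := \poly_(i < m.+1) q`_(m - i).
have HE (x : C) : x != 0 ->
    (map_poly ratr H).[x] = x ^+ m * (map_poly (ratr : rat -> C) q).[x^-1].
  move=> x0.
  have -> : map_poly ratr H = \poly_(i < m.+1) ratr q`_(m - i) :> {poly C}.
    apply/polyP => i; rewrite coef_map !coef_poly; case: ifP => // _.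
    exact: (rmorph0 (ratr : {rmorphism rat -> C})).
  rewrite horner_poly horner_coef size_map_poly sq.
  rewrite mulr_sumr (reindex_inj rev_ord_inj) /=; apply: eq_bigr => i _.
  have im : (i <= m)%N by rewrite -ltnS.
  rewrite coef_map subSS subKn // mulrCA; congr (_ * _).
  by rewrite exprVn expfB_cond // (negPf x0).
have : root (map_poly ratr H) z.
  by apply: irreducible_root_transfer qirr qa qz _; rewrite rootE HE // (eqP qaV) mulr0.
by rewrite rootE HE // mulf_eq0 expf_eq0 (negPf z0) andbF.
Qed.

Lemma irreducible_no_rat_root (C : numClosedFieldType) (q : {poly rat}) (c : rat) :
  irreducible_poly q -> (2 < size q)%N -> ~~ root (map_poly (ratr : rat -> C) q) (ratr c).
Proof.
move=> qirr q2; apply/negP; rewrite fmorph_root -dvdp_XsubCl => dq.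
have [_ /(_ _ _ dq)] := qirr; rewrite size_XsubC => /(_ isT) /eqp_size.
by rewrite size_XsubC => sq; rewrite -sq in q2.
Qed.

Section SalemSpectrum.
Context (R : realType) (n : nat) (alpha : R) (A : 'M[int]_n.+1).
Hypotheses (n2 : (2 < n.+1)%N) (Aalpha : root (map_poly intr (char_poly A)) alpha)
  (salem : salem_number alpha) (deg : has_degree alpha n.+1)
  (inv_conj : forall q : {poly rat},
     root (map_poly ratr q) alpha -> root (map_poly ratr q) alpha^-1).

Local Notation C := R[i].
Local Notation "p ^Q" := (map_poly (ratr : rat -> C) p) (at level 2).
Local Notation "p ^Z" := (map_poly (intr : int -> C) p) (at level 2).

Lemma root_complex (q : {poly rat}) (x : R) :
  root q^Q x%:C = root (map_poly (ratr : rat -> R) q) x.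
Proof.
have -> : q^Q = map_poly (real_complex R) (map_poly (ratr : rat -> R) q).
  by rewrite -map_poly_comp; apply: eq_map_poly => c /=; rewrite fmorph_rat.
by rewrite fmorph_root.
Qed.

(** Since [alpha^-1] is a conjugate, the conjugates are closed under inversion; one that differs
    from [alpha] and [alpha^-1] has modulus at most 1, and so has its inverse. Conjugates on the
    circle are not real, as 1 and -1 are rational, so those in the upper half plane represent each
    complex conjugate pair once. *)
Lemma salem_spectrum : exists (q : {poly rat}) (zs : seq C),
  [/\ irreducible_poly q, root q^Q alpha%:C,
      forall z, root q^Q z -> [\/ z = alpha%:C, z = alpha%:C^-1 | `|z| = 1],
      [/\ uniq zs, zs != [::],
      {in zs, forall z, root q^Q z /\ `|z| = 1} & {in zs, forall z, 0 < complex.Im z}]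
    & (char_poly A)^Z =
      \prod_(r <- alpha%:C :: alpha%:C^-1 :: zs ++ map conjc zs) ('X - r%:P) /\
      uniq (alpha%:C :: alpha%:C^-1 :: zs ++ map conjc zs) /\
      {in alpha%:C :: alpha%:C^-1 :: zs ++ map conjc zs, forall z, root q^Q z}].
Proof.
have [a1 _ conj_le [zu [q0 [_ qirr0 qa0] qzu] zu1]] := salem.
have [q [qm qirr qa] sq] := deg.
have qaC : root q^Q alpha%:C by rewrite root_complex.
have a0 : alpha != 0 by rewrite gt_eqF // (lt_trans ltr01).
have a0C : alpha%:C != 0 :> C by rewrite fmorph_eq0.
have qaVC : root q^Q (alpha%:C^-1).
  by rewrite -fmorphV root_complex inv_conj.
have qzuC : root q^Q zu by apply: irreducible_root_transfer qirr0 qa0 qzu _.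
have sq2 : (2 < size q)%N by rewrite sq; exact: ltnW.
have q0C : ~~ root q^Q 0.
  by rewrite -(rmorph0 (ratr : {rmorphism rat -> C})) irreducible_no_rat_root.
have rootsP z : root q^Q z -> [\/ z = alpha%:C, z = alpha%:C^-1 | `|z| = 1].
  move=> qz; have z0 : z != 0 by apply: contraTneq qz => ->.
  have [->|za] := eqVneq z alpha%:C; first by constructor 1.
  have [->|zaV] := eqVneq z alpha%:C^-1; first by constructor 2.
  have qzV := irreducible_inv_root qirr z0 a0C qaC qaVC qz.
  have zle : `|z| <= 1 by apply: conj_le => //; exists q.
  have zVle : `|z^-1| <= 1.
    apply: conj_le; first by exists q.
    by apply: contra zaV => /eqP <-; rewrite invrK.
  constructor 3; apply/eqP; rewrite eq_le zle /=.
  by rewrite normfV invf_le1 ?normr_gt0 in zVle.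
(* [q] divides the characteristic polynomial, and both are monic of degree [n.+1]. *)
have chiE : (char_poly A)^Z = q^Q.
  have -> : (char_poly A)^Z = (map_poly (intr : int -> rat) (char_poly A))^Q.
    by rewrite -map_poly_comp; apply: eq_map_poly => c /=; rewrite ratr_int.
  congr (_ ^Q); apply/eqP; rewrite -eqp_monic //; last first.
    by apply: monic_map; apply: char_poly_monic.
  rewrite eqp_sym -dvdp_size_eqp.
    by rewrite sq size_map_inj_poly ?size_char_poly //; apply: intr_inj.
  apply: (irreducible_dvd_root qirr qaC).
  rewrite root_complex -map_poly_comp.
  by rewrite (eq_map_poly (g := intr)) // => c /=; rewrite ratr_int.
have [rs qE] := closed_field_poly_normal q^Q.
rewrite (_ : lead_coef _ = 1) ?scale1r in qE; last first.
  by apply/eqP; rewrite -monicE monic_map.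
have rsU : uniq rs.
  by rewrite -separable_prod_XsubC -qE separable_map irreducible_separable.
have mem_rs z : (z \in rs) = root q^Q z by rewrite qE root_prod_XsubC.
pose zs := [seq z <- rs | 0 < complex.Im z].
have Im0 z : root q^Q z -> `|z| = 1 -> complex.Im z != 0.
  move=> qz z1; apply/eqP; case: z qz z1 => x y /= + + y0; rewrite {y}y0 => qx.
  rewrite complexr0 in qx; rewrite complexr0 normc_def /= expr0n addr0 sqrtr_sqr => -[] x1.
  have := irreducible_no_rat_root C 1 qirr; have := irreducible_no_rat_root C (-1) qirr.
  rewrite rmorphN rmorph1 => /(_ sq2)/negP qN1 /(_ sq2)/negP q1.
  case: (ler0P x) x1 => _ xE.
    by apply: qN1; move: qx; rewrite -[x]opprK xE rmorphN rmorph1.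
  by apply: q1; move: qx; rewrite xE !rmorph1.
have invJ (z : C) : `|z| = 1 -> z^-1 = z^*%C.
  by move=> z1; rewrite invc_norm z1 expr1n invr1 mul1r.
have qconj z : root q^Q z -> `|z| = 1 -> root q^Q z^*%C.
  move=> qz z1; rewrite -invJ //; apply: irreducible_inv_root qaC qaVC qz => //.
  by rewrite -normr_eq0 z1 oner_eq0.
have real_norm (x : R) : `|x%:C| = 1 :> C -> root q^Q x%:C -> False.
  by move=> x1 qx; have := Im0 _ qx x1; rewrite /= eqxx.
have zsP z : z \in zs -> [/\ root q^Q z, `|z| = 1 & 0 < complex.Im z].
  rewrite mem_filter mem_rs => /andP[iz qz]; split => //.
  by case: (rootsP _ qz) => // zE; move: iz; rewrite zE -?fmorphV /= ltxx.
have zsE z : root q^Q z -> `|z| = 1 -> (z \in zs) || (z^*%C \in zs).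
  move=> qz z1; rewrite !mem_filter !mem_rs qz qconj // !andbT.
  by case: z qz z1 => x y qz z1 /=; rewrite oppr_gt0 orbC -neq_lt; apply: (Im0 _ qz z1).
have listU : uniq (alpha%:C :: alpha%:C^-1 :: zs ++ map conjc zs).
  rewrite /= cat_uniq filter_uniq // (map_inj_uniq (can_inj (@conjcK R))) filter_uniq // andbT /=.
  have notin (x : R) : x%:C \notin zs ++ map conjc zs.
    rewrite mem_cat; apply/norP; split; apply/negP.
      by move=> /zsP[_ _]; rewrite /= ltxx.
    by case/mapP => z /zsP[_ _ iz] E; move: iz; rewrite -(conjcK z) -E /= oppr0 ltxx.
  rewrite inE negb_or notin -fmorphV notin /= andbT; apply/andP; split.
    apply/eqP => /complexI aE; have : 1 < alpha^-1 by rewrite -aE.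
    by rewrite invf_gt1 ?(lt_trans ltr01) // ltNge ltW.
  apply/hasPn => z /mapP[w /zsP[_ _ iw] ->]; apply/negP => /zsP[_ _] /=.
  by case: w iw => x y /= iw; rewrite oppr_gt0 ltNge ltW.
exists q, zs; split => //; first split => //.
- exact: filter_uniq.
- apply/eqP => zs0; have := zsE _ qzuC zu1; rewrite zs0 !in_nil //.
- by move=> z /zsP[].
- by move=> z /zsP[].
have mem_list : rs =i alpha%:C :: alpha%:C^-1 :: zs ++ map conjc zs.
  move=> z; rewrite mem_rs !inE mem_cat; apply/idP/idP => [qz|].
    case: (rootsP _ qz) => [->|->|z1]; rewrite ?eqxx ?orbT //.
    case/orP: (zsE _ qz z1) => [->|zJ]; rewrite ?orbT //.
    by rewrite -[z in z \in map _ _]conjcK map_f ?orbT.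
  case/or4P => [/eqP->|/eqP->|/zsP[]|/mapP[w /zsP[qw w1 _] ->]] //.
  exact: qconj.
split; [|split => // z].
  by rewrite chiE qE; apply: perm_big; apply: uniq_perm.
by rewrite -mem_list mem_rs.
Qed.

End SalemSpectrum.

Lemma horner_int_complex (R : rcfType) (g : {poly int}) (x : R) :
  (map_poly (intr : int -> R[i]) g).[x%:C] = ((map_poly intr g).[x])%:C.
Proof.
have -> : map_poly (intr : int -> R[i]) g = map_poly (real_complex R) (map_poly intr g).
  by rewrite -map_poly_comp; apply: eq_map_poly => c /=; rewrite rmorph_int.
exact: horner_map.
Qed.

Lemma horner_int_conj (R : rcfType) (g : {poly int}) (z : R[i]) :
  (map_poly intr g).[z^*%C] = ((map_poly intr g).[z])^*%C.
Proof.
have {1}-> : map_poly (intr : int -> R[i]) g = map_poly (@conjc R) (map_poly intr g).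
  by rewrite -map_poly_comp; apply: eq_map_poly => c /=; rewrite rmorph_int.
exact: horner_map.
Qed.

(** Complex conjugate pairs merge into twice a real part in the trace and into a squared modulus in
    the norm, so the analysis only sees the representatives [zs]. *)
Lemma salem_conjugates (R : realType) (n : nat) (alpha : R) (A : 'M[int]_n.+1) :
  (2 < n.+1)%N -> root (map_poly intr (char_poly A)) alpha ->
  salem_number alpha -> has_degree alpha n.+1 ->
  (forall q : {poly rat},
     root (map_poly ratr q) alpha -> root (map_poly ratr q) alpha^-1) ->
  exists zs : seq R[i],
  [/\ uniq zs /\ zs != [::], {in zs, forall z, `|z| = 1},
      forall k l : R[i] -> nat, \prod_(z <- zs) z ^+ k z = \prod_(z <- zs) z ^+ l z ->
        {in zs, forall z, k z = l z},
      forall (g : {poly int}) m, exists K : int,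
        (map_poly intr g).[alpha] * alpha ^+ m +
        (map_poly intr g).[alpha^-1] * alpha ^- m +
        \sum_(z <- zs) complex.Re ((map_poly intr g).[z] * z ^+ m) *+ 2 = K%:~R
    & forall g : {poly int}, (map_poly intr g).[alpha] != 0 ->
        1 <= `|(map_poly intr g).[alpha]| * `|(map_poly intr g).[alpha^-1]| *
             \prod_(z <- zs) cabs (map_poly intr g).[z] ^+ 2].
Proof.
move=> n2 Aalpha salem deg inv_conj.
have a1 : 1 < alpha by case: salem.
have [q [zs [qirr qa rootsP [zsU zsN0 zsq zsI] [chiE [listU listq]]]]] :=
  salem_spectrum n2 Aalpha salem deg inv_conj.
exists zs; split => //.
- by move=> z /zsq[].
- move=> k l; apply: salem_conjugates_independent qirr qa _ rootsP _ zsU _.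
  + by rewrite -[1](rmorph1 (real_complex R)) ltcR.
  + by move=> z /zsq[].
  (* On the unit circle [z * w = 1] makes [w] the complex conjugate of [z], but both lie in the
     upper half plane. *)
  move=> z w zz ww; apply/eqP => zw1.
  have z0 : z != 0.
    by apply: contra_eq_neq zw1 => ->; rewrite mul0r eq_sym oner_eq0.
  have wE : w = z^*%C.
    by rewrite -[w](mulKf z0) zw1 mulr1 invc_norm (zsq _ zz).2 expr1n invr1 mul1r.
  have := zsI _ ww; have := zsI _ zz; rewrite wE; case: (z) => x y /=.
  by rewrite oppr_gt0 => /ltW; rewrite leNgt => /negP.
- move=> g m; have [] := int_mx_simple_spectrum (g * 'X^m) listU chiE.
  set K := \tr _ => trE _; exists K; apply: complexI.
  rewrite rmorph_int trE; rewrite !big_cons big_cat /= big_map -big_split /=.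
  rewrite rmorphM /= map_polyXn -fmorphV !hornerM !hornerXn !horner_int_complex.
  rewrite -!rmorphXn -!rmorphM /= exprVn addrA !rmorphD /= rmorph_sum /=.
  congr (_ + _); apply: eq_bigr => z _.
  rewrite !hornerM !hornerXn horner_int_conj -rmorphXn -rmorphM /= addcJ.
  by rewrite raddfMn /= mulr_natl.
move=> g g0; have [_] := int_mx_simple_spectrum g listU chiE.
set K := \det _ => detE.
have zs_le z : z \in zs -> (cabs (map_poly intr g).[z]) ^+ 2 = cabs (map_poly intr g).[z] * cabs (map_poly intr g).[z^*%C].
  by rewrite horner_int_conj cabs_conj expr2.
have nE : `|K%:~R| = `|(map_poly intr g).[alpha]| * `|(map_poly intr g).[alpha^-1]| *
             \prod_(z <- zs) cabs (map_poly intr g).[z] ^+ 2 :> R.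
  rewrite -(cabs_real K%:~R) rmorph_int detE cabs_prod !big_cons big_cat /= big_map -big_split /=.
  rewrite -fmorphV !horner_int_complex !cabs_real mulrA; congr (_ * _).
  by rewrite big_seq [RHS]big_seq; apply: eq_bigr => z zz; rewrite zs_le.
(* A nonzero integer has absolute value at least 1. If the norm were zero, [g] would vanish at some
   conjugate, hence at [alpha]. *)
rewrite -nE -intr_norm -[1]/(1%:~R) ler_int -gtz0_ge1 normr_gt0.
apply: contra_neq g0 => K0; move: detE; rewrite K0 => /esym/eqP.
rewrite prodf_seq_eq0 => /hasP[r /listq qr /= gr].
have gQ : map_poly (intr : int -> R[i]) g = map_poly ratr (map_poly (intr : int -> rat) g).
  by rewrite -map_poly_comp; apply: eq_map_poly => c /=; rewrite ratr_int.
have : root (map_poly (intr : int -> R[i]) g) alpha%:C.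
  by rewrite gQ; apply: irreducible_root_transfer qirr qr qa _; rewrite -gQ.
by rewrite rootE horner_int_complex => /eqP /complexI.
Qed.

(** * Weyl means of independent rotations *)

Section Bessel.
Context (R : realType).

(* J_0(x) = bessel0 (x ^ 2 / 4) *)
Definition bessel0_coeff (n : nat) : R := (-1) ^+ n / (n`!%:R ^+ 2).

Definition bessel0 (t : R) : R := limn (pseries bessel0_coeff t).

Definition bessel0' (t : R) : R := limn (pseries (pseries_diffs bessel0_coeff) t).

Definition bessel0'' (t : R) : R :=
  limn (pseries (pseries_diffs (pseries_diffs bessel0_coeff)) t).

Lemma pseries_fact_cvg (c : nat -> R) (x : R) :
  (forall n, `|c n| <= n`!%:R^-1) -> cvgn (pseries c x).
Proof.
move=> cle; apply: normed_cvg.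
apply: (series_le_cvg _ _ _ (is_cvg_series_exp_coeff `|x|)) => n /=.
- exact: normr_ge0.
- exact: exp_coeff_ge0.
- by rewrite normrM normrX /exp_coeff /= mulrC ler_wpM2l ?exprn_ge0.
Qed.

Lemma fact_ge1 n : 1 <= n`!%:R :> R.
Proof. by rewrite ler1n fact_gt0. Qed.

Lemma bessel0_coeff_bound n : `|bessel0_coeff n| <= n`!%:R^-1.
Proof.
rewrite /bessel0_coeff normrM normrX normrN1 expr1n mul1r ger0_norm ?invr_ge0 ?exprn_ge0 //.
have := fact_ge1 n => f1; have f0 := lt_le_trans ltr01 f1.
by rewrite lef_pV2 ?posrE ?exprn_gt0 // ler_eXnr.
Qed.

Lemma bessel0_coeffS n :
  bessel0_coeff n.+1 = - bessel0_coeff n / (n.+1%:R ^+ 2).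
Proof.
rewrite /bessel0_coeff factS natrM exprS.
have f0 : n`!%:R != 0 :> R by rewrite pnatr_eq0 -lt0n fact_gt0.
have n0 : n.+1%:R != 0 :> R by rewrite pnatr_eq0.
by field; rewrite f0 nat1r n0.
Qed.

Lemma bessel0_diffs_bound n : `|pseries_diffs bessel0_coeff n| <= n`!%:R^-1.
Proof.
rewrite /pseries_diffs bessel0_coeffS.
have n0 : n.+1%:R != 0 :> R by rewrite pnatr_eq0.
have -> : n.+1%:R * (- bessel0_coeff n / n.+1%:R ^+ 2) = - bessel0_coeff n / n.+1%:R.
  by rewrite expr2 invfM mulrCA mulrA mulrA mulfK.
rewrite normrM normrN (le_trans _ (bessel0_coeff_bound n)) // ler_piMr //.
by rewrite ger0_norm ?invr_ge0 // invf_le1 // ler1n.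
Qed.

Lemma bessel0_diffs2_bound n :
  `|pseries_diffs (pseries_diffs bessel0_coeff) n| <= n`!%:R^-1.
Proof.
have n0 : n.+1%:R != 0 :> R by rewrite pnatr_eq0.
rewrite {1}/pseries_diffs normrM ger0_norm //.
rewrite (le_trans (ler_wpM2l _ (bessel0_diffs_bound _))) //.
by rewrite factS natrM invfM mulVKf.
Qed.

Lemma is_derive_bessel0 (x : R) : is_derive x (1 : R) bessel0 (bessel0' x).
Proof.
apply: (@pseries_snd_diffs _ bessel0_coeff (`|x| + 1) x).
- by apply: pseries_fact_cvg => n; exact: bessel0_coeff_bound.
- by apply: pseries_fact_cvg => n; exact: bessel0_diffs_bound.
- by apply: pseries_fact_cvg => n; exact: bessel0_diffs2_bound.
- by rewrite [`|_ + 1|]ger0_norm ?ltrDl // addr_ge0.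
Qed.

Lemma bessel0_diffs3_bound n :
  `|pseries_diffs (pseries_diffs (pseries_diffs bessel0_coeff)) n| <= n`!%:R^-1.
Proof.
have n0 : n.+1%:R != 0 :> R by rewrite pnatr_eq0.
rewrite {1}/pseries_diffs normrM ger0_norm //.
rewrite (le_trans (ler_wpM2l _ (bessel0_diffs2_bound _))) //.
by rewrite factS natrM invfM mulVKf.
Qed.

Lemma is_derive_bessel0' (x : R) : is_derive x (1 : R) bessel0' (bessel0'' x).
Proof.
apply: (@pseries_snd_diffs _ (pseries_diffs bessel0_coeff) (`|x| + 1) x).
- by apply: pseries_fact_cvg => n; exact: bessel0_diffs_bound.
- by apply: pseries_fact_cvg => n; exact: bessel0_diffs2_bound.
- by apply: pseries_fact_cvg => n; exact: bessel0_diffs3_bound.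
- by rewrite [`|_ + 1|]ger0_norm ?ltrDl // addr_ge0.
Qed.

(** Bessel's equation in the variable [x ^ 2 / 4]. The partial sums of the three series already
    cancel term by term, by [bessel0_coeffS]. *)
Lemma bessel0_ode (x : R) : x * bessel0'' x + bessel0' x + bessel0 x = 0.
Proof.
have C0 := @pseries_fact_cvg _ x bessel0_coeff_bound.
have C1 := @pseries_fact_cvg _ x bessel0_diffs_bound.
have C2 := @pseries_fact_cvg _ x bessel0_diffs2_bound.
have E := pseries_diffs_equiv C2.
have S : (fun n => x * series (fun i => i%:R * pseries_diffs bessel0_coeff i * x ^+ i.-1) n
   + pseries (pseries_diffs bessel0_coeff) x n + pseries bessel0_coeff x n) @ \oo --> x * bessel0'' x + bessel0' x + bessel0 x.
  apply: cvgD; [apply: cvgD|] => //.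
  by apply: cvgM; [exact: cvg_cst|exact: E].
have Z : (fun n => x * series (fun i => i%:R * pseries_diffs bessel0_coeff i * x ^+ i.-1) n
   + pseries (pseries_diffs bessel0_coeff) x n + pseries bessel0_coeff x n) = fun=> 0.
  apply/funext => n; rewrite /pseries /series /= mulr_sumr -!big_split /=.
  apply: big1 => i _; have i0 : i.+1%:R != 0 :> R by rewrite pnatr_eq0.
  have -> : x * (i%:R * pseries_diffs bessel0_coeff i * x ^+ i.-1) =
            i%:R * pseries_diffs bessel0_coeff i * x ^+ i.
    case: i {i0} => [|i]; first by rewrite !mul0r mulr0.
    by rewrite /= exprS mulrCA.
  rewrite -!mulrDl /pseries_diffs bessel0_coeffS -nat1r.
  by apply/eqP; rewrite mulf_eq0; apply/orP; left; apply/eqP; field; rewrite nat1r.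
by move: S; rewrite Z => S; rewrite -(cvg_lim _ S) // lim_cst.
Qed.

(** A Lyapunov function for the Bessel equation: its derivative is minus a square, and for [t >= 0]
    it dominates the square of [bessel0]. This bounds [bessel0] on the whole half-line without
    asymptotics. *)
Definition bessel0_energy (t : R) : R := bessel0 t ^+ 2 + t * bessel0' t ^+ 2.

Lemma is_derive_bessel0_energy (x : R) :
  is_derive x (1 : R) bessel0_energy (- bessel0' x ^+ 2).
Proof.
have H0 := is_derive_bessel0 x; have H1 := is_derive_bessel0' x.
have -> : bessel0_energy = bessel0 ^+ 2 + id * (bessel0' ^+ 2).
  by apply/funext => t; rewrite /bessel0_energy.
apply: (is_derive_eq (is_deriveD (is_deriveX 2 H0)
  (is_deriveM (is_derive_id x (1 : R)) (is_deriveX 2 H1)))).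
have := bessel0_ode x; rewrite exprfctE.
move: (bessel0 x) (bessel0' x) (bessel0'' x) => f f1 f2 E.
rewrite /GRing.scale /= !expr1 mulr1.
have -> : f = - (x * f2 + f1) by apply/eqP; rewrite -addr_eq0 addrC E.
by ring.
Qed.

Lemma bessel0_energy_nincr (s t : R) : s <= t -> bessel0_energy t <= bessel0_energy s.
Proof.
move=> st; have [|c _ E] := MVT_segment st (fun x _ => is_derive_bessel0_energy x).
  apply: derivable_within_continuous => x _; exact: (@ex_derive _ _ _ _ _ _ _ (is_derive_bessel0_energy x)).
by rewrite -subr_le0 E mulNr oppr_le0 mulr_ge0 ?sqr_ge0 // subr_ge0.
Qed.

Lemma pseries_0 (c : nat -> R) : limn (pseries c 0) = c 0%N.
Proof.
apply: cvg_lim => //; rewrite -(cvg_shiftn 1) /=.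
have -> : (fun n => pseries c 0 (n + 1)%N) = fun=> c 0%N.
  apply/funext => n; rewrite addn1 /pseries /series /= big_nat_recl //= expr0 mulr1.
  by rewrite big1 ?addr0 // => i _; rewrite exprS mul0r mulr0.
exact: cvg_cst.
Qed.

Lemma bessel0_0 : bessel0 0 = 1.
Proof. by rewrite /bessel0 pseries_0 /bessel0_coeff fact0 expr0 expr1n divr1. Qed.

Lemma bessel0'_0 : bessel0' 0 = -1.
Proof.
rewrite /bessel0' pseries_0 /pseries_diffs mul1r /bessel0_coeff.
by rewrite expr1 (_ : 1`! = 1%N) // expr1n divr1.
Qed.

(** Strictness is won near 0, where [bessel0'] is close to -1; afterwards the energy does not
    increase. *)
Lemma bessel0_energy_lt1 (t : R) : 0 < t -> bessel0_energy t < 1.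
Proof.
move=> t0.
have cont : {for 0, continuous bessel0'}.
  apply/differentiable_continuous/derivable1_diffP.
  exact: (@ex_derive _ _ _ _ _ _ _ (is_derive_bessel0' 0)).
have : \forall x \near (0 : R), bessel0' x < 0.
  by apply: (cvgr_lt _ cont); rewrite bessel0'_0 oppr_lt0.
rewrite -nbhs_nearE nbhs_ballP => -[e /= e0 He].
pose s := Num.min t (e / 2).
have s0 : 0 < s by rewrite lt_min t0 divr_gt0.
have [|c] := MVT s0 (fun x _ => is_derive_bessel0_energy x).
  apply: derivable_within_continuous => x _; exact: (@ex_derive _ _ _ _ _ _ _ (is_derive_bessel0_energy x)).
rewrite in_itv /= => /andP[c0 cs] E.
have c_neg : bessel0' c < 0.
  apply: He; rewrite /ball /= sub0r normrN gtr0_norm // (lt_le_trans cs) //.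
  by rewrite ge_min; apply/orP; right; lra.
rewrite (le_lt_trans (bessel0_energy_nincr (_ : s <= t))) ?ge_min ?lexx //.
have <- : bessel0_energy 0 = 1 by rewrite /bessel0_energy mul0r addr0 bessel0_0 expr1n.
rewrite -subr_lt0 E subr0 mulNr oppr_lt0 mulr_gt0 // exprn_even_gt0 //= lt_eqF //.
Qed.

Lemma bessel0_sqr_le (t : R) : 0 <= t -> bessel0 t ^+ 2 <= bessel0_energy t.
Proof. by move=> t0; rewrite lerDl mulr_ge0 ?sqr_ge0. Qed.

Lemma bessel0_le1 (t : R) : 0 <= t -> `|bessel0 t| <= 1.
Proof.
move=> t0; rewrite -(@ler_pXn2r _ 2) ?nnegrE // expr1n real_normK ?num_real //.
rewrite (le_trans (bessel0_sqr_le t0)) // (le_trans (bessel0_energy_nincr t0)) //.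
by rewrite /bessel0_energy mul0r addr0 bessel0_0 expr1n.
Qed.

Lemma bessel0_lt1 (t0 : R) : 0 < t0 ->
  exists2 kappa, 0 < kappa & forall t, t0 <= t -> `|bessel0 t| <= 1 - kappa.
Proof.
move=> t0_gt0; have E1 := bessel0_energy_lt1 t0_gt0.
exists (1 - Num.sqrt (bessel0_energy t0)).
  by rewrite subr_gt0 -sqrtr1 ltr_sqrt.
move=> t tt0; rewrite opprB addrC subrK -sqrtr_sqr ler_wsqrtr //.
by rewrite (le_trans (bessel0_sqr_le (le_trans (ltW t0_gt0) tt0))) // bessel0_energy_nincr.
Qed.

End Bessel.

(** * Truncated exponential series *)

Definition exp_sum (F : fieldType) (K : nat) (a : F) : F :=
  \sum_(k < K) a ^+ k / k`!%:R.

Definition exp_poly (F : fieldType) (K : nat) (a : F) : {poly F} :=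
  \poly_(k < K) (a ^+ k / k`!%:R).

Lemma exp_poly_horner1 (F : fieldType) K (a : F) : (exp_poly K a).[1] = exp_sum K a.
Proof.
by rewrite horner_poly; apply: eq_bigr => k _; rewrite expr1n mulr1.
Qed.

Lemma exp_polyM_coef (F : numFieldType) K (a b : F) m : (m < K)%N ->
  (exp_poly K a * exp_poly K b)`_m = (a + b) ^+ m / m`!%:R.
Proof.
move=> mK; rewrite coefMr exprDn mulr_suml; apply: eq_bigr => i _.
have im : (i <= m)%N by rewrite -ltnS.
rewrite !coef_poly (leq_ltn_trans im mK) (leq_ltn_trans (leq_subr _ _) mK).
have f0 k : k`!%:R != 0 :> F by rewrite pnatr_eq0 -lt0n fact_gt0.
rewrite -(bin_fact im) mulrnAl -mulr_natr !natrM.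
have b0 : 'C(m, i)%:R != 0 :> F by rewrite pnatr_eq0 -lt0n bin_gt0.
by field; rewrite b0 !f0.
Qed.

(** Below degree [K] the product of two truncations has the coefficients of the exponential of
    [a + b]; those of degree [K] and more form the error. *)
Lemma exp_sumM_split (F : numFieldType) K (a b : F) :
  exp_sum K a * exp_sum K b = exp_sum K (a + b) +
    \sum_(K <= m < K + K) (exp_poly K a * exp_poly K b)`_m.
Proof.
have sz : (size (exp_poly K a * exp_poly K b)%R <= K + K)%N.
  rewrite (leq_trans (size_polyMleq _ _)) // (leq_trans (leq_pred _)) //.
  by rewrite leq_add // size_poly.
rewrite -!exp_poly_horner1 -hornerM (horner_coef_wide _ sz).
rewrite -(big_mkord xpredT (fun i => (exp_poly K a * exp_poly K b)`_i * 1 ^+ i)).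
rewrite (big_cat_nat _ (leq_addr K K)) //=; congr (_ + _).
  rewrite exp_poly_horner1 big_mkord; apply: eq_bigr => i _.
  by rewrite expr1n mulr1 exp_polyM_coef.
by apply: eq_bigr => i _; rewrite expr1n mulr1.
Qed.

Section ExpTail.
Context (R : realType).
Implicit Types (x y : R) (a b w : R[i]) (K : nat).

Lemma coef_exp_polyM_cabs K a b m :
  cabs (exp_poly K a * exp_poly K b)`_m <=
  (exp_poly K (cabs a) * exp_poly K (cabs b))`_m.
Proof.
rewrite !coefM (le_trans (cabs_sum _ _ _)) //; apply: ler_sum => i _.
have coef_cabs c j : cabs (exp_poly K c)`_j = (exp_poly K (cabs c))`_j.
  rewrite !coef_poly; case: ifP => _; last exact: cabs0.
  by rewrite cabsM cabsX cabsV cabs_nat.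
by rewrite cabsM !coef_cabs.
Qed.

(** The error is a polynomial in [a] and [b] with nonnegative coefficients, so it is dominated by
    its value at the moduli. *)
Lemma exp_sumM_close K a b :
  cabs (exp_sum K a * exp_sum K b - exp_sum K (a + b)) <=
  exp_sum K (cabs a) * exp_sum K (cabs b) - exp_sum K (cabs a + cabs b).
Proof.
rewrite !exp_sumM_split ![exp_sum K (_ + _) + _]addrC !addrK.
rewrite (le_trans (cabs_sum _ _ _)) //; apply: ler_sum => i _.
exact: coef_exp_polyM_cabs.
Qed.

Lemma exp_sum_series K x : exp_sum K x = series (exp_coeff x) K.
Proof. by rewrite /series /= big_mkord. Qed.

Lemma exp_sum_cvg x : (fun K => exp_sum K x) @ \oo --> expR x.
Proof.
rewrite (_ : (fun K => exp_sum K x) = series (exp_coeff x)); last first.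
  by apply/funext => K; rewrite exp_sum_series.
by rewrite /expR; apply: is_cvg_series_exp_coeff.
Qed.

Lemma exp_sum_diff_ge x y K L : 0 <= x <= y -> (K <= L)%N ->
  exp_sum K y - exp_sum K x <= exp_sum L y - exp_sum L x.
Proof.
move=> /andP[x0 xy] KL; rewrite /exp_sum -!sumrB -(subnKC KL).
rewrite big_split_ord /= lerDl; apply: sumr_ge0 => i _.
rewrite subr_ge0 ler_wpM2r ?invr_ge0 // lerXn2r ?nnegrE //.
exact: le_trans x0 xy.
Qed.

Definition exp_tail K x : R := expR x - exp_sum K x.

Lemma exp_tail_mono K x y : 0 <= x <= y -> exp_tail K x <= exp_tail K y.
Proof.
move=> xy; rewrite /exp_tail.
suff : exp_sum K y - exp_sum K x <= expR y - expR x by lra.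
have cv : (fun K => exp_sum K y - exp_sum K x) @ \oo --> expR y - expR x.
  by apply: cvgB; exact: exp_sum_cvg.
rewrite -(cvg_lim _ cv) //.
apply: (nondecreasing_cvgn_le (u_ := fun K => exp_sum K y - exp_sum K x)).
  by move=> k l kl; apply: exp_sum_diff_ge.
by apply/cvg_ex; eexists; exact: cv.
Qed.

Lemma exp_tail_cvg x : (fun K => exp_tail K x) @ \oo --> 0.
Proof. by rewrite -(subrr (expR x)); apply: cvgB; [exact: cvg_cst|exact: exp_sum_cvg]. Qed.

Lemma exp_sum_le K x : 0 <= x -> exp_sum K x <= expR x.
Proof.
move=> x0; rewrite -(cvg_lim _ (@exp_sum_cvg x)) //.
apply: (nondecreasing_cvgn_le (u_ := fun K => exp_sum K x)).
  move=> k l kl; rewrite /exp_sum -(subnKC kl).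
  rewrite big_split_ord /= lerDl; apply: sumr_ge0 => i _.
  by rewrite mulr_ge0 ?exprn_ge0 ?invr_ge0.
by apply/cvg_ex; eexists; exact: exp_sum_cvg.
Qed.

Lemma expi_coeff x n :
  ('i%C * x%:C) ^+ n / n`!%:R = cos_coeff x n +i* sin_coeff x n.
Proof.
have E : ('i%C * x%:C) ^+ n / n`!%:R = 'i%C ^+ n * (x ^+ n / n`!%:R)%:C.
  by rewrite exprMn -mulrA rmorphM /= rmorphXn fmorphV /= rmorph_nat.
rewrite E /cos_coeff /sin_coeff /=.
have := odd_double_half n; case: (odd n) => /= nE.
  have -> : n.-1./2 = n./2 by rewrite -{1}nE add1n /= doubleK.
  have -> : 'i%C ^+ n = 'i%C * ((-1) ^+ n./2)%:C :> R[i].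
    by rewrite -{1}nE add1n exprS -mul2n exprM sqr_i rmorphXn rmorphN1.
  rewrite -mulrA -rmorphM /= !mul0r mul1r -mulrA.
  by apply/eqP; rewrite eq_complex /=; apply/andP; split; apply/eqP; ring.
have -> : 'i%C ^+ n = ((-1) ^+ n./2)%:C :> R[i].
  by rewrite -{1}nE add0n -mul2n exprM sqr_i rmorphXn rmorphN1.
rewrite -rmorphM /= !mul0r mul1r -mulrA.
by apply/eqP; rewrite eq_complex /= !eqxx.
Qed.

Lemma Re_exp_sum K x : complex.Re (exp_sum K ('i%C * x%:C)) = series (cos_coeff x) K.
Proof.
rewrite /exp_sum (raddf_sum (@complex.Re R : Rcomplex R -> R)) /series /= big_mkord.
by apply: eq_bigr => k _; rewrite expi_coeff.
Qed.

Lemma Im_exp_sum K x : complex.Im (exp_sum K ('i%C * x%:C)) = series (sin_coeff x) K.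
Proof.
rewrite /exp_sum (raddf_sum (@complex.Im R : Rcomplex R -> R)) /series /= big_mkord.
by apply: eq_bigr => k _; rewrite expi_coeff.
Qed.

Lemma exp_sum_close K L a : (K <= L)%N ->
  cabs (exp_sum L a - exp_sum K a) <= exp_sum L (cabs a) - exp_sum K (cabs a).
Proof.
move=> KL; rewrite /exp_sum -(subnKC KL) !big_split_ord /= ![\sum_(i < K) _ + _]addrC !addrK.
rewrite (le_trans (cabs_sum _ _ _)) //; apply: ler_sum => i _.
by rewrite cabsM cabsX cabsV cabs_nat.
Qed.

Lemma cvg_dist_le (u : nat -> R) (l c t : R) K :
  u @ \oo --> l -> (forall L, (K <= L)%N -> `|u L - c| <= t) -> `|l - c| <= t.
Proof.
move=> ul uc; have cv : (fun n => `|u n - c|) @ \oo --> `|l - c|.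
  by apply: cvg_norm; apply: cvgB => //; exact: cvg_cst.
apply: (cvgr_to_le cv); exists K => // L /= KL; exact: uc.
Qed.

(** The factor 2 comes from bounding the cosine series and the sine series separately. *)
Lemma expi_exp_sum K x : cabs (expi x - exp_sum K ('i%C * x%:C)) <= 2 * exp_tail K `|x|.
Proof.
have ab : cabs ('i%C * x%:C) = `|x| by rewrite cabsM cabs_i cabs_real mul1r.
have close L : (K <= L)%N ->
    cabs (exp_sum L ('i%C * x%:C) - exp_sum K ('i%C * x%:C)) <= exp_tail K `|x|.
  move=> KL; rewrite (le_trans (exp_sum_close _ KL)) // ab lerD2r.
  exact: exp_sum_le.
rewrite (le_trans (cabs_le_sqrt2 _)) // mulr2n mulrDl !mul1r lerD //.
  rewrite (raddfB (@complex.Re R : Rcomplex R -> R)) /= Re_exp_sum.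
  apply: (@cvg_dist_le (series (cos_coeff x)) _ _ _ K).
    by rewrite cos.unlock; apply: is_cvg_series_cos_coeff.
  move=> L KL; rewrite -!Re_exp_sum -(raddfB (@complex.Re R : Rcomplex R -> R)).
  by rewrite (le_trans (Re_le_cabs _)) // close.
rewrite (raddfB (@complex.Im R : Rcomplex R -> R)) /= Im_exp_sum.
apply: (@cvg_dist_le (series (sin_coeff x)) _ _ _ K).
  by rewrite sin.unlock; apply: is_cvg_series_sin_coeff.
move=> L KL; rewrite -!Im_exp_sum -(raddfB (@complex.Im R : Rcomplex R -> R)).
by rewrite (le_trans (Im_le_cabs _)) // close.
Qed.

(* Factoring exp(2i Re w) = exp(i w) exp(i w^* ) separates the powers of w
   from those of its conjugate. *)
Lemma expi_2Re K w :
  cabs (expi (complex.Re w *+ 2) - exp_sum K ('i%C * w) * exp_sum K ('i%C * w^*%C)) <=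
  3 * exp_tail K (cabs w *+ 2).
Proof.
have wE : 'i%C * (complex.Re w *+ 2)%:C = 'i%C * w + 'i%C * w^*%C.
  by rewrite -mulrDr addcJ raddfMn /= mulr_natl.
set x := complex.Re w *+ 2; set S := exp_sum K ('i%C * x%:C).
have xw : `|x| <= cabs w *+ 2 by rewrite normrMn lerMn2r Re_le_cabs.
rewrite -(subrKA S) (le_trans (cabsD _ _)) //.
(* Two tails pay for truncating the exponential of the sum, one for factoring the truncation. *)
rewrite -[3]/(2 + 1)%:R natrD mulrDl mul1r lerD //.
  rewrite (le_trans (expi_exp_sum _ _)) // ler_wpM2l //.
  by rewrite exp_tail_mono // normr_ge0 xw.
rewrite -cabsN opprB /S wE (le_trans (exp_sumM_close _ _ _)) //.
rewrite !cabsM cabs_i cabs_conj !mul1r -mulr2n lerD2r.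
rewrite mulr2n expRD ler_pM ?exp_sum_le ?cabs_ge0 //.
  by apply: sumr_ge0 => k _; rewrite mulr_ge0 ?exprn_ge0 ?invr_ge0 ?cabs_ge0.
by apply: sumr_ge0 => k _; rewrite mulr_ge0 ?exprn_ge0 ?invr_ge0 ?cabs_ge0.
Qed.

End ExpTail.

(** * Cesaro means *)

Definition has_mean (R : realType) (u : nat -> R[i]) (l : R[i]) : Prop :=
  forall eps : R, 0 < eps -> exists N0 : nat, forall N : nat, (N0 <= N)%N ->
    cabs (\sum_(n < N) u n - N%:R * l) <= eps * N%:R.

Section Mean.
Context (R : realType).
Implicit Types (u v : nat -> R[i]) (l m : R[i]).

Lemma has_mean0 : has_mean (fun=> 0 : R[i]) 0.
Proof.
by move=> e e0; exists 0%N => N _; rewrite big1 // mulr0 subrr cabs0 mulr_ge0 // ltW.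
Qed.

Lemma has_meanD u v l m : has_mean u l -> has_mean v m ->
  has_mean (fun n => u n + v n) (l + m).
Proof.
move=> ul vm e e0; have e2 : 0 < e / 2 by rewrite divr_gt0.
have [N1 H1] := ul _ e2; have [N2 H2] := vm _ e2.
exists (maxn N1 N2) => N; rewrite geq_max => /andP[/H1 h1 /H2 h2].
rewrite big_split /= mulrDr opprD addrACA (le_trans (cabsD _ _)) //.
by rewrite (le_trans (lerD h1 h2)) // -mulrDl -splitr.
Qed.

Lemma has_meanZ (c : R[i]) u l : has_mean u l -> has_mean (fun n => c * u n) (c * l).
Proof.
move=> ul e e0; have c0 : 0 < cabs c + 1 by rewrite ltr_wpDl ?cabs_ge0.
have [N1 H1] := ul _ (divr_gt0 e0 c0); exists N1 => N /H1 h1.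
rewrite -mulr_sumr mulrCA -mulrBr cabsM.
have := ler_wpM2l (cabs_ge0 c) h1; move/le_trans; apply.
rewrite mulrA ler_wpM2r // mulrCA ler_piMr ?(ltW e0) //.
by rewrite ler_pdivrMr // mul1r lerDl.
Qed.

Lemma has_mean_sum (I : finType) (P : pred I) (u : I -> nat -> R[i]) (l : I -> R[i]) :
  (forall i, P i -> has_mean (u i) (l i)) ->
  has_mean (fun n => \sum_(i | P i) u i n) (\sum_(i | P i) l i).
Proof.
move=> ul.
suff H (s : seq I) : has_mean (fun n => \sum_(i <- s | P i) u i n) (\sum_(i <- s | P i) l i).
  exact: H.
elim: s => [|i s IHs]; first by under eq_fun do rewrite big_nil; rewrite big_nil; apply: has_mean0.
under eq_fun do rewrite big_cons; rewrite big_cons.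
case: (boolP (P i)) => // Pi; exact: (has_meanD (ul _ Pi) IHs).
Qed.

(** Weyl's argument: the geometric sums are bounded by [2 / |z - 1|], independently of their
    length. *)
Lemma has_mean_geom (z : R[i]) : `|z| = 1 -> z != 1 -> has_mean (fun n => z ^+ n) 0.
Proof.
move=> z1 zN1 e e0.
have z10 : 0 < cabs (z - 1).
  rewrite lt_neqAle cabs_ge0 andbT eq_sym -(inj_eq (@complexI R)) cabsE normr_eq0.
  by rewrite subr_eq0.
have cz : cabs z = 1 by apply: complexI; rewrite cabsE.
have [N0 HN0] : exists N0 : nat, 2 / cabs (z - 1) / e <= N0%:R.
  by exists (Num.truncn (2 / cabs (z - 1) / e)).+1; rewrite ltW // truncnS_gt.
exists N0 => N N0N; rewrite mulr0 subr0.
have : cabs ((z - 1) * \sum_(n < N) z ^+ n) <= 2.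
  rewrite -subrX1 (le_trans (cabsD _ _)) // cabsN cabs1 cabsX cz expr1n.
  by rewrite -[2]/(1 + 1)%:R natrD.
rewrite cabsM mulrC -ler_pdivlMr // => /le_trans; apply.
by rewrite -ler_pdivrMl // mulrC (le_trans HN0) // ler_nat.
Qed.

Lemma has_mean_cst1 : has_mean (fun=> 1 : R[i]) 1.
Proof.
move=> e e0; exists 0%N => N _; rewrite sumr_const card_ord mulr1 subrr cabs0.
by rewrite mulr_ge0 // ltW.
Qed.

(** One [e] pays for replacing [u] by [v], the other for the convergence of the means of [v]. *)
Lemma has_mean_close u v l (e : R) : has_mean v l -> 0 < e ->
  (forall n, cabs (u n - v n) <= e) ->
  exists N0 : nat, forall N : nat, (N0 <= N)%N ->
    cabs (\sum_(n < N) u n) <= (cabs l + 2 * e) * N%:R.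
Proof.
move=> vl e0 uv; have [N0 H] := vl _ e0; exists N0 => N /H h.
have -> : \sum_(n < N) u n = \sum_(n < N) (u n - v n) +
    (\sum_(n < N) v n - N%:R * l) + N%:R * l.
  by rewrite sumrB; ring.
rewrite (le_trans (cabsD _ _)) // cabsM cabs_nat.
have h2 : cabs (\sum_(n < N) (u n - v n)) <= e * N%:R.
  rewrite (le_trans (cabs_sum _ _ _)) // (le_trans (ler_sum _ (fun (i : 'I_N) _ => uv i))) //.
  by rewrite sumr_const card_ord mulr_natr.
have := le_trans (cabsD _ _) (lerD h2 h) => h3.
by rewrite mulrDl [cabs l * _]mulrC [leRHS]addrC lerD2r (le_trans h3) // mulr2n !mulrDl mul1r.
Qed.

Lemma prod_close (I : Type) (s : seq I) (u v : I -> R[i]) (B delta : R) :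
  1 <= B -> 0 <= delta -> (forall i, cabs (u i) <= B) -> (forall i, cabs (v i) <= B) ->
  (forall i, cabs (u i - v i) <= delta) ->
  cabs (\prod_(i <- s) u i - \prod_(i <- s) v i) <= (size s)%:R * B ^+ size s * delta.
Proof.
move=> B1 d0 uB vB uv; have B0 := le_trans ler01 B1.
elim: s => [|i s IHs]; first by rewrite !big_nil subrr cabs0 !mul0r.
rewrite !big_cons; set U := \prod_(_ <- s) _; set V := \prod_(_ <- s) _.
have UE : cabs V <= B ^+ size s.
  rewrite cabs_prod; elim: (s) => [|j s' IH]; first by rewrite big_nil.
  by rewrite big_cons /= exprS ler_pM ?cabs_ge0 // prodr_ge0 // => *; exact: cabs_ge0.
have -> : u i * U - v i * V = u i * (U - V) + (u i - v i) * V by ring.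
rewrite (le_trans (cabsD _ _)) // !cabsM /=.
apply: (@le_trans _ _ (B * ((size s)%:R * B ^+ size s * delta) + delta * B ^+ size s)).
  by rewrite lerD // ler_pM ?cabs_ge0.
rewrite -nat1r exprS mulrDl mul1r mulrDl addrC.
apply: lerD; last by rewrite le_eqVlt; apply/orP; left; apply/eqP; ring.
rewrite mulrC ler_wpM2r // ler_peMl ?exprn_ge0 //.
Qed.

End Mean.

Section IndependentRotations.
Context (R : realType) (I : finType) (y : I -> R[i]).
Hypotheses (y1 : forall i, `|y i| = 1)
  (y_indep : forall k l : I -> nat,
     \prod_i y i ^+ k i = \prod_i y i ^+ l i -> k =1 l).
Implicit Types b : I -> R[i].

Let yJ i : y i * (y i)^*%C = 1.
Proof. by rewrite -sqr_normc y1 expr1n. Qed.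

Let cy i : cabs (y i) = 1.
Proof. by apply: complexI; rewrite cabsE y1. Qed.

(** An approximation of [expi (2 Re (b i * y i ^+ n))] that is a polynomial in [y i ^+ n] and its
    conjugate, hence a finite combination of geometric sequences in [n]. *)
Definition exp_pair K b (i : I) (n : nat) : R[i] :=
  exp_sum K ('i%C * (b i * y i ^+ n)) * exp_sum K ('i%C * (b i * y i ^+ n)^*%C).

Definition exp_pair_coeff K b (i : I) (e : 'I_K * 'I_K) : R[i] :=
  ('i%C * b i) ^+ e.1 / (e.1)`!%:R * (('i%C * (b i)^*%C) ^+ e.2 / (e.2)`!%:R).

Lemma exp_pairE K b i n : exp_pair K b i n =
  \sum_(e : 'I_K * 'I_K) exp_pair_coeff b i e * (y i ^+ e.1 * (y i)^*%C ^+ e.2) ^+ n.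
Proof.
rewrite /exp_pair /exp_sum big_distrlr /= pair_big /=; apply: eq_bigr => e _.
rewrite /exp_pair_coeff rmorphM rmorphXn /=.
rewrite !exprMn !(exprAC _ n) -!exprM; ring.
Qed.

(** Expanding the product over [i] gives geometric sequences with ratios [W f]. By independence the
    ratio is 1 only if each [y i] and its conjugate carry the same exponent, and these diagonal
    terms add up to partial sums of the Bessel series. *)
Lemma exp_pair_mean K b :
  has_mean (fun n => \prod_i exp_pair K b i n)
    (\prod_i (\sum_(k < K) bessel0_coeff R k * (cabs (b i) ^+ 2) ^+ k)%:C).
Proof.
pose W (f : {ffun I -> 'I_K * 'I_K}) := \prod_i (y i ^+ (f i).1 * (y i)^*%C ^+ (f i).2).
have -> : (fun n => \prod_i exp_pair K b i n) =
    fun n => \sum_(f : {ffun I -> 'I_K * 'I_K}) (\prod_i exp_pair_coeff b i (f i)) * W f ^+ n.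
  apply/funext => n; under eq_bigr do rewrite exp_pairE.
  rewrite bigA_distr_bigA /=; apply: eq_bigr => f _.
  by rewrite big_split /= /W -prodrXl.
have W1 f : `|W f| = 1.
  rewrite normr_prod big1 // => i _; rewrite normrM !normrX normcJ y1 !expr1n mulr1 //.
have WE f : (W f == 1) = [forall i, (f i).1 == (f i).2].
  apply/eqP/forallP => [Wf i|fE]; last first.
    by apply: big1 => i _; rewrite -(eqP (fE i)) -exprMn yJ expr1n.
  apply/eqP/val_inj; move: i.
  apply: (y_indep (k := fun i => (f i).1) (l := fun i => (f i).2)).
  transitivity (W f * \prod_i y i ^+ (f i).2); last by rewrite Wf mul1r.
  rewrite /W -big_split /=; apply: eq_bigr => i _.
  by rewrite -mulrA -exprMn mulrC [_ * y i]mulrC yJ expr1n mul1r.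
have -> : \prod_i (\sum_(k < K) bessel0_coeff R k * (cabs (b i) ^+ 2) ^+ k)%:C =
    \sum_(f : {ffun I -> 'I_K * 'I_K})
      (\prod_i exp_pair_coeff b i (f i)) * (W f == 1)%:R.
  transitivity (\prod_i \sum_(e : 'I_K * 'I_K) exp_pair_coeff b i e * (e.1 == e.2)%:R).
    apply: eq_bigr => i _.
    rewrite -(pair_bigA _ (fun k l => exp_pair_coeff b i (k, l) * (k == l)%:R)) /=.
    rewrite rmorph_sum; apply: eq_bigr => k _.
    rewrite (bigD1 k) //= eqxx mulr1 big1 ?addr0; last first.
      by move=> l lk; rewrite eq_sym (negPf lk) mulr0.
    rewrite /exp_pair_coeff /= /bessel0_coeff !rmorphM /= !rmorphXn fmorphV !rmorphXn /=.
    rewrite rmorph_nat rmorphN1 cabsE sqr_normc.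
    have f0 : k`!%:R != 0 :> R[i] by rewrite pnatr_eq0 -lt0n fact_gt0.
    rewrite -(sqr_i R) !exprMn; field.
    exact: f0.
  rewrite bigA_distr_bigA /=; apply: eq_bigr => f _; rewrite big_split /=; congr (_ * _).
  rewrite WE; have [fE|/forallPn[i fi]] := boolP [forall i, (f i).1 == (f i).2].
    by rewrite big1 // => i _; rewrite (forallP fE).
  by rewrite (bigD1 i) //= (negPf fi) mul0r.
apply: has_mean_sum => f _. apply: has_meanZ.
have [->|WN1] := eqVneq (W f) 1; last exact: has_mean_geom.
have -> : GRing.exp (1 : R[i]) = fun=> 1 by apply/funext => n; exact: expr1n.
exact: has_mean_cst1.
Qed.

Lemma bessel0_prod_cvg b (e : R) : 0 < e -> exists K0 : nat, forall K, (K0 <= K)%N ->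
  `|\prod_i \sum_(k < K) bessel0_coeff R k * (cabs (b i) ^+ 2) ^+ k -
    \prod_i bessel0 (cabs (b i) ^+ 2)| <= e.
Proof.
move=> e0.
have C i : (fun K : nat => \sum_(k < K) bessel0_coeff R k * (cabs (b i) ^+ 2) ^+ k) @ \oo
    --> bessel0 (cabs (b i) ^+ 2).
  have -> : (fun K : nat => \sum_(k < K) bessel0_coeff R k * (cabs (b i) ^+ 2) ^+ k) =
    pseries (bessel0_coeff R) (cabs (b i) ^+ 2).
    by apply/funext => K; rewrite /pseries /series /= big_mkord.
  by apply: pseries_fact_cvg => n; exact: bessel0_coeff_bound.
have : (fun K : nat => \prod_i \sum_(k < K) bessel0_coeff R k * (cabs (b i) ^+ 2) ^+ k) @ \oo
    --> \prod_i bessel0 (cabs (b i) ^+ 2).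
  elim: (index_enum I) => [|i s IHs].
    by under eq_fun do rewrite big_nil; rewrite big_nil; exact: cvg_cst.
  under eq_fun do rewrite big_cons; rewrite big_cons.
  exact: cvgM (C i) IHs.
move=> /cvgrPdist_le/(_ _ e0)[K0 _ HK]; exists K0 => K KK.
by rewrite distrC; apply: HK.
Qed.

Lemma exp_pair_bound K b i n : cabs (exp_pair K b i n) <= expR (cabs (b i)) ^+ 2.
Proof.
rewrite /exp_pair cabsM expr2.
have E a : cabs a = cabs (b i) -> cabs (exp_sum K a) <= expR (cabs (b i)).
  move=> ab; rewrite (le_trans (cabs_sum _ _ _)) //.
  apply: le_trans (exp_sum_le K (cabs_ge0 (b i))).
  by apply: ler_sum => k _; rewrite cabsM cabsX cabsV cabs_nat ab.
by rewrite ler_pM ?cabs_ge0 ?E // !cabsM cabs_i ?cabs_conj ?cabsM cabsX cy expr1n mulr1 mul1r.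
Qed.

Lemma expi_sum (J : Type) (s : seq J) (x : J -> R) :
  expi (\sum_(j <- s) x j) = \prod_(j <- s) expi (x j).
Proof.
elim: s => [|j s IHs]; first by rewrite !big_nil /expi cos0 sin0.
rewrite !big_cons -IHs /expi cosD sinD.
by apply/eqP; rewrite eq_complex /= eqxx /= addrC.
Qed.

Lemma cabs_expi (x : R) : cabs (expi x) = 1.
Proof.
apply/eqP; rewrite -(@eqrXn2 _ 2) ?cabs_ge0 //.
by rewrite sqr_cabs /= cos2Dsin2 expr1n.
Qed.

(** The order of choices matters: [kappa] comes from [beta] alone, whereas the truncation order and
    [N0] are chosen after [b]. *)
Lemma cos_mean_bound (beta : R) : 0 < beta -> exists2 kappa : R, 0 < kappa &
  forall b, (exists i, beta <= cabs (b i)) ->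
  exists N0 : nat, forall N, (N0 <= N)%N ->
    \sum_(n < N) cos (\sum_i complex.Re (b i * y i ^+ n) *+ 2) <= (1 - kappa) * N%:R.
Proof.
move=> beta0; have [kappa k0 Hk] := bessel0_lt1 (exprn_gt0 2 beta0).
(* Three errors of [kappa / 8] have to fit into the other half: one for truncating the Bessel series
   and two from [has_mean_close]. *)
exists (kappa / 2); first by rewrite divr_gt0.
move=> b [i0 bi0].
have prod_le : `|\prod_i bessel0 (cabs (b i) ^+ 2)| <= 1 - kappa.
  rewrite normr_prod (bigD1 i0) //= -[leRHS]mulr1 ler_pM ?prodr_ge0 //.
    by apply: Hk; rewrite ler_pXn2r ?nnegrE ?cabs_ge0 // ltW.
  by apply: prodr_ile1 => i _; rewrite normr_ge0 bessel0_le1 // sqr_ge0.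
pose B : R := \sum_i expR (cabs (b i)) ^+ 2 + 1.
have B1 : 1 <= B by rewrite lerDr; apply: sumr_ge0 => i _; exact: sqr_ge0.
have bB i : expR (cabs (b i)) ^+ 2 <= B.
  rewrite /B (bigD1 i) //= -addrA lerDl addr_ge0 //.
  by apply: sumr_ge0 => j _; exact: sqr_ge0.
pose M : R := (size (index_enum I))%:R * B ^+ size (index_enum I).
have M0 : 0 <= M by rewrite mulr_ge0 // exprn_ge0 // (le_trans ler01 B1).
(* [M] is the amplification, in [prod_close], of the error made in each factor. *)
pose delta := kappa / 8 / (M + 1).
have M1 : 0 < M + 1 by rewrite ltr_wpDl.
have delta0 : 0 < delta by rewrite !divr_gt0.
have Mdelta : M * delta <= kappa / 8.
  by rewrite /delta mulrCA ler_piMr ?divr_ge0 ?(ltW k0) // ler_pdivrMr // mul1r lerDl.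
have k8 : 0 < kappa / 8 by rewrite divr_gt0.
have [K0 HK0] := bessel0_prod_cvg b k8.
(* [rho] dominates twice the modulus of every [b i * y i ^+ n], so one truncation order serves all
   [i] and [n]. *)
pose rho := \sum_i cabs (b i) *+ 2.
have [K1 HK1] : exists K1 : nat, forall K, (K1 <= K)%N -> 3 * exp_tail K rho <= delta.
  have d3 : 0 < delta / 3 by rewrite divr_gt0.
  have /cvgrPdist_le/(_ _ d3)[K1 _ HK1] := @exp_tail_cvg R rho.
  exists K1 => K /HK1 /=; rewrite sub0r normrN => h.
  by rewrite -ler_pdivlMl // mulrC (le_trans (ler_norm _)).
pose K := maxn K0 K1.
pose u n := \prod_i expi (complex.Re (b i * y i ^+ n) *+ 2).
have bi_le i : cabs (b i) *+ 2 <= rho.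
  by rewrite /rho (bigD1 i) //= lerDl sumr_ge0 // => j _; rewrite mulrn_wge0 // cabs_ge0.
have uv n : cabs (u n - \prod_i exp_pair K b i n) <= kappa / 8.
  apply: le_trans Mdelta; apply: prod_close => //; first exact: ltW.
  - by move=> i; rewrite cabs_expi.
  - by move=> i; rewrite (le_trans (exp_pair_bound _ _ _ _)).
  move=> i; rewrite (le_trans (expi_2Re K _)) // cabsM cabsX cy expr1n mulr1.
  apply: le_trans (HK1 K (leq_maxr _ _)); rewrite ler_wpM2l //.
  by rewrite exp_tail_mono // mulrn_wge0 ?cabs_ge0 //= bi_le.
have [N0 HN0] := has_mean_close (exp_pair_mean K b) k8 uv.
exists N0 => N /HN0 h.
have -> : \sum_(n < N) cos (\sum_i complex.Re (b i * y i ^+ n) *+ 2) =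
    complex.Re (\sum_(n < N) u n).
  rewrite (raddf_sum (@complex.Re R : Rcomplex R -> R)); apply: eq_bigr => n _.
  by rewrite /u -expi_sum.
rewrite (le_trans (ler_norm _)) // (le_trans (Re_le_cabs _)) // (le_trans h) //.
rewrite ler_wpM2r // -rmorph_prod cabs_real.
have := HK0 K (leq_maxl _ _); set P := \prod_i _; set Q := \prod_i _ => PQ.
have : `|P| <= `|Q| + kappa / 8.
  by rewrite -[P](subrK Q) (le_trans (ler_normD _ _)) // addrC lerD2l.
by move: prod_le; rewrite -/Q => ? ?; lra.
Qed.

End IndependentRotations.

(** * Elementary trigonometric inequalities *)

Section Trig.
Context (R : realType).
Implicit Types x y : R.

Lemma cos_lipschitz x y : `|cos x - cos y| <= `|x - y|.
Proof.
wlog xy : x y / x <= y.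
  move=> H; have /orP[/H //|/H] := le_total x y.
  by rewrite distrC (distrC y).
have [|c _ E] := MVT_segment xy (fun z _ => is_derive_cos z).
  by apply: continuous_subspaceT; exact: continuous_cos.
rewrite distrC E normrM normrN [`|x - y|]distrC ler_piMl //.
by rewrite ler_norml sin_geN1 sin_le1.
Qed.

Lemma expiD x y : expi (x + y) = expi x * expi y.
Proof.
rewrite /expi cosD sinD.
by apply/eqP; rewrite eq_complex /= eqxx /= addrC.
Qed.

Lemma expi0 : expi 0 = 1 :> R[i].
Proof. by rewrite /expi cos0 sin0. Qed.

Lemma expiMn x n : expi (x *+ n) = expi x ^+ n.
Proof.
elim: n => [|n IHn]; first by rewrite mulr0n expi0 expr0.
by rewrite mulrS expiD IHn exprS.
Qed.

Lemma expi_lipschitz x y : cabs (expi x - expi y) <= 2 * `|x - y|.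
Proof.
rewrite (le_trans (cabs_le_sqrt2 _)) //= mulr2n mulrDl mul1r lerD ?cos_lipschitz //.
have := cos_lipschitz (x - pi / 2) (y - pi / 2); rewrite !cosBpihalf.
by move/le_trans; apply; rewrite opprB addrA subrK.
Qed.

Lemma cos_int x (K : int) : cos (2 * pi * K%:~R + x) = cos x.
Proof.
have H n y : cos (2 * pi * n%:R + y) = cos y.
  have -> : 2 * pi * n%:R + y = y + (pi *+ 2) *+ n.
    by rewrite -mulrnA -(mulr_natr pi (2 * n)) natrM; ring.
  by rewrite periodicn //; exact: cosD2pi.
case: K => n; first exact: H.
rewrite NegzE mulrNz mulrN -(H n.+1 (- _ + x)); congr cos.
by rewrite addrA subrr add0r.
Qed.

Lemma sqr_cabs_1subexpi x : cabs (1 - expi x) ^+ 2 = 2 * (1 - cos x).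
Proof.
rewrite sqr_cabs /= sub0r sqrrN sqrrB expr1n mul1r.
by have := cos2Dsin2 x => E; rewrite -addrA E; ring.
Qed.

(** Follows from [|1 - z ^+ n| <= n |1 - z|] on the unit circle. It clears the denominator [L] of
    omega at the cost of [L ^+ 2], and it bounds a fraction of a quarter turn away from 0. *)
Lemma one_sub_cosMn x n : 1 - cos (x *+ n) <= n%:R ^+ 2 * (1 - cos x).
Proof.
have H : cabs (1 - expi x ^+ n) <= n%:R * cabs (1 - expi x).
  rewrite -cabsN opprB subrX1 cabsM mulrC -[cabs (_ - 1)]cabsN opprB ler_wpM2r ?cabs_ge0 //.
  rewrite (le_trans (cabs_sum _ _ _)) //.
  under eq_bigr do rewrite cabsX cabs_expi expr1n.
  by rewrite sumr_const card_ord.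
have : cabs (1 - expi x ^+ n) ^+ 2 <= (n%:R * cabs (1 - expi x)) ^+ 2.
  by rewrite lerXn2r ?nnegrE ?mulr_ge0 ?cabs_ge0.
by rewrite -expiMn exprMn !sqr_cabs_1subexpi mulrCA ler_pM2l.
Qed.

Lemma cabs_1addexpi x : cabs (1 + expi x) <= 2 - (1 - cos x) / 2.
Proof.
have s0 : 0 <= 1 - cos x by rewrite subr_ge0 cos_le1.
have s2 : 1 - cos x <= 2 by have := cos_geN1 x; lra.
rewrite -(@ler_pXn2r _ 2) ?nnegrE ?cabs_ge0 //; last by lra.
rewrite sqr_cabs /= add0r sqrrD expr1n mul1r.
have := cos2Dsin2 x => E; rewrite -addrA E.
(* In terms of [t] the claim is [4 - 4 t <= (2 - t) ^+ 2]. *)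
have := sqr_ge0 ((1 - cos x) / 2); set t := (1 - cos x) / 2 => t0.
have -> : cos x = 1 - t *+ 2 by rewrite /t; lra.
by rewrite sqrrB; lra.
Qed.

End Trig.

Lemma geometric_sum_le (R : realFieldType) (x : R) N : 0 <= x < 1 ->
  \sum_(n < N) x ^+ n <= (1 - x)^-1.
Proof.
move=> /andP[x0 x1]; have x10 : 0 < 1 - x by rewrite subr_gt0.
rewrite -[leRHS]mul1r ler_pdivlMr // mulrC.
have := subrX1 x N; rewrite -[x - 1]opprB mulNr => /eqP; rewrite -eqr_oppLR => /eqP <-.
by rewrite opprB lerBlDr lerDl exprn_ge0.
Qed.

(** If all factors were below [D^-1 <= 1], one of them would already give [D * F i ^+ 2 < 1], and
    the others could only decrease the product. *)
Lemma prod_ge_witness (R : realFieldType) (I : eqType) (s : seq I) (F : I -> R) (D : R) :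
  1 <= D -> s != [::] -> (forall i, 0 <= F i) -> 1 <= D * \prod_(i <- s) F i ^+ 2 ->
  exists2 i, i \in s & D^-1 <= F i.
Proof.
move=> D1 sN0 F0 DF; have D0 : 0 < D := lt_le_trans ltr01 D1.
apply/hasP; apply: contraTT DF => /hasPn Flt; rewrite -ltNge.
have Fl i : i \in s -> F i < D^-1 by move=> /Flt; rewrite -ltNge.
case: s sN0 {Flt} Fl => [//|i0 s] _ Fl; rewrite big_cons mulrA.
have F1 i : i \in i0 :: s -> F i ^+ 2 <= 1.
  move=> /Fl /ltW h; rewrite expr_le1 ?(le_trans h) //.
  by rewrite invf_le1.
have h0 : D * F i0 ^+ 2 < 1.
  rewrite mulrC -ltr_pdivlMr // mul1r (le_lt_trans _ (Fl _ (mem_head _ _))) //.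
  by rewrite expr2 ler_piMr // (le_trans (ltW (Fl _ (mem_head _ _)))) // invf_le1.
rewrite (le_lt_trans _ h0) // ler_piMr ?mulr_ge0 ?sqr_ge0 ?(ltW D0) //.
rewrite big_seq; apply: prodr_ile1 => i si.
by rewrite sqr_ge0 F1 // inE si orbT.
Qed.

(* Modulo 1, g(alpha) alpha^n is minus the sum of the other conjugates, so its
   distribution is that of a sum of independent rotations. *)
Lemma salem_cos_mean (R : realType) (n : nat) (alpha : R) (A : 'M[int]_n.+1) :
  (2 < n.+1)%N -> root (map_poly intr (char_poly A)) alpha ->
  salem_number alpha -> has_degree alpha n.+1 ->
  (forall q : {poly rat},
     root (map_poly ratr q) alpha -> root (map_poly ratr q) alpha^-1) ->
  forall (s : nat) (D : R), (0 < s)%N -> 1 <= D -> exists2 kappa : R, 0 < kappa &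
  forall g : {poly int}, (map_poly intr g).[alpha] != 0 ->
    `|(map_poly intr g).[alpha]| * `|(map_poly intr g).[alpha^-1]| <= D ->
  exists N0 : nat, forall N, (N0 <= N)%N ->
    \sum_(m < N) cos (2 * pi * ((map_poly intr g).[alpha] * alpha ^+ (s * m)))
      <= (1 - kappa) * N%:R.
Proof.
move=> n2 Aalpha salem deg inv_conj s D s0 D1.
have [zs [[zsU zsN0] zs1 zs_indep zs_tr zs_norm]] :=
  salem_conjugates n2 Aalpha salem deg inv_conj.
have a1 : 1 < alpha by case: salem.
have a0 : 0 < alpha := lt_trans ltr01 a1.
pose y (i : 'I_(size zs)) := zs`_i ^+ s.
have y1 i : `|y i| = 1 by rewrite normrX zs1 ?mem_nth // expr1n.
(* Independence survives [s]-th powers, which multiply all exponents by [s > 0]. *)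
have y_indep (k l : 'I_(size zs) -> nat) :
    \prod_i y i ^+ k i = \prod_i y i ^+ l i -> k =1 l.
  pose ext (k : 'I_(size zs) -> nat) (z : R[i]) : nat :=
    if insub (index z zs) is Some i then k i else 0.
  have extE k' (i : 'I_(size zs)) : ext k' zs`_i = k' i.
    rewrite /ext index_uniq ?ltn_ord //; case: insubP => [j _ /val_inj -> //|].
    by rewrite ltn_ord.
  have prodE k' : \prod_i y i ^+ k' i = \prod_(z <- zs) z ^+ (s * ext k' z).
    rewrite (big_nth 0) big_mkord; apply: eq_bigr => i _.
    by rewrite extE exprM.
  rewrite !prodE => /(zs_indep (fun z => s * ext k z)%N (fun z => s * ext l z)%N) E i.
  have := E zs`_i (mem_nth _ (ltn_ord i)); rewrite !extE => /eqP.
  by rewrite eqn_pmul2l // => /eqP.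
have Dinv0 : 0 < D^-1 by rewrite invr_gt0 (lt_le_trans ltr01).
have [kappa k0 Hk] := cos_mean_bound y1 y_indep Dinv0.
(* The other half of [kappa] absorbs the contributions of [g(alpha^-1)], whose total is bounded by
   [G], as soon as [N >= 2 G / kappa]. *)
exists (kappa / 2); first by rewrite divr_gt0.
move=> g g0 gD.
pose b (i : 'I_(size zs)) := (2 * pi)%:C * (map_poly intr g).[zs`_i].
have pi1 : 1 <= 2 * pi :> R by have := pi_ge2 R; lra.
have [|N1 HN1] := Hk b.
  have := zs_norm g g0; move=> h.
  have {}h : 1 <= D * \prod_(z <- zs) cabs (map_poly intr g).[z] ^+ 2.
    rewrite (le_trans h) // ler_wpM2r // prodr_ge0 // => z _; exact: sqr_ge0.
  have [|z zz Dz] := prod_ge_witness D1 zsN0 _ h; first by move=> z; exact: cabs_ge0.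
  have iz : (index z zs < size zs)%N by rewrite index_mem.
  exists (Ordinal iz); rewrite /b /= nth_index // cabsM cabs_real.
  by rewrite (le_trans Dz) // ler_peMl ?cabs_ge0 // (le_trans pi1) // ler_norm.
pose c := 2 * pi * `|(map_poly intr g).[alpha^-1]|.
pose G := c * (1 - alpha^-1)^-1.
have c0 : 0 <= c by rewrite mulr_ge0 // mulr_ge0 ?pi_ge0.
have aV : 0 <= alpha^-1 < 1 by rewrite invr_ge0 ltW //= invf_lt1.
have term m : cos (2 * pi * ((map_poly intr g).[alpha] * alpha ^+ (s * m))) <=
    cos (\sum_i complex.Re (b i * y i ^+ m) *+ 2) + c * alpha^-1 ^+ m.
  have [K HK] := zs_tr g (s * m)%N.
  set w := _ * alpha ^+ _ in HK *.
  set w' := _ * alpha ^- _ in HK.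
  set S := \sum_(z <- zs) _ in HK.
  have SE : \sum_i complex.Re (b i * y i ^+ m) *+ 2 = 2 * pi * S.
    rewrite /S (big_nth 0) big_mkord mulr_sumr; apply: eq_bigr => i _.
    rewrite /b /y -exprM (mulrnAr (2 * pi) (complex.Re _)); congr (_ *+ _); rewrite -mulrA.
    by case: (_ * zs`_i ^+ _) => p q /=; rewrite mul0r subr0.
  (* The integral trace [K] drops out of the cosine, and the small term [w'] costs at most its size
     because cosine is 1-Lipschitz. *)
  rewrite SE; have -> : w = K%:~R - w' - S by rewrite -HK; ring.
  have -> : 2 * pi * (K%:~R - w' - S) = 2 * pi * K%:~R - (2 * pi * w' + 2 * pi * S) by ring.
  rewrite cos_int cosN.
  rewrite -lerBlDl (le_trans (ler_norm _)) // (le_trans (cos_lipschitz _ _)) //.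
  have w'_le : `|w'| <= `|(map_poly intr g).[alpha^-1]| * alpha^-1 ^+ m.
    rewrite normrM ler_wpM2l // -exprVn ger0_norm; last by rewrite exprn_ge0 // (andP aV).1.
    by apply: ler_wiXn2l; rewrite ?leq_pmull ?(andP aV).1 ?ltW ?(andP aV).2.
  have pi0 : 0 <= 2 * pi :> R by rewrite (le_trans ler01).
  by rewrite addrK normrM (ger0_norm pi0) /c -[leRHS]mulrA ler_wpM2l.
have [N2 HN2] : exists N2 : nat, 2 * G / kappa <= N2%:R.
  by exists (Num.truncn (2 * G / kappa)).+1; rewrite ltW // truncnS_gt.
exists (maxn N1 N2) => N; rewrite geq_max => /andP[/HN1 h1 N2N].
rewrite (le_trans (ler_sum _ (fun (m : 'I_N) _ => term m))) // big_split /=.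
rewrite -mulr_sumr.
have h2 : c * (\sum_(m < N) alpha^-1 ^+ m) <= G by rewrite ler_wpM2l // geometric_sum_le.
have h3 : G <= kappa / 2 * N%:R.
  have : 2 * G / kappa <= N%:R by rewrite (le_trans HN2) // ler_nat.
  by rewrite ler_pdivrMr //; lra.
by move: h1 h2 h3; rewrite !mulrBl; lra.
Qed.

(** * Exponential sums over words *)

Lemma sum_count_mem (S : pzSemiRingType) (T : finType) (F : T -> S) (w : seq T) :
  \sum_(i <- w) F i = \sum_i F i * (count_mem i w)%:R.
Proof.
elim: w => [|c w IHw]; first by rewrite big_nil big1 // => i _; rewrite mulr0.
rewrite big_cons IHw; under [RHS]eq_bigr do rewrite natrD mulrDr.
rewrite big_split /=; congr (_ + _).
rewrite (bigD1 c) //= eqxx mulr1 big1 ?addr0 //.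
by move=> e ec; rewrite eq_sym (negPf ec) mulr0.
Qed.

Section Words.
Context (R : realType) (d : nat) (zeta : substitution d) (p : 'rV[R]_d).
Implicit Types (w u v : seq 'I_d) (a b c : 'I_d) (theta : R).

Definition wlen w : R := \sum_(b <- w) p 0 b.

(** Lay the letters of [w] from 0 on as intervals of lengths [p 0 b]: this is the sum of
    [expi (theta * x)] over the left ends [x] of the intervals labelled [a]. *)
Fixpoint wsum (theta : R) (a : 'I_d) (w : seq 'I_d) : R[i] :=
  if w is b :: w' then (b == a)%:R + expi (theta * p 0 b) * wsum theta a w' else 0.

Lemma wlen_cat u v : wlen (u ++ v) = wlen u + wlen v.
Proof. exact: big_cat. Qed.

Lemma wlen_cons b w : wlen (b :: w) = p 0 b + wlen w.
Proof. exact: big_cons. Qed.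

Lemma wlen1 b : wlen [:: b] = p 0 b.
Proof. exact: big_seq1. Qed.

Lemma wsum_cat theta a u v :
  wsum theta a (u ++ v) = wsum theta a u + expi (theta * wlen u) * wsum theta a v.
Proof.
elim: u => [|b u IHu] /=; first by rewrite /wlen big_nil mulr0 expi0 mul1r add0r.
by rewrite IHu wlen_cons [theta * (_ + _)]mulrDr expiD; ring.
Qed.

Lemma subst_word_cat u v :
  subst_word zeta (u ++ v) = subst_word zeta u ++ subst_word zeta v.
Proof. by rewrite /subst_word map_cat flatten_cat. Qed.

Lemma iter_subst_cat n u v :
  iter n (subst_word zeta) (u ++ v) =
  iter n (subst_word zeta) u ++ iter n (subst_word zeta) v.
Proof. by elim: n => //= n ->; exact: subst_word_cat. Qed.

Lemma iter_subst_nil n : iter n (subst_word zeta) [::] = [::].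
Proof. by elim: n => //= n ->. Qed.

Lemma subst_word1 b : subst_word zeta [:: b] = zeta b.
Proof. by rewrite /subst_word /= cats0. Qed.

Lemma count_iter_subst n a w :
  count_mem a (iter n (subst_word zeta) w) =
  (\sum_(b <- w) (subst_mx zeta ^+ n) a b)%N.
Proof.
elim: n w => [|n IHn] w.
  rewrite /= expr0 -sum1_count big_mkcond; apply: eq_bigr => b _.
  by rewrite !mxE /= eq_sym; case: (a == b).
rewrite iterSr IHn exprSr; elim: w => [|b w IHw]; first by rewrite !big_nil.
rewrite /subst_word /= big_cat big_cons /= -/(subst_word zeta w) IHw; congr (_ + _)%N.
rewrite mxE; under [RHS]eq_bigr do rewrite mxE.
rewrite (sum_count_mem (fun c => (subst_mx zeta ^+ n) a c)).
by apply: eq_bigr => i _; rewrite natn.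
Qed.

Hypotheses (p_gt0 : forall b, 0 < p 0 b).

Lemma wlen_ge0 w : 0 <= wlen w.
Proof. by apply: sumr_ge0 => b _; exact: ltW. Qed.

Lemma cabs_expiM (x : R) z : cabs (expi x * z) = cabs z.
Proof. by rewrite cabsM cabs_expi mul1r. Qed.

Context (alpha : R).
Hypothesis (p_eigen : p *m subst_mxR R zeta = alpha *: p).

Lemma wlen_subst_letter b : wlen (zeta b) = alpha * p 0 b.
Proof.
have := congr1 (fun q : 'rV_d => q 0 b) p_eigen; rewrite !mxE => <-.
rewrite /wlen; under [RHS]eq_bigr do rewrite !mxE.
exact: sum_count_mem.
Qed.

Lemma wlen_subst_word w : wlen (subst_word zeta w) = alpha * wlen w.
Proof.
elim: w => [|b w IHw]; first by rewrite /subst_word /wlen !big_nil mulr0.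
by rewrite -cat1s subst_word_cat (wlen_cat (subst_word _ _)) (wlen_cat [:: b]) IHw subst_word1 wlen_subst_letter wlen1 mulrDr.
Qed.

Lemma wlen_iter_subst n w : wlen (iter n (subst_word zeta) w) = alpha ^+ n * wlen w.
Proof.
by elim: n => [|n IHn] /=; rewrite ?mul1r // wlen_subst_word IHn mulrA -exprS.
Qed.

(** Measuring the sums against the lengths [p 0 b] makes the bound additive under concatenation. *)
Lemma wsum_iter_le n theta a N w :
  (forall b, cabs (wsum theta a (iter n (subst_word zeta) [:: b])) <= N * p 0 b) ->
  cabs (wsum theta a (iter n (subst_word zeta) w)) <= N * wlen w.
Proof.
move=> HN; elim: w => [|b w IHw].
  by rewrite iter_subst_nil /= cabs0 /wlen big_nil mulr0.
rewrite -cat1s iter_subst_cat wsum_cat wlen_cat wlen1 mulrDr.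
by rewrite (le_trans (cabsD _ _)) // lerD // cabs_expiM.
Qed.

(** Both copies of the image of [c] contribute the same sum [S], with phases that differ by [theta]
    times the dilated length of the return word [c :: u2]. Their partial cancellation is the only
    saving; the other pieces are bounded trivially. *)
Lemma wsum_return_le n theta a N c u1 u2 u3 :
  (forall b, cabs (wsum theta a (iter n (subst_word zeta) [:: b])) <= N * p 0 b) ->
  cabs (wsum theta a (iter n (subst_word zeta) (u1 ++ c :: u2 ++ c :: u3))) <=
  N * (wlen (u1 ++ c :: u2 ++ c :: u3) -
       p 0 c * ((1 - cos (theta * (alpha ^+ n * wlen (c :: u2)))) / 2)).
Proof.
move=> HN; have Hw := wsum_iter_le _ HN.
rewrite -[c :: u2 ++ _]/([:: c] ++ _) -[c :: u3]/([:: c] ++ u3) -[c :: u2]cat1s.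
set W := iter n (subst_word zeta).
rewrite /W !iter_subst_cat -/W !wsum_cat.
set E1 := expi (theta * wlen (W u1)).
set Ec := expi (theta * wlen (W [:: c])).
set E2 := expi (theta * wlen (W u2)).
set S := wsum theta a (W [:: c]).
have -> : wsum theta a (W u1) + E1 * (S + Ec * (wsum theta a (W u2) + E2 * (S + Ec * wsum theta a (W u3)))) =
  wsum theta a (W u1) + E1 * ((1 + Ec * E2) * S) +
   E1 * (Ec * wsum theta a (W u2)) + E1 * (Ec * (E2 * (Ec * wsum theta a (W u3)))) by ring.
have cosE : Ec * E2 = expi (theta * (alpha ^+ n * wlen ([:: c] ++ u2))).
  by rewrite -expiD -mulrDr /W !wlen_iter_subst -mulrDr wlen_cat.
set x := theta * (_ * _) in cosE *.
have N0 : 0 <= N.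
  by rewrite -(pmulr_lge0 N (p_gt0 c)) (le_trans (cabs_ge0 _) (HN c)).
have h1 := Hw u1; have h2 := Hw u2; have h3 := Hw u3.
have hS : cabs ((1 + Ec * E2) * S) <= (2 - (1 - cos x) / 2) * (N * p 0 c).
  by rewrite cabsM ler_pM ?cabs_ge0 ?HN // cosE cabs_1addexpi.
have k1 : cabs (E1 * ((1 + Ec * E2) * S)) <= (2 - (1 - cos x) / 2) * (N * p 0 c).
  by rewrite /E1 cabs_expiM.
have k2 : cabs (E1 * (Ec * wsum theta a (W u2))) <= N * wlen u2.
  by rewrite /E1 /Ec !cabs_expiM.
have k3 : cabs (E1 * (Ec * (E2 * (Ec * wsum theta a (W u3))))) <= N * wlen u3.
  by rewrite /E1 /Ec /E2 !cabs_expiM.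
have t1 := le_trans (cabsD _ _) (lerD h1 k1).
have t2 := le_trans (cabsD _ _) (lerD t1 k2).
apply: le_trans (le_trans (cabsD _ _) (lerD t2 k3)) _.
rewrite !(wlen_cat, wlen1) le_eqVlt; apply/orP; left; apply/eqP.
by field.
Qed.

End Words.

Lemma not_uniq_split (T : eqType) (s : seq T) : ~~ uniq s ->
  exists c u1 u2 u3, s = u1 ++ c :: u2 ++ c :: u3.
Proof.
elim: s => [//|x s IHs] /=; rewrite negb_and negbK => /orP[|/IHs[c [u1 [u2 [u3 ->]]]]].
  by move=> /splitPr[u2 u3]; exists x, [::], u2, u3.
by exists c, (x :: u1), u2, u3.
Qed.

Lemma exprn_unbounded (R : archiRealFieldType) (x y : R) : 1 < x -> exists m : nat, y <= x ^+ m.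
Proof.
move=> x1; have x10 : 0 < x - 1 by rewrite subr_gt0.
have bern m : m%:R * (x - 1) <= x ^+ m.
  elim: m => [|m IHm]; first by rewrite mul0r expr0.
  have xm1 : 1 <= x ^+ m by rewrite exprn_ege1 // ltW.
  rewrite exprS -nat1r mulrDl mul1r.
  have -> : x * x ^+ m = (x - 1) * x ^+ m + x ^+ m by ring.
  by rewrite lerD // ler_peMr // ltW.
exists (Num.truncn (y / (x - 1))).+1; rewrite (le_trans _ (bern _)) //.
by rewrite -ler_pdivrMr // ltW // truncnS_gt.
Qed.

(** * Return words and contraction of word sums *)

Section Contraction.
Context (R : realType) (d : nat) (zeta : substitution d) (p : 'rV[R]_d) (alpha : R).
Hypotheses (p_gt0 : forall b, 0 < p 0 b) (alpha_gt1 : 1 < alpha)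
  (p_eigen : p *m subst_mxR R zeta = alpha *: p)
  (prim : primitive_subst zeta) (d_gt0 : (0 < d)%N).

Let e0 : 'I_d := Ordinal d_gt0.

Definition ptot : R := \sum_b p 0 b.

Lemma p_le_ptot b : p 0 b <= ptot.
Proof. by rewrite /ptot (bigD1 b) //= lerDl sumr_ge0 // => c _; exact: ltW. Qed.

Lemma ptot_gt0 : 0 < ptot.
Proof. exact: lt_le_trans (p_gt0 e0) (p_le_ptot e0). Qed.

Let alpha_gt0 : 0 < alpha. Proof. exact: lt_trans ltr01 alpha_gt1. Qed.

Lemma wlen_le_size w : wlen p w <= (size w)%:R * ptot.
Proof.
rewrite /wlen (le_trans (ler_sum _ (fun b _ => p_le_ptot b))) //.
by rewrite big_const_seq count_predT iter_addr_0 mulr_natl.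
Qed.

(** A word with more than [d] letters repeats a letter, and the images of [e0] become that long
    because their lengths grow like powers of [alpha]. By primitivity [e0], and then the repetition,
    occurs inside the image of every letter. *)
Lemma return_word : exists (k : nat) (c : 'I_d) (u2 : seq 'I_d), (0 < k)%N /\
  forall b, exists u1 u3, iter k (subst_word zeta) [:: b] = u1 ++ c :: u2 ++ c :: u3.
Proof.
have [k0 k00 Mk0] := prim.
have [m Hm] := exprn_unbounded (d.+1%:R * ptot / p 0 e0) alpha_gt1.
have nuniq : ~~ uniq (iter m (subst_word zeta) [:: e0]).
  apply/negP => /card_uniqP sz.
  have szd : (size (iter m (subst_word zeta) [:: e0]) <= d)%N.
    by rewrite -sz -[leqRHS]card_ord max_card.
  have := wlen_le_size (iter m (subst_word zeta) [:: e0]).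
  rewrite (wlen_iter_subst p_eigen) wlen1 leNgt => /negP; apply.
  apply: (@lt_le_trans _ _ (d.+1%:R * ptot)).
    by rewrite ltr_pM2r ?ptot_gt0 // ltr_nat ltnS.
  by rewrite -ler_pdivrMr.
have [c [v1 [u2 [v3 E]]]] := not_uniq_split nuniq.
exists (m + k0)%N, c, u2; split; first by rewrite addn_gt0 k00 orbT.
move=> b; have : e0 \in iter k0 (subst_word zeta) [:: b].
  by rewrite -has_pred1 has_count count_iter_subst big_seq1 Mk0.
rewrite iterD => /splitPr[w1 w2]; rewrite -cat1s !iter_subst_cat E.
exists (iter m (subst_word zeta) w1 ++ v1), (v3 ++ iter m (subst_word zeta) w2).
by rewrite -!catA /= -!catA.
Qed.

(** The saving is put into exponential form by [1 - x <= expR (- x)], so that successive factors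
    multiply to the exponential of a Cesaro sum. *)
Lemma wsum_contraction : exists (k : nat) (v : seq 'I_d) (eta : R),
  [/\ (0 < k)%N, v != [::], 0 < eta &
  forall theta a n N,
    (forall b, cabs (wsum p theta a (iter n (subst_word zeta) [:: b])) <= N * p 0 b) ->
    forall b, cabs (wsum p theta a (iter (n + k) (subst_word zeta) [:: b])) <=
      N * alpha ^+ k * expR (- (eta * (1 - cos (theta * (alpha ^+ n * wlen p v))))) * p 0 b].
Proof.
have [k [c [u2 [k0 Hk]]]] := return_word.
have ak0 : 0 < alpha ^+ k by rewrite exprn_gt0.
(* The saving of [wsum_return_le] is [p 0 c / 2], to be compared with the total
   [alpha ^+ k * p 0 b]; since [p 0 b <= ptot], one constant serves all letters [b]. *)
exists k, (c :: u2), (p 0 c / (2 * alpha ^+ k * ptot)); split => //.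
  by rewrite divr_gt0 ?p_gt0 // !mulr_gt0 // ptot_gt0.
move=> theta a n N HN b; set eta := p 0 c / _; rewrite iterD; have [u1 [u3 E]] := Hk b.
have := @wsum_return_le _ _ _ _ p_gt0 _ p_eigen n theta a N c u1 u2 u3 HN; rewrite -E.
rewrite (wlen_iter_subst p_eigen) wlen1; set s := 1 - cos _.
have s0 : 0 <= s by rewrite subr_ge0 cos_le1.
have N0 : 0 <= N by rewrite -(pmulr_lge0 N (p_gt0 c)) (le_trans (cabs_ge0 _) (HN c)).
move=> /le_trans; apply; rewrite -!mulrA ler_wpM2l //.
have pt := ptot_gt0.
have E2 : alpha ^+ k * ((1 - eta * s) * p 0 b) =
    alpha ^+ k * p 0 b - p 0 c * (s / 2) * (p 0 b / ptot).
  by rewrite /eta; field; rewrite ?gt_eqF // /eta.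
apply: (@le_trans _ _ (alpha ^+ k * ((1 - eta * s) * p 0 b))).
  rewrite E2 lerD2l lerN2 ler_piMr ?mulr_ge0 ?divr_ge0 ?(ltW (p_gt0 _)) //.
  by rewrite ler_pdivrMr // mul1r p_le_ptot.
rewrite ler_wpM2l ?(ltW ak0) // ler_wpM2r ?(ltW (p_gt0 _)) //.
have -> : p 0 c * ((2 * (alpha ^+ k * ptot))^-1 * s) = eta * s by rewrite /eta !mulrA.
exact: expR_ge1Dx.
Qed.

End Contraction.

Lemma cat_eq_cat (T : Type) (s1 s2 t1 t2 : seq T) : s1 ++ s2 = t1 ++ t2 ->
  (exists r, t1 = s1 ++ r /\ s2 = r ++ t2) \/ (exists r, s1 = t1 ++ r /\ t2 = r ++ s2).
Proof.
elim: s1 t1 => [|x s1 IHs] [|y t1] /=; first by move=> ->; left; exists [::].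
- by move=> ->; left; exists (y :: t1).
- by move=> <-; right; exists (x :: s1).
by case=> -> /IHs[[r [-> ->]]|[r [-> ->]]]; [left|right]; exists r.
Qed.

(** * Power saving for all factors of the language *)

Section Decay.
Context (R : realType) (d : nat) (zeta : substitution d) (p : 'rV[R]_d) (alpha : R).
Hypotheses (p_gt0 : forall b, 0 < p 0 b) (alpha_gt1 : 1 < alpha)
  (p_eigen : p *m subst_mxR R zeta = alpha *: p) (d_gt0 : (0 < d)%N).
Context (theta : R) (a : 'I_d) (beta : R).
Hypothesis (beta_gt1 : 1 < beta).

Local Notation S := (wsum p theta a).
Local Notation Z n w := (iter n (subst_word zeta) w).

Let alpha_gt0 : 0 < alpha. Proof. exact: lt_trans ltr01 alpha_gt1. Qed.
Let beta_gt0 : 0 < beta. Proof. exact: lt_trans ltr01 beta_gt1. Qed.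
Let alpha_ge0 : 0 <= alpha. Proof. exact: ltW. Qed.
Let beta_ge0 : 0 <= beta. Proof. exact: ltW. Qed.
Let alpha_ge1 : 1 <= alpha. Proof. exact: ltW. Qed.
Let beta_ge1 : 1 <= beta. Proof. exact: ltW. Qed.
Let p_ge0 b : 0 <= p 0 b. Proof. exact: ltW. Qed.

Lemma wsum1_le b : cabs (S [:: b]) <= 1.
Proof. by rewrite /= mulr0 addr0; case: (b == a); rewrite ?cabs1 ?cabs0. Qed.

Section Block.
Context (k : nat) (V eta : R).
Hypotheses (k_gt0 : (0 < k)%N) (eta_gt0 : 0 < eta)
  (contraction : forall n N,
    (forall b, cabs (S (Z n [:: b])) <= N * p 0 b) ->
    forall b, cabs (S (Z (n + k) [:: b])) <=
      N * alpha ^+ k * expR (- (eta * (1 - cos (theta * (alpha ^+ n * V))))) * p 0 b).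

Definition wsum_cst : R := \sum_c (p 0 c)^-1.

Lemma wsum_iterate m b : cabs (S (Z (k * m) [:: b])) <=
  wsum_cst * alpha ^+ (k * m) *
  expR (- (eta * \sum_(j < m) (1 - cos (theta * (alpha ^+ (k * j) * V))))) * p 0 b.
Proof.
elim: m b => [|m IHm] b.
  rewrite muln0 big_ord0 mulr0 oppr0 expR0 expr0 !mulr1 (le_trans (wsum1_le b)) //.
  rewrite -ler_pdivrMr // mul1r /wsum_cst (bigD1 b) //= lerDl.
  by apply: sumr_ge0 => c _; rewrite invr_ge0 ltW.
rewrite mulnS addnC; have := contraction IHm b; rewrite exprD big_ord_recr /=.
move=> /le_trans; apply; rewrite [in leRHS]mulrDr [in leRHS]opprD [in leRHS]expRD.
by rewrite le_eqVlt; apply/orP; left; apply/eqP; ring.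
Qed.

(** Below [N0] only the trivial bound is known. The constant [C] takes over its factor
    [alpha ^+ (k * N0)], and another [alpha ^+ k] for levels that are not multiples of [k]. *)
Lemma block_decay (delta : R) (N0 : nat) : alpha ^+ k * expR (- delta) <= beta ^+ k ->
  (forall m, (N0 <= m)%N ->
     delta * m%:R <= eta * \sum_(j < m) (1 - cos (theta * (alpha ^+ (k * j) * V)))) ->
  exists2 C : R, 0 < C & forall n b, cabs (S (Z n [:: b])) <= C * beta ^+ n * p 0 b.
Proof.
move=> beta_k HN0.
have cst0 : 0 < wsum_cst.
  rewrite /wsum_cst (bigD1 (Ordinal d_gt0)) //= ltr_pwDl ?invr_gt0 //.
  by apply: sumr_ge0 => c _; rewrite invr_ge0 ltW.
pose C1 := wsum_cst * alpha ^+ (k * N0).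
have C10 : 0 < C1 by rewrite mulr_gt0 // exprn_gt0.
have lvl m b : cabs (S (Z (k * m) [:: b])) <= C1 * beta ^+ (k * m) * p 0 b.
  rewrite (le_trans (wsum_iterate m b)) // ler_wpM2r //.
  rewrite /C1 -!mulrA ler_wpM2l ?(ltW cst0) //.
  have [mN|Nm] := leqP N0 m.
    apply: (@le_trans _ _ (beta ^+ (k * m))); last first.
      by rewrite ler_peMl ?exprn_ge0 // exprn_ege1.
    apply: (@le_trans _ _ ((alpha ^+ k * expR (- delta)) ^+ m)).
      rewrite exprMn -exprM ler_wpM2l ?exprn_ge0 //.
      by rewrite -expRM_natl ler_expR mulrN lerN2 mulrC HN0.
    by rewrite exprM lerXn2r ?nnegrE ?mulr_ge0 ?exprn_ge0 ?expR_ge0.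
  apply: (@le_trans _ _ (alpha ^+ (k * N0))); last first.
    by rewrite ler_peMr ?exprn_ge0 // exprn_ege1.
  apply: (@le_trans _ _ (alpha ^+ (k * m))); last first.
    by rewrite ler_weXn2l // leq_mul2l (ltnW Nm) orbT.
  rewrite ler_piMr ?exprn_ge0 // -[leRHS]expR0 ler_expR oppr_le0 mulr_ge0 ?(ltW eta_gt0) //.
  by apply: sumr_ge0 => j _; rewrite subr_ge0 cos_le1.
clearbody C1; exists (C1 * alpha ^+ k); first by rewrite mulr_gt0 // exprn_gt0.
move=> n b; rewrite {1}(divn_eq n k) mulnC iterD.
have := @wsum_iter_le _ _ zeta p (k * (n %/ k)) theta a _ (Z (n %% k) [:: b]) (lvl (n %/ k)%N).
rewrite (wlen_iter_subst p_eigen) wlen1 => /le_trans; apply.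
rewrite mulrA ler_wpM2r // -!mulrA ler_wpM2l ?(ltW C10) //.
rewrite mulrC ler_pM ?exprn_ge0 //.
  by rewrite ler_weXn2l // ltnW // ltn_mod.
by rewrite ler_weXn2l // mulnC leq_trunc_div.
Qed.

End Block.

Section Factor.
Context (C : R).
Hypotheses (C_gt0 : 0 < C)
  (block_le : forall n b, cabs (S (Z n [:: b])) <= C * beta ^+ n * p 0 b).

(** Chosen so that [prefix_cst * (beta - 1) >= C * alpha * ptot p], which closes the induction on
    the level in [prefix_decay]; the summand 1 covers level 0. *)
Definition prefix_cst : R := 1 + C * alpha * ptot p / (beta - 1).
Local Notation P := prefix_cst.

Let beta1_gt0 : 0 < beta - 1. Proof. by rewrite subr_gt0. Qed.

Lemma prefix_cst_ge1 : 1 <= P.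
Proof.
rewrite lerDl divr_ge0 ?(ltW beta1_gt0) // !mulr_ge0 ?(ltW C_gt0) //.
by rewrite /ptot; apply: sumr_ge0.
Qed.

Let P_ge0 : 0 <= P. Proof. exact: le_trans ler01 prefix_cst_ge1. Qed.

Lemma prefix_word_le n :
  (forall b u u', Z n [:: b] = u ++ u' -> cabs (S u) <= P * beta ^+ n) ->
  forall w u u', Z n w = u ++ u' -> cabs (S u) <= C * beta ^+ n * wlen p w + P * beta ^+ n.
Proof.
move=> Hn; have bn0 : 0 <= beta ^+ n by rewrite exprn_ge0.
have Cb0 : 0 <= C * beta ^+ n by rewrite mulr_ge0 // ltW.
elim=> [|c w IHw] u u'.
  rewrite iter_subst_nil; case: u => // _.
  by rewrite /= cabs0 addr_ge0 // mulr_ge0 // wlen_ge0.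
rewrite -cat1s iter_subst_cat => /cat_eq_cat[[r [-> rE]]|[r [rE _]]].
  rewrite wsum_cat wlen_cat wlen1 mulrDr -addrA (le_trans (cabsD _ _)) //.
  by rewrite lerD // cabs_expiM (IHw _ _ rE).
by rewrite (le_trans (Hn _ _ _ rE)) // lerDr mulr_ge0 // wlen_ge0.
Qed.

(** A prefix of [zeta^(n+1)(b)] is a sequence of complete words [zeta^n(c)] followed by a prefix of
    one more. The losses over the levels form a geometric sum, harmless because [beta > 1]. *)
Lemma prefix_decay n b u u' : Z n [:: b] = u ++ u' -> cabs (S u) <= P * beta ^+ n.
Proof.
elim: n b u u' => [|n IHn] b u u'.
  case: u => [|c [|]] //=; first by rewrite cabs0 mulr1.
  by move=> _; rewrite mulr1 (le_trans (wsum1_le c)) ?prefix_cst_ge1.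
rewrite iterSr subst_word1 => E; rewrite (le_trans (prefix_word_le IHn E)) //.
rewrite (wlen_subst_letter p_eigen).
have -> : C * beta ^+ n * (alpha * p 0 b) + P * beta ^+ n =
  beta ^+ n * (C * alpha * p 0 b + P) by ring.
have -> : P * beta ^+ n.+1 = beta ^+ n * (P * (beta - 1) + P) by rewrite exprS; ring.
rewrite ler_wpM2l ?exprn_ge0 // lerD2r /prefix_cst mulrDl mul1r divfK ?gt_eqF //.
rewrite ler_wpDl ?(ltW beta1_gt0) // ler_wpM2l ?p_le_ptot // mulr_ge0 // ltW //.
Qed.

Lemma inner_factor_decay n b s1 v s2 : Z n [:: b] = s1 ++ v ++ s2 ->
  cabs (S v) <= 2 * (P * beta ^+ n).
Proof.
move=> E; have h1 := prefix_decay E.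
have h2 : cabs (S (s1 ++ v)) <= P * beta ^+ n.
  by apply: (@prefix_decay n b _ s2); rewrite -catA.
have -> : cabs (S v) = cabs (S (s1 ++ v) - S s1).
  by rewrite wsum_cat addrAC subrr add0r cabs_expiM.
by rewrite (le_trans (cabsD _ _)) // cabsN mulr2n mulrDl mul1r lerD.
Qed.

(** A word no longer than any [zeta^n(c)] lies inside one such word or straddles two consecutive
    ones. The cost is 2 inside, as a difference of two prefixes, and [2 + 1] for a suffix followed
    by a prefix. *)
Lemma factor_word_decay n w s1 v s2 : Z n w = s1 ++ v ++ s2 ->
  (forall c, wlen p v <= alpha ^+ n * p 0 c) -> cabs (S v) <= 3 * (P * beta ^+ n).
Proof.
move=> E vle; have Pb0 : 0 <= P * beta ^+ n by rewrite mulr_ge0 ?exprn_ge0.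
elim: w s1 E => [|c w IHw] s1.
  rewrite iter_subst_nil; case: s1 => //; case: (v) => //= _.
  by rewrite cabs0 mulr_ge0.
rewrite -cat1s iter_subst_cat => /cat_eq_cat[[r [_ rE]]|[r [rE]]].
  exact: IHw rE.
case/cat_eq_cat => [[r2 [rE2 _]]|[r2 [vE wE]]].
  rewrite (le_trans (inner_factor_decay (_ : Z n [:: c] = s1 ++ v ++ r2))) ?rE ?rE2 //.
  by rewrite ler_wpM2r // ler_nat.
have hr : cabs (S r) <= 2 * (P * beta ^+ n).
  by apply: (@inner_factor_decay n c s1 r [::]); rewrite cats0.
have hr2 : cabs (S r2) <= P * beta ^+ n.
  case: w {IHw} wE => [|c' w].
    by rewrite iter_subst_nil; case: (r2) => //= _; rewrite cabs0.
  rewrite -cat1s iter_subst_cat => /cat_eq_cat[[q [qE _]]|[q [qE _]]]; last first.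
    exact: prefix_decay qE.
  (* [q] is the part of [v] beyond the whole block of [c']; the length bound forces it to be
     empty. *)
  have : wlen p q <= 0.
    have := vle c'; rewrite vE qE !wlen_cat (wlen_iter_subst p_eigen) wlen1.
    by have := wlen_ge0 p_gt0 r; lra.
  case: q qE => [|x q] qE; last first.
    by rewrite wlen_cons leNgt ltr_pwDl ?wlen_ge0.
  by move=> _; apply: (@prefix_decay n c' r2 [::]); rewrite qE !cats0.
rewrite vE wsum_cat (le_trans (cabsD _ _)) // cabs_expiM.
by move: hr hr2; set Q := P * _; lra.
Qed.

Lemma factor_decay M a0 n v : infix v (Z M [:: a0]) ->
  (forall c, wlen p v <= alpha ^+ n * p 0 c) -> cabs (S v) <= 3 * (P * beta ^+ n).
Proof.
move=> /infixP[s1 [s2 E]] vle.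
have [nM|Mn] := leqP n M.
  by move: E; rewrite -(subnKC nM) iterD => /factor_word_decay; apply.
rewrite (le_trans (inner_factor_decay E)) //.
rewrite ler_pM ?mulr_ge0 ?exprn_ge0 ?ler_nat //.
by rewrite ler_wpM2l // ler_weXn2l // ltnW.
Qed.

End Factor.
End Decay.

(** * The embedding of Q(alpha) on polynomial values *)

Section Embedding.
Context (R : realType) (alpha : R) (s : R -> R[i]).
Hypotheses (s_emb : field_embedding (Qadjoin alpha) s).

Let K := Qadjoin alpha.

Lemma Qadjoin_horner (q : {poly rat}) : K (map_poly ratr q).[alpha].
Proof. by exists q, 1; rewrite rmorph1 hornerC divr1. Qed.

Lemma Qadjoin_rat (c : rat) : K (ratr c).
Proof. by have := Qadjoin_horner c%:P; rewrite map_polyC hornerC. Qed.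

Lemma embedding0 : s 0 = 0.
Proof.
have [_ sD _] := s_emb; have K0 : K 0 by rewrite -(rmorph0 (ratr : {rmorphism rat -> R})); exact: Qadjoin_rat.
by have := sD 0 0 K0 K0; rewrite addr0 => /eqP; rewrite eq_sym -subr_eq0 addrK => /eqP.
Qed.

Lemma embeddingN x : K x -> K (- x) -> s (- x) = - s x.
Proof.
have [_ sD _] := s_emb => Kx KNx; apply/eqP.
by rewrite -addr_eq0 -sD // addNr embedding0.
Qed.

Lemma embedding_nat n : s n%:R = n%:R.
Proof.
have [s1 sD _] := s_emb; elim: n => [|n IHn]; first exact: embedding0.
rewrite -!natr1 sD ?s1 ?IHn //.
  by rewrite -(ratr_nat R n); exact: Qadjoin_rat.
by rewrite -(rmorph1 (ratr : {rmorphism rat -> R})); exact: Qadjoin_rat.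
Qed.

Lemma embedding_int (m : int) : s m%:~R = m%:~R.
Proof.
case: m => n; first exact: embedding_nat.
have E (F : pzRingType) : (Negz n)%:~R = - n.+1%:R :> F by rewrite NegzE mulrNz.
rewrite !E embeddingN; first by rewrite embedding_nat.
  by rewrite -(ratr_nat R n.+1); exact: Qadjoin_rat.
by rewrite -(ratr_nat R n.+1) -rmorphN; exact: Qadjoin_rat.
Qed.

Lemma embedding_rat (c : rat) : s (ratr c) = ratr c.
Proof.
have [_ _ sM] := s_emb.
have d0 : (denq c)%:~R != 0 :> R[i] by rewrite intr_eq0 denq_neq0.
apply: (mulIf d0); rewrite -{1}(embedding_int (denq c)) -sM; last 2 first.
- exact: Qadjoin_rat.
- by rewrite -ratr_int; exact: Qadjoin_rat.
have E (F : numFieldType) : ratr c * (denq c)%:~R = (numq c)%:~R :> F.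
  by rewrite -[(denq c)%:~R]ratr_int -rmorphM -numqE; exact: ratr_int.
by rewrite !E embedding_int.
Qed.

Lemma embedding_horner (q : {poly rat}) :
  s (map_poly ratr q).[alpha] = (map_poly ratr q).[s alpha].
Proof.
have [_ sD sM] := s_emb.
elim/poly_ind: q => [|q c IHq]; first by rewrite !rmorph0 !horner0 embedding0.
rewrite !rmorphD !rmorphM /= !map_polyX !map_polyC !hornerMXaddC.
have Ka : K alpha by have := Qadjoin_horner 'X; rewrite map_polyX hornerX.
have Kq := Qadjoin_horner q; have Kc := Qadjoin_rat c.
have Kqa : K ((map_poly ratr q).[alpha] * alpha).
  by have := Qadjoin_horner (q * 'X); rewrite rmorphM /= map_polyX hornerMX.
by rewrite (sD _ _ Kqa Kc) (sM _ _ Kq Ka) IHq embedding_rat.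
Qed.

Lemma horner_int_rat (F : numFieldType) (g : {poly int}) :
  map_poly (intr : int -> F) g = map_poly ratr (map_poly (intr : int -> rat) g).
Proof. by rewrite -map_poly_comp; apply: eq_map_poly => c /=; rewrite ratr_int. Qed.

End Embedding.

(** * The exponent of the word sums *)

Lemma contraction_rate (R : realType) (alpha delta : R) (k : nat) :
  1 < alpha -> 0 < delta -> (0 < k)%N ->
  exists2 beta : R, 1 < beta < alpha & alpha ^+ k * expR (- delta) <= beta ^+ k.
Proof.
move=> a1 d0 k0; have a0 : 0 < alpha := lt_trans ltr01 a1.
pose b0 := alpha * expR (- delta / k%:R).
have b00 : 0 <= b0 by rewrite mulr_ge0 ?expR_ge0 // ltW.
have b0a : b0 < alpha.
  rewrite /b0 gtr_pMr // -[ltRHS]expR0 ltr_expR mulNr oppr_lt0 divr_gt0 // ltr0n //.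
(* [b0] is the exact rate but may be below 1; the maximum restores [1 < beta]. *)
exists (Num.max b0 ((1 + alpha) / 2)).
  rewrite lt_max gt_max b0a /=; apply/andP; split; [apply/orP; right|]; lra.
have -> : alpha ^+ k * expR (- delta) = b0 ^+ k.
  rewrite exprMn -expRM_natl; congr (_ * expR _).
  by rewrite mulrC divfK // pnatr_eq0 -lt0n.
by rewrite lerXn2r ?nnegrE ?le_max ?b00 ?lexx.
Qed.

Section WordSumBound.
Context (R : realType) (n : nat) (zeta : substitution n.+1) (alpha : R) (p : 'rV[R]_n.+1).
Hypotheses (n_gt1 : (2 < n.+1)%N) (zeta_prim : primitive_subst zeta)
  (alpha_eigen : eigenvalue (subst_mxR R zeta) alpha)
  (alpha_salem : salem_number alpha) (alpha_deg : has_degree alpha n.+1)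
  (p_roof : roof_vector zeta alpha p)
  (sigma0 : R -> R[i]) (sigma0_emb : field_embedding (Qadjoin alpha) sigma0)
  (sigma0_alpha : sigma0 alpha = (alpha^-1)%:C).

Lemma subst_mx_root :
  root (map_poly intr (char_poly (map_mx (Posz : nat -> int) (subst_mx zeta)))) alpha.
Proof.
rewrite map_char_poly -eigenvalue_root_char; move: alpha_eigen.
by rewrite /subst_mxR -map_mx_comp.
Qed.

(** Apply [sigma0] to the equation satisfied by [alpha]. *)
Lemma inv_alpha_conj (q : {poly rat}) :
  root (map_poly ratr q) alpha -> root (map_poly ratr q) alpha^-1.
Proof.
rewrite -root_complex => qa; rewrite -root_complex rootE -sigma0_alpha.
rewrite -(embedding_horner sigma0_emb); move: qa.
by rewrite root_complex => /eqP ->; rewrite (embedding0 sigma0_emb).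
Qed.

Lemma wlen_int_poly (v : seq 'I_n.+1) :
  exists h : {poly int}, wlen p v = (map_poly intr h).[alpha].
Proof.
have [_ _ p_int] := p_roof.
elim: v => [|b v [h hE]].
  by exists 0; rewrite rmorph0 horner0 /wlen big_nil.
have [q qE] := p_int b; exists (q + h).
by rewrite wlen_cons hE qE rmorphD hornerD.
Qed.

Definition in_language (v : seq 'I_n.+1) : Prop :=
  exists (a : 'I_n.+1) (m : nat), infix v (iter m (subst_word zeta) [:: a]).

(** The exponent is fixed before [omega]: [k], [eta] and the return word come from the substitution,
    [kappa] from [D], and [delta] from these and [A]. Only [K] depends on [omega], through the
    threshold [N0]. *)
Lemma word_sum_bound (A B C : R) : 1 < A -> 1 < B -> 1 < C ->
  exists2 gamma : R, 0 < gamma < 1 & forall omega : R,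
    B^-1 <= `|omega| <= B -> `|sigma0 omega| <= C%:C ->
    (exists (L : nat) (l : 'I_n.+1 -> int),
       reduced_form alpha omega L l /\ L%:R <= A) ->
    exists2 K : R, 0 < K & forall a v ell, in_language v -> 1 <= ell ->
      wlen p v <= ell -> cabs (wsum p (- (2 * pi * omega)) a v) <= K * ell `^ (1 - gamma).
Proof.
move=> A1 B1 C1.
have [p_eigen p_gt0 p_int] := p_roof.
have a1 : 1 < alpha by case: alpha_salem.
have a0 : 0 < alpha := lt_trans ltr01 a1.
have [k [v0 [eta [k0 v0N0 eta0 contr]]]] := wsum_contraction p_gt0 a1 p_eigen zeta_prim (ltn0Sn n).
have [h hE] := wlen_int_poly v0.
have V0 : 0 < wlen p v0.
  case: (v0) v0N0 => // b v _; rewrite wlen_cons ltr_pwDl //; exact: wlen_ge0.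
set V := wlen p v0 in hE V0 contr.
pose hV := `|(map_poly (intr : int -> R) h).[alpha^-1]|.
have hV0 : 0 <= hV by exact: normr_ge0.
(* Product of the bounds [A * B * V] for [g] at [alpha] and [A * C * hV] for [g] at [alpha^-1],
   where [g = lp * h]; the 1 ensures [1 <= D]. *)
pose D := 1 + A ^+ 2 * B * C * V * hV.
have A0 : 0 < A := lt_trans ltr01 A1.
have B0 : 0 < B := lt_trans ltr01 B1.
have C0 : 0 < C := lt_trans ltr01 C1.
have D1 : 1 <= D by rewrite lerDl !mulr_ge0 ?exprn_ge0 ?(ltW A0) ?(ltW B0) ?(ltW C0) ?(ltW V0) ?normr_ge0.
have [kappa kappa0 Hk] := salem_cos_mean n_gt1 subst_mx_root alpha_salem alpha_deg
  inv_alpha_conj k0 D1.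
(* Removing the denominator [L] from the argument of the cosine costs [L ^+ 2 <= A ^+ 2]. *)
pose delta := eta * (kappa / A ^+ 2).
have delta0 : 0 < delta by rewrite mulr_gt0 // divr_gt0 // exprn_gt0.
have [beta /andP[b1 ba] beta_k] := contraction_rate a1 delta0 k0.
have b0 : 0 < beta := lt_trans ltr01 b1.
have lna : 0 < ln alpha by rewrite ln_gt0.
have lnb : 0 < ln beta by rewrite ln_gt0.
(* Makes [beta ^+ m] the power [1 - gamma] of the length scale [alpha ^+ m]. *)
pose gamma := 1 - ln beta / ln alpha.
have gamma1 : 1 - gamma = ln beta / ln alpha by rewrite opprB addrC subrK.
have beta_pow m : beta ^+ m = (alpha ^+ m) `^ (1 - gamma).
  rewrite gamma1 -!powR_mulrn ?ltW // -powRrM mulrC powRrM; congr (_ `^ _).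
  by rewrite /powR gt_eqF // divfK ?gt_eqF // lnK.
exists gamma.
  rewrite /gamma subr_gt0 gtrBl divr_gt0 // andbT ltr_pdivrMr // mul1r.
  by rewrite ltr_ln ?posrE.
move=> omega /andP[oB oB'] osig [L [l [[L1 _ oE] LA]]].
have L0 : 0 < L%:R :> R by rewrite ltr0n.
pose lp : {poly int} := \sum_(i < n.+1) (l i)%:P * 'X^i.
have lpE (F : comNzRingType) (x : F) :
    (map_poly intr lp).[x] = \sum_(i < n.+1) (l i)%:~R * x ^+ i.
  rewrite rmorph_sum horner_sum; apply: eq_bigr => i _.
  by rewrite rmorphM /= map_polyC map_polyXn hornerM hornerC hornerXn.
have lpa : (map_poly intr lp).[alpha] = L%:R * omega.
  by rewrite lpE oE mulrA mulfV ?mul1r // gt_eqF.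
have lpaV : `|(map_poly intr lp).[alpha^-1]| <= L%:R * C.
  rewrite -lecR -cabs_real -horner_int_complex -sigma0_alpha.
  rewrite horner_int_rat -(embedding_horner sigma0_emb) -horner_int_rat lpa.
  have [_ _ sM] := sigma0_emb.
  have KL : Qadjoin alpha L%:R by rewrite -(ratr_nat R L); exact: Qadjoin_rat.
  have Ko : Qadjoin alpha omega.
    have -> : omega = (map_poly ratr (L%:R^-1 *: map_poly (intr : int -> rat) lp)).[alpha].
      rewrite linearZ /= hornerZ fmorphV /= ratr_nat -horner_int_rat lpa.
      by rewrite mulrA mulVf ?mul1r // gt_eqF.
    exact: Qadjoin_horner.
  rewrite (sM _ _ KL Ko) (embedding_nat sigma0_emb) cabsE normrM.
  rewrite rmorphM /= rmorph_nat normr_nat ler_wpM2l //.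
pose g := lp * h.
have gE (F : comNzRingType) (x : F) :
  (map_poly intr g).[x] = (map_poly intr lp).[x] * (map_poly intr h).[x].
  by rewrite rmorphM hornerM.
have ga : (map_poly intr g).[alpha] = L%:R * omega * V by rewrite gE lpa hE.
have o0 : omega != 0.
  by rewrite -normr_gt0 (lt_le_trans _ oB) // invr_gt0.
have g0 : (map_poly intr g).[alpha] != 0 by rewrite ga !mulf_neq0 // gt_eqF.
have gD : `|(map_poly intr g).[alpha]| * `|(map_poly intr g).[alpha^-1]| <= D.
  rewrite ga gE !normrM (gtr0_norm L0) (gtr0_norm V0) -/hV.
  apply: (@le_trans _ _ (A * B * V * (A * C * hV))); last first.
    by rewrite /D ler_wpDl // le_eqVlt; apply/orP; left; apply/eqP; ring.
  apply: ler_pM.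
  - by rewrite !mulr_ge0 ?(ltW L0) ?(ltW V0).
  - by rewrite mulr_ge0.
  - by rewrite ler_wpM2r ?(ltW V0) // ler_pM // ltW.
  - by rewrite ler_wpM2r // (le_trans lpaV) // ler_wpM2r // ltW.
have [N0 HN0] := Hk g g0 gD.
pose theta := - (2 * pi * omega).
have HN m : (N0 <= m)%N ->
    delta * m%:R <= eta * \sum_(j < m) (1 - cos (theta * (alpha ^+ (k * j) * V))).
  move=> /HN0 h1; rewrite /delta -mulrA ler_wpM2l ?(ltW eta0) //.
  have h2 : kappa * m%:R <= \sum_(j < m) (1 - cos (2 * pi * ((map_poly intr g).[alpha] * alpha ^+ (k * j)))).
    by rewrite sumrB sumr_const card_ord; lra.
  rewrite mulrAC ler_pdivrMr ?exprn_gt0 // (le_trans h2) // mulr_suml.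
  apply: ler_sum => j _.
  have -> : 2 * pi * ((map_poly intr g).[alpha] * alpha ^+ (k * j)) =
            (2 * pi * omega * (alpha ^+ (k * j) * V)) *+ L.
    by rewrite ga -[RHS]mulr_natr; ring.
  rewrite (le_trans (one_sub_cosMn _ _)) // /theta mulNr cosN mulrC.
  by rewrite ler_wpM2l ?subr_ge0 ?cos_le1 // lerXn2r ?nnegrE ?(ltW A0) ?(ltW L0).
have lang a : exists2 P : R, 0 < P & forall m v, in_language v ->
    (forall c, wlen p v <= alpha ^+ m * p 0 c) ->
    cabs (wsum p theta a v) <= P * beta ^+ m.
  have [Cb Cb0 Hb] := block_decay p_gt0 a1 p_eigen (ltn0Sn n) b1 k0 eta0
    (contr theta a) beta_k HN.
  exists (3 * prefix_cst p alpha beta Cb).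
    by rewrite mulr_gt0 // (lt_le_trans ltr01) // prefix_cst_ge1.
  move=> m v [e [M vM]] vle; rewrite -mulrA.
  exact: (factor_decay p_gt0 a1 p_eigen b1 Cb0 Hb vM).
have /choice[P HP] : forall a, exists P : R, 0 < P /\ forall m v, in_language v ->
    (forall c, wlen p v <= alpha ^+ m * p 0 c) ->
    cabs (wsum p theta a v) <= P * beta ^+ m.
  by move=> a; have [P P0 H] := lang a; exists P.
pose s := \sum_c (p 0 c)^-1.
pose PP := \sum_c P c.
have PP0 : 0 < PP.
  by rewrite /PP big_ord_recl ltr_pwDl ?(HP _).1 //; apply: sumr_ge0 => c _; rewrite ltW // (HP _).1.
have s0 : 0 < s.
  by rewrite /s big_ord_recl ltr_pwDl ?invr_gt0 //; apply: sumr_ge0 => c _; rewrite invr_ge0 ltW.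
exists (PP * (alpha * (s + 1)) `^ (1 - gamma)).
  by rewrite mulr_gt0 // powR_gt0 // mulr_gt0 // ltr_wpDr.
move=> a v ell vL ell1 vle.
have ell0 : 0 < ell := lt_le_trans ltr01 ell1.
have exm : exists m : nat, ell * s <= alpha ^+ m by exact: exprn_unbounded.
(* The condition makes every [zeta^m(c)] at least as long as [ell]; by minimality
   [alpha ^+ m <= alpha * (s + 1) * ell], where the 1 covers [m = 0]. *)
have [m ms mmin] := ex_minnP exm.
have vm c : wlen p v <= alpha ^+ m * p 0 c.
  rewrite (le_trans vle) // -ler_pdivrMr // (le_trans _ ms) // ler_wpM2l ?(ltW ell0) //.
  by rewrite /s (bigD1 c) //= lerDl; apply: sumr_ge0 => e _; rewrite invr_ge0 ltW.
rewrite (le_trans ((HP a).2 m v vL vm)) // beta_pow -mulrA -powRM; last 2 first.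
- by rewrite mulr_ge0 ?(ltW a0) // addr_ge0 // ltW.
- exact: ltW.
rewrite ler_pM ?powR_ge0 ?(ltW (HP a).1) //.
  by rewrite /PP (bigD1 a) //= lerDl; apply: sumr_ge0 => c _; rewrite ltW // (HP _).1.
rewrite ge0_ler_powR ?nnegrE ?exprn_ge0 ?(ltW a0) //.
- by rewrite gamma1 divr_ge0 // ltW.
- by rewrite !mulr_ge0 ?(ltW a0) ?(ltW ell0) // addr_ge0 // ltW.
case: m ms mmin {vm} => [|m] ms mmin.
  rewrite expr0; apply: mulr_ege1 => //; apply: mulr_ege1; first exact: ltW.
  by rewrite lerDr ltW.
have := mmin m; rewrite ltnn; case: leP => // [_ /(_ isT)//|lt_m _].
rewrite exprS -mulrA ler_wpM2l ?(ltW a0) // (le_trans (ltW lt_m)) // mulrC.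
by rewrite ler_wpM2r ?(ltW ell0) // lerDl.
Qed.

End WordSumBound.

(** * Tilings and the suspension flow *)

Section GeometricCut.
Context (R : realType) (tau theta : R) (N : nat).
Hypotheses (tau_gt0 : 0 < tau).

(** A discrete primitive of [expi (theta * x)]: multiplied by [1 - expi (theta * tau)] it telescopes
    to a value close to [1 - expi (theta * u)]. *)
Definition cut_sum (u : R) : R[i] :=
  \sum_(k < N) (k%:R * tau < u)%R%:R * expi (theta * tau) ^+ k.

Lemma cut_sumE u : exists K : nat,
  [/\ cut_sum u = \sum_(k < K) expi (theta * tau) ^+ k,
      (K <= N)%N & 0 <= u <= N%:R * tau -> `|K%:R * tau - u| <= tau].
Proof.
have exK : exists K : nat, u <= K%:R * tau.
  exists (Num.truncn (u / tau)).+1.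
  by rewrite -ler_pdivrMr // ltW // truncnS_gt.
have [K uK Kmin] := ex_minnP exK.
have ltE k : (k%:R * tau < u) = (k < K)%N.
  apply/idP/idP => [ku|kK].
    rewrite -(ltr_nat R) -(ltr_pM2r tau_gt0); exact: lt_le_trans ku uK.
  by rewrite ltNge; apply/negP => /Kmin; rewrite leqNgt kK.
exists (minn N K); split; last 2 first.
- exact: geq_minl.
- move=> /andP[u0 uN]; have KN : (K <= N)%N by apply: Kmin.
  rewrite (minn_idPr KN) ger0_norm ?subr_ge0 // lerBlDr.
  case: (K) (ltE) => [|m] E; first by rewrite mul0r addr_ge0 // ltW.
  by rewrite -nat1r mulrDl mul1r lerD2l ltW // E.
rewrite /cut_sum; under eq_bigr do rewrite ltE.
rewrite (big_ord_widen N (fun k => expi (theta * tau) ^+ k) (geq_minl N K)).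
rewrite [RHS]big_mkcond /=; apply: eq_bigr => k _.
by rewrite leq_min ltn_ord /=; case: (k < K)%N; rewrite ?mul1r ?mul0r.
Qed.

Lemma cut_sum_bound u : cabs ((1 - expi (theta * tau)) * cut_sum u) <= 2.
Proof.
have [K [-> _ _]] := cut_sumE u.
rewrite -opprB mulNr cabsN -subrX1 (le_trans (cabsD _ _)) // cabsN cabs1 cabsX cabs_expi.
by rewrite expr1n -[2]/(1 + 1)%:R natrD.
Qed.

Lemma cut_sum_close u : 0 <= u <= N%:R * tau ->
  cabs ((1 - expi (theta * tau)) * cut_sum u - (1 - expi (theta * u))) <=
  2 * (`|theta| * tau).
Proof.
move=> uN; have [K [-> _ /(_ uN) Ku]] := cut_sumE u.
have -> : (1 - expi (theta * tau)) * \sum_(k < K) expi (theta * tau) ^+ k =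
    1 - expi (theta * tau) ^+ K.
  by rewrite -[1 - expi _]opprB mulNr -subrX1 opprB.
rewrite opprB addrC addrA addrNK -expiMn (le_trans (expi_lipschitz _ _)) // ler_wpM2l //.
rewrite -(mulr_natr (theta * tau)) -[_ * tau * _]mulrA -mulrBr normrM ler_wpM2l //.
by rewrite [tau * _]mulrC distrC.
Qed.

End GeometricCut.

Section Tiling.
Context (R : realType) (d : nat) (p : 'rV[R]_d) (c : nat -> 'I_d).
Hypothesis p_gt0 : forall b, 0 < p 0 b.

Definition tile_pos (n : nat) : R := \sum_(j < n) p 0 (c j).

Definition in_tile (a : 'I_d) (u : R) : bool :=
  `[< exists n, c n = a /\ tile_pos n <= u < tile_pos n.+1 >].

Lemma tile_posS n : tile_pos n.+1 = tile_pos n + p 0 (c n).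
Proof. by rewrite /tile_pos big_ord_recr. Qed.

Lemma tile_pos_homo : {homo tile_pos : m n / (m <= n)%N >-> m <= n}.
Proof.
by apply: homo_leq => [//|y x z|n]; [exact: le_trans|rewrite tile_posS lerDl ltW].
Qed.

Lemma tile_pos_unbounded (x : R) : exists n, x < tile_pos n.
Proof.
pose s := \sum_b (p 0 b)^-1.
have ps b : 1 <= p 0 b * s.
  rewrite -ler_pdivrMl // mulr1 /s (bigD1 b) //= lerDl.
  by apply: sumr_ge0 => e _; rewrite invr_ge0 ltW.
have posn n : n%:R <= tile_pos n * s.
  elim: n => [|n IHn]; first by rewrite /tile_pos big_ord0 mul0r.
  by rewrite tile_posS mulrDl -natr1 lerD.
have s0 : 0 < s.
  have := ps (c 0); rewrite -(pmulr_rgt0 s (p_gt0 (c 0))); exact: lt_le_trans.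
exists (Num.truncn (x * s)).+1; rewrite -(ltr_pM2r s0) (lt_le_trans _ (posn _)) //.
exact: truncnS_gt.
Qed.

Lemma tile_witness (u : R) : 0 <= u -> exists n, tile_pos n <= u < tile_pos n.+1.
Proof.
move=> u0; have [[|n] un nmin] := ex_minnP (tile_pos_unbounded u).
  by move: un; rewrite /tile_pos big_ord0 ltNge u0.
exists n; rewrite un andbT leNgt; apply/negP => /nmin; by rewrite ltnn.
Qed.

Lemma wsum_iota theta a s i m :
  \sum_(j < m) (c (i + j) == a)%:R * expi (theta * (tile_pos (i + j) - s)) =
  expi (theta * (tile_pos i - s)) * wsum p theta a [seq c j | j <- iota i m].
Proof.
elim: m i => [|m IHm] i; first by rewrite big_ord0 mulr0.
rewrite big_ord_recl /= addn0 [RHS]mulrDr; congr (_ + _); first exact: mulrC.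
under eq_bigr do rewrite /bump /= add1n -addSnnS.
by rewrite IHm mulrA -expiD tile_posS; congr (expi _ * _); ring.
Qed.

Lemma wlen_iota i m : wlen p [seq c j | j <- iota i m] = tile_pos (i + m) - tile_pos i.
Proof.
elim: m i => [|m IHm] i; first by rewrite /wlen big_nil addn0 subrr.
by rewrite /= wlen_cons IHm -addSnnS tile_posS; ring.
Qed.

Context (tau theta s : R) (N : nat) (a : 'I_d).
Hypotheses (tau_gt0 : 0 < tau) (s_ge0 : 0 <= s) (s_lt : s < p 0 (c 0)).

Local Notation cut := (cut_sum tau theta N).
Local Notation q := (expi (theta * tau)).

Definition tile_sum : R[i] :=
  \sum_(k < N) (in_tile a (s + k%:R * tau))%:R * q ^+ k.

(** The samples in a tile are those before its right end minus those before its left end, so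
    grouping by tiles produces differences of [cut_sum]. *)
Lemma tile_sumE m : s + N%:R * tau < tile_pos m ->
  tile_sum = \sum_(n < m) (c n == a)%:R * (cut (tile_pos n.+1 - s) - cut (tile_pos n - s)).
Proof.
move=> Nm; rewrite /tile_sum /cut_sum.
under [RHS]eq_bigr do rewrite -sumrB mulr_sumr.
rewrite exchange_big /=; apply: eq_bigr => k _.
under [RHS]eq_bigr do rewrite -mulrBl mulrA.
rewrite -mulr_suml; congr (_ * _).
have u0 : 0 <= s + k%:R * tau by rewrite addr_ge0 // mulr_ge0 // ltW.
have [n0 /andP[n0l n0r]] := tile_witness u0.
have n0m : (n0 < m)%N.
  rewrite ltnNge; apply/negP => /tile_pos_homo h.
  have : k%:R * tau < N%:R * tau by rewrite ltr_pM2r // ltr_nat.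
  lra.
have lt_tile n : (k%:R * tau < tile_pos n - s) = (n0 < n)%N.
  rewrite ltrBrDr addrC; apply/idP/idP => [h|/tile_pos_homo]; last exact: lt_le_trans.
  by rewrite ltnNge; apply/negP => /tile_pos_homo h2; lra.
rewrite (bigD1 (Ordinal n0m)) //= !lt_tile ltnn ltnSn subr0 mulr1 big1 ?addr0.
  have uniq_n n : tile_pos n <= s + k%:R * tau < tile_pos n.+1 -> n = n0.
    move=> /andP[nl nr]; have := lt_tile n; have := lt_tile n.+1.
    rewrite !ltrBrDr ![k%:R * tau + s]addrC nr ltNge nl /= => /esym h1 /esym h2.
    by apply/eqP; rewrite eqn_leq leqNgt h2 /= -ltnS h1.
  suff -> : in_tile a (s + k%:R * tau) = (c n0 == a) by [].
  apply/asboolP/eqP => [[n [<- /uniq_n ->//]]|na].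
  by exists n0; split => //; rewrite n0l.
move=> n nn0; rewrite !lt_tile ltnS leq_eqVlt.
have /negPf -> : n0 != n by apply: contra nn0 => /eqP n0E; apply/eqP/val_inj.
by rewrite /= subrr mulr0.
Qed.

(** The first and the last tile may be cut by the window and cost 4 each. On a complete tile
    labelled [a], after multiplication by [1 - q], the difference of cuts is the phase of the left
    end times [1 - expi (theta * p 0 a)], up to [4 |theta| tau]; this factor is common to all such
    tiles and at most 2 in modulus. *)
Lemma tile_sum_bound : exists m : nat, let w := [seq c j | j <- iota 1 m] in
  wlen p w <= N%:R * tau /\
  cabs ((1 - q) * tile_sum) <= 8 + 2 * cabs (wsum p theta a w) + m%:R * (4 * (`|theta| * tau)).
Proof.
have [m1 m1P m1min] := ex_minnP (tile_pos_unbounded (s + N%:R * tau)).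
have NT0 : 0 <= N%:R * tau by rewrite mulr_ge0 // ltW.
case: m1 m1P m1min => [|m] mP mmin.
  by move: mP; rewrite /tile_pos big_ord0 ltNge addr_ge0.
have mle : tile_pos m <= s + N%:R * tau.
  by rewrite leNgt; apply/negP => /mmin; rewrite ltnn.
rewrite (tile_sumE mP) mulr_sumr.
pose D n := (1 - q) * ((c n == a)%:R * (cut (tile_pos n.+1 - s) - cut (tile_pos n - s))).
have D4 n : cabs (D n) <= 4.
  rewrite /D mulrCA cabsM; apply: (@le_trans _ _ (1 * 4)); last by rewrite mul1r.
  rewrite ler_pM ?cabs_ge0 //; first by case: (c n == a); rewrite ?cabs1 ?cabs0.
  rewrite mulrBr (le_trans (cabsD _ _)) // cabsN.
  by have := cut_sum_bound theta N tau_gt0 (tile_pos n.+1 - s);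
     have := cut_sum_bound theta N tau_gt0 (tile_pos n - s); lra.
case: m mP mmin mle => [|m] mP mmin mle.
  exists 0%N; rewrite /= /wlen big_nil cabs0 mulr0 mul0r !addr0; split => //.
  by rewrite big_ord1 (le_trans (D4 0%N)) // ler_nat.
have pos1E : tile_pos 1 = p 0 (c 0) by rewrite tile_posS /tile_pos big_ord0 add0r.
exists m => w; split.
  by rewrite /w wlen_iota add1n pos1E lerBlDr (le_trans mle) // addrC lerD2l ltW.
rewrite big_ord_recl big_ord_recr /= /bump /= add1n.
under eq_bigr do rewrite add1n.
have pos1 : s < tile_pos 1 by rewrite pos1E.
pose e (n : nat) : R[i] := expi (theta * (tile_pos n - s)).
have Derr n : (n < m)%N -> cabs (D n.+1 - (1 - expi (theta * p 0 a)) * ((c n.+1 == a)%:R * e n.+1)) <=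
    4 * (`|theta| * tau).
  move=> nm; rewrite /D /e; have [ca|] := eqVneq (c n.+1) a; last first.
    by rewrite !mul0r !mulr0 subr0 cabs0 mulr_ge0 // mulr_ge0 // ltW.
  rewrite !mul1r.
  have b1 : 0 <= tile_pos n.+1 - s <= N%:R * tau.
    have := @tile_pos_homo 1 n.+1 isT; have := @tile_pos_homo n.+1 m.+1 (ltnW nm); move=> ? ?; apply/andP; split; lra.
  have b2 : 0 <= tile_pos n.+2 - s <= N%:R * tau.
    have := @tile_pos_homo 1 n.+2 isT; have := @tile_pos_homo n.+2 m.+1 nm; move=> ? ?; apply/andP; split; lra.
  have h1 := cut_sum_close theta tau_gt0 b1; have h2 := cut_sum_close theta tau_gt0 b2.
  have E : theta * (tile_pos n.+2 - s) = theta * p 0 a + theta * (tile_pos n.+1 - s).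
    by rewrite [tile_pos n.+2]tile_posS ca; ring.
  have -> : (1 - q) * (cut (tile_pos n.+2 - s) - cut (tile_pos n.+1 - s)) -
      (1 - expi (theta * p 0 a)) * expi (theta * (tile_pos n.+1 - s)) =
    ((1 - q) * cut (tile_pos n.+2 - s) - (1 - expi (theta * (tile_pos n.+2 - s)))) -
    ((1 - q) * cut (tile_pos n.+1 - s) - (1 - expi (theta * (tile_pos n.+1 - s)))).
    by rewrite E expiD; ring.
  by rewrite (le_trans (cabsD _ _)) // cabsN; lra.
have sumD : cabs (\sum_(n < m) D n.+1) <= 2 * cabs (wsum p theta a w) + m%:R * (4 * (`|theta| * tau)).
  pose F (n : 'I_m) := (1 - expi (theta * p 0 a)) * ((c n.+1 == a)%:R * e n.+1).
  have -> : \sum_(n < m) D n.+1 = \sum_(n < m) F n + \sum_(n < m) (D n.+1 - F n).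
    by rewrite -big_split /=; apply: eq_bigr => n _; rewrite addrC subrK.
  rewrite (le_trans (cabsD _ _)) // lerD //.
    rewrite -mulr_sumr (wsum_iota theta a s 1 m) cabsM cabs_expiM ler_wpM2r ?cabs_ge0 //.
    rewrite (le_trans (cabsD _ _)) // cabsN cabs1 cabs_expi; lra.
  rewrite (le_trans (cabs_sum _ _ _)) // (le_trans (ler_sum _ (fun (n : 'I_m) _ => Derr n (ltn_ord n)))) //.
  by rewrite sumr_const card_ord -[leLHS]mulr_natl.
rewrite -/(D 0%N) -/(D m.+1).
have t1 := le_trans (cabsD (\sum_(n < m) D n.+1) (D m.+1)) (lerD sumD (D4 m.+1)).
apply: le_trans (le_trans (cabsD _ _) (lerD (D4 0%N) t1)) _.
lra.
Qed.

End Tiling.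

Section SuspensionFlow.
Local Open Scope quotient_scope.
Context (R : realType) (d : nat) (zeta : substitution d) (p : 'rV[R]_d) (aper : aperiodic zeta).
Hypothesis p_gt0 : forall b, 0 < p 0 b.

Local Notation X := (subshift zeta).
Local Notation F := (@roof_map R d zeta p).
Local Notation susp := (suspension p aper).
Local Notation pi_ u := (\pi_(suspension p aper) u).

Definition orbit_letter (x : X) (n : nat) : 'I_d := (set_val x : full_shift d) n%:Z.

Lemma pi_eqP (u v : X * R) : pi_ u = pi_ v <-> same_orbit p u v.
Proof.
split=> [/eqmodP/asboolP //|H]; apply/eqmodP; exact/asboolP.
Qed.

Lemma iter_shift n (x : X) (k : int) :
  (set_val (iter n (@Defs.shift d zeta) x) : full_shift d) k =
  (set_val x : full_shift d) (k + n%:Z).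
Proof.
elim: n k => [|n IHn] k; first by rewrite addr0.
by rewrite /= /lshift_seq -[LHS]/((set_val (iter n _ x) : full_shift d) (k + 1)) IHn -addrA -PoszD add1n.
Qed.

Lemma letter0_iter n (x : X) : letter0 (iter n (@Defs.shift d zeta) x) = orbit_letter x n.
Proof. by rewrite /letter0 iter_shift add0r. Qed.

Lemma iter_roof_map n (x : X) (s : R) :
  iter n F (x, s) = (iter n (@Defs.shift d zeta) x, s - tile_pos p (orbit_letter x) n).
Proof.
elim: n => [|n IHn]; first by rewrite /= /tile_pos big_ord0 subr0.
by rewrite /= IHn /roof_map /= tile_posS opprD addrA -(letter0_iter n x).
Qed.

Lemma same_orbit_shift (t : R) (u v : X * R) : same_orbit p u v ->
  same_orbit p (u.1, u.2 + t) (v.1, v.2 + t).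
Proof.
case: u v => [x s] [y s'] [n [|]]; rewrite iter_roof_map => -[<- <-]; exists n; [left|right].
  by rewrite iter_roof_map /= addrAC.
by rewrite iter_roof_map /= addrAC.
Qed.

Lemma pi_flow (t : R) (u : X * R) : flow p aper t (pi_ u) = pi_ (u.1, u.2 + t).
Proof.
rewrite /flow; apply/pi_eqP; apply: same_orbit_shift.
by apply/pi_eqP; rewrite reprK.
Qed.

Lemma flowD (s t : R) q : flow p aper s (flow p aper t q) = flow p aper (t + s) q.
Proof.
have [u ->] : exists u, q = pi_ u by exists (repr q); rewrite reprK.
by rewrite !pi_flow /= addrA.
Qed.

Lemma pi_iter n (u : X * R) : pi_ (iter n F u) = pi_ u.
Proof. by apply/pi_eqP; exists n; right. Qed.

(** A point of nonnegative height reaches the fundamental domain by forward iterates of the roof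
    map, so the letters at nonnegative indices decide. *)
Lemma letter_set_pi (a : 'I_d) (x : X) (u : R) : 0 <= u ->
  letter_set p aper a (pi_ (x, u)) <-> in_tile p (orbit_letter x) a u.
Proof.
move=> u0; split; last first.
  move=> /asboolP[n [<- /andP[un nu]]].
  exists (iter n F (x, u)); last exact: pi_iter.
  rewrite iter_roof_map /= letter0_iter; split=> //.
  by rewrite subr_ge0 un /= ltrBlDl -tile_posS.
move=> [[y s'] /= [ya /andP[s0 sp]] /pi_eqP[n [|]]]; rewrite iter_roof_map => -[E1 E2]; apply/asboolP.
  case: n E1 E2 => [|n] E1 E2.
    move: E2; rewrite /tile_pos big_ord0 subr0 => <-; rewrite -{}E1 /=.
    exists 0%N; rewrite /tile_pos big_ord0 big_ord_recl big_ord0 addr0.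
    by rewrite -[orbit_letter _ _](letter0_iter 0) /= ya s0 sp.
  exfalso; have := @tile_pos_homo _ _ p (orbit_letter y) p_gt0 1 n.+1 isT.
  rewrite {1}/tile_pos big_ord_recl big_ord0 addr0 -[orbit_letter _ _](letter0_iter 0) /= ya.
  by move=> h; move: u0; rewrite -E2 subr_ge0 leNgt => /negP; apply; exact: lt_le_trans sp h.
exists n; rewrite -[orbit_letter x n]letter0_iter E1; split => //.
rewrite tile_posS -[orbit_letter x n]letter0_iter E1 ya.
by move: s0 sp; rewrite -E2 subr_ge0 ltrBlDl => -> ->.
Qed.

Lemma unshift_subshift (x : full_shift d) : x \in subshift zeta ->
  (fun n => x (n - 1) : 'I_d) \in subshift zeta.
Proof.
rewrite !inE => Xx i k; have [a [n H]] := Xx (i - 1) k.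
exists a, n; apply: etrans H; congr (infix _ _).
by apply: eq_map => j; rewrite addrAC.
Qed.

Definition unshift (x : X) : X := SigSub (unshift_subshift (valP x)).

Lemma unshiftK (x : X) : Defs.shift (unshift x) = x.
Proof.
apply: val_inj; apply/funext => n /=.
by rewrite /lshift_seq /= addrK.
Qed.

Lemma shiftK (x : X) : unshift (Defs.shift x) = x.
Proof.
apply: val_inj; apply/funext => n /=.
by rewrite /lshift_seq /= subrK.
Qed.

Definition unroof_map (u : X * R) : X * R := (unshift u.1, u.2 + p 0 (letter0 (unshift u.1))).

Lemma roof_mapK : cancel F unroof_map.
Proof. by case=> x s; rewrite /unroof_map /roof_map /= shiftK subrK. Qed.

Lemma unroof_mapK : cancel unroof_map F.
Proof. by case=> x s; rewrite /unroof_map /roof_map /= unshiftK addrK. Qed.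

Lemma iter_unroof_mapK n : cancel (iter n unroof_map) (iter n F).
Proof. by elim: n => [//|n IHn] u; rewrite iterSr /= unroof_mapK IHn. Qed.

Lemma iter_roof_mapK n : cancel (iter n F) (iter n unroof_map).
Proof. by elim: n => [//|n IHn] u; rewrite iterSr /= roof_mapK IHn. Qed.

Lemma pi_iter_unroof n (u : X * R) : pi_ (iter n unroof_map u) = pi_ u.
Proof. by rewrite -(pi_iter n (iter n unroof_map u)) iter_unroof_mapK. Qed.

(** Each backward iterate raises the height by at least [S^-1]; once it is nonnegative, the tile
    containing it tells how often to iterate forward. *)
Lemma fundamental_domain (q : susp) : exists (x : X) (s : R),
  [/\ q = pi_ (x, s), 0 <= s & s < p 0 (orbit_letter x 0)].
Proof.
have [[x s] ->] : exists u, q = pi_ u by exists (repr q); rewrite reprK.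
pose S := \sum_b (p 0 b)^-1.
have pS b : 1 <= p 0 b * S.
  rewrite -ler_pdivrMl // mulr1 /S (bigD1 b) //= lerDl.
  by apply: sumr_ge0 => e _; rewrite invr_ge0 ltW.
have S0 : 0 < S.
  have := pS (letter0 x); rewrite -(pmulr_rgt0 S (p_gt0 (letter0 x))); exact: lt_le_trans.
have up n : n%:R <= ((iter n unroof_map (x, s)).2 - s) * S.
  elim: n => [|n IHn]; first by rewrite /= subrr mul0r.
  by rewrite /= addrAC mulrDl -natr1 lerD.
have [n sn] : exists n, 0 <= (iter n unroof_map (x, s)).2.
  exists (Num.truncn (- s * S)).+1; have := up (Num.truncn (- s * S)).+1.
  set y := (iter _ _ _).2 => h.
  have : - s * S <= (y - s) * S by rewrite (le_trans _ h) // ltW // truncnS_gt.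
  by rewrite ler_pM2r // lerBrDr addNr.
rewrite -(pi_iter_unroof n (x, s)); move: sn; case: (iter n unroof_map (x, s)) => y t /= t0.
have [m /andP[mt tm]] := tile_witness (orbit_letter y) p_gt0 t0.
exists (iter m (@Defs.shift d zeta) y), (t - tile_pos p (orbit_letter y) m).
rewrite -iter_roof_map pi_iter -[orbit_letter _ 0](letter0_iter 0) /= letter0_iter.
by rewrite subr_ge0 mt ltrBlDl -tile_posS tm.
Qed.

Lemma orbit_language (x : X) i m : exists (a : 'I_d) (n : nat),
  infix [seq orbit_letter x j | j <- iota i m] (iter n (subst_word zeta) [:: a]).
Proof.
have := valP x; rewrite inE => /(_ i%:Z m)[a [n H]]; exists a, n.
(* A block with parameter [m] has [m.+1] letters; the last one is dropped. *)
apply: infix_trans H; apply/infixP; exists [::], [:: orbit_letter x (i + m)].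
rewrite /block -(addn1 m) iotaD map_cat /= add0n; congr (_ ++ [:: _]).
rewrite (_ : iota i m = [seq (i + j)%N | j <- iota 0 m]) -?map_comp //.
by rewrite -iotaDl addn0.
Qed.

End SuspensionFlow.

(** * Topology and measurability of the suspension *)

Lemma continuous_into_prod (Z : topologicalType) (I : eqType) (K : I -> topologicalType)
  (f : Z -> prod_topology K) :
  (forall i, continuous (fun z => f z i)) -> continuous f.
Proof.
move=> cf z; apply/cvg_sup => i.
move=> U [? /= [[W oW <-]]] /= Wfz /filterS; apply; apply: (cf i).
exact: open_nbhs_nbhs.
Qed.

Lemma continuous_discrete (D : discreteTopologicalType) (Z : topologicalType) (f : D -> Z) :
  continuous f.
Proof. by apply/continuousP => A _; exact: discrete_open. Qed.

Lemma continuous_pair (Z U V : topologicalType) (f : Z -> U) (g : Z -> V) :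
  continuous f -> continuous g -> continuous (fun z => (f z, g z)).
Proof. by move=> cf cg z; exact: (cvg_pair (cf z) (cg z)). Qed.

Section SuspensionTopology.
Local Open Scope quotient_scope.
Context (R : realType) (d : nat) (zeta : substitution d) (p : 'rV[R]_d) (aper : aperiodic zeta).
Hypothesis p_gt0 : forall b, 0 < p 0 b.

Local Notation X := (subshift zeta).
Local Notation F := (@roof_map R d zeta p).
Local Notation G := (@unroof_map R d zeta p).
Local Notation susp := (suspension p aper).
Local Notation pi_ u := (\pi_(suspension p aper) u).

Lemma continuous_coord (k : int) :
  continuous (fun x : X => (set_val x : full_shift d) k : discrete_topology 'I_d).
Proof.
move=> x; apply: (continuous_comp (f := set_val : X -> full_shift d)
  (g := fun h : full_shift d => h k)).
  exact: initial_continuous.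
exact: (@proj_continuous _ (fun _ : int => discrete_topology 'I_d) k).
Qed.

Lemma continuous_shift : continuous (@Defs.shift d zeta).
Proof.
apply: continuous_comp_initial; apply: continuous_into_prod => k.
exact: continuous_coord.
Qed.

Lemma continuous_unshift : continuous (@unshift d zeta).
Proof.
apply: continuous_comp_initial; apply: continuous_into_prod => k.
exact: continuous_coord.
Qed.

Lemma continuous_roof_letter : continuous (fun x : X => p 0 (letter0 x)).
Proof.
move=> x; apply: (continuous_comp (f := fun x : X => letter0 x : discrete_topology 'I_d)
  (g := fun b : discrete_topology 'I_d => p 0 b)).
  exact: continuous_coord.
exact: continuous_discrete.
Qed.

Lemma continuous_roof_map : continuous F.
Proof.
apply: continuous_pair => u.
  apply: (continuous_comp (f := fst) (g := @Defs.shift d zeta)); first exact: cvg_fst.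
  exact: continuous_shift.
apply: cvgB; first exact: cvg_snd.
apply: (continuous_comp (f := fst) (g := fun x : X => p 0 (letter0 x))); first exact: cvg_fst.
exact: continuous_roof_letter.
Qed.

Lemma continuous_unroof_map : continuous G.
Proof.
apply: continuous_pair => u.
  apply: (continuous_comp (f := fst) (g := @unshift d zeta)); first exact: cvg_fst.
  exact: continuous_unshift.
apply: cvgD; first exact: cvg_snd.
apply: (continuous_comp (f := fst) (g := fun x : X => p 0 (letter0 (unshift x)))); first exact: cvg_fst.
apply: (continuous_comp (f := @unshift d zeta) (g := fun x : X => p 0 (letter0 x))).
  exact: continuous_unshift.
exact: continuous_roof_letter.
Qed.

Lemma continuous_iter (T : topologicalType) (f : T -> T) n : continuous f -> continuous (iter n f).
Proof.
move=> cf; elim: n => [|n IHn] x; first exact: cvg_id.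
exact: (continuous_comp (IHn x) (cf _)).
Qed.

(** The saturation of an open set is the union of its preimages under all iterates of the roof map
    and of its inverse, which are continuous. *)
Lemma open_pi_image (U : set (X * R)) : open U -> open ((fun u => pi_ u) @` U : set susp).
Proof.
move=> oU; suff : open ((fun u : X * R => pi_ u) @^-1` ((fun u => pi_ u) @` U)) by [].
have -> : (fun u : X * R => pi_ u) @^-1` ((fun u => pi_ u) @` U) =
  \bigcup_(n in [set: nat]) (iter n F @^-1` U) `|` \bigcup_(n in [set: nat]) (iter n G @^-1` U).
  apply/seteqP; split=> [u [v Uv /pi_eqP[n [vu|uv]]]|u [[n _]|[n _]] /= Un].
  - by right; exists n => //=; rewrite -vu iter_roof_mapK.
  - by left; exists n => //=; rewrite uv.
  - by exists (iter n F u) => //; exact: pi_iter.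
  - by exists (iter n G u) => //; exact: pi_iter_unroof.
have cF n := @continuous_iter _ F n continuous_roof_map.
have cG n := @continuous_iter _ G n continuous_unroof_map.
by apply: openU; apply: bigcup_open => n _; [move/continuousP: (cF n)|move/continuousP: (cG n)]; apply.
Qed.

(** The condition [0 <= s] is not open. The set is recovered as a countable intersection of images
    of the open sets [O k], whose lower end [- k.+1^-1] tends to 0. *)
Lemma measurable_letter_set (a : 'I_d) :
  measurable (letter_set p aper a : set (borel_suspension p aper)).
Proof.
pose O (k : nat) : set (X * R) := [set u | letter0 u.1 = a /\ - k.+1%:R^-1 < u.2 < p 0 a].
have oO k : open (O k).
  have -> : O k = ((fun u : X * R => letter0 u.1 : discrete_topology 'I_d) @^-1` [set a]) `&`
      (snd @^-1` `]- k.+1%:R^-1, p 0 a[).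
    by apply/seteqP; split=> u /=; rewrite in_itv /=.
  apply: openI.
    have c1 : continuous (fun u : X * R => letter0 u.1 : discrete_topology 'I_d).
      move=> u; apply: (continuous_comp (f := fst)
        (g := fun x : X => letter0 x : discrete_topology 'I_d)); first exact: cvg_fst.
      exact: continuous_coord.
    by move/continuousP: c1; apply; exact: discrete_open.
  have c2 : continuous (snd : X * R -> R) by move=> u; exact: cvg_snd.
  by move/continuousP: c2; apply; exact: interval_open.
suff -> : letter_set p aper a = \bigcap_(k in [set: nat]) ((fun u => pi_ u) @` O k).
  apply: (@bigcap_measurable _ (borel_suspension p aper)) => [|k _]; first by exists 0%N.
  apply: sub_sigma_algebra; exact: open_pi_image.
apply/seteqP; split=> [q [u [ua /andP[u0 up]] <-] k _|q qO].
  by exists u => //; split=> //; rewrite up andbT (lt_le_trans _ u0) // oppr_lt0 invr_gt0.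
have [x [s [qE s0 sp]]] := fundamental_domain p_gt0 q.
have e0 : 0 < p 0 (orbit_letter x 0) - s by rewrite subr_gt0.
(* This [k] excludes representatives of negative height: on the orbit of [(x, s)] they have height
   at most [s - p 0 (orbit_letter x 0) <= - k.+1^-1]. *)
have [k Hk] : exists k : nat, k.+1%:R^-1 <= p 0 (orbit_letter x 0) - s.
  exists (Num.truncn (p 0 (orbit_letter x 0) - s)^-1).
  by rewrite -[leRHS]invrK lef_pV2 ?posrE ?invr_gt0 // ltW // truncnS_gt.
have [[y t] [/= ya /andP[tk ta]] piE] := qO k I.
have [t0|t0] := leP 0 t; first by rewrite -piE; exists (y, t) => //; split; rewrite ?t0.
exfalso; have /pi_eqP[n] : pi_ (y, t) = pi_ (x, s) by rewrite piE.
rewrite !iter_roof_map => -[] [_ E].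
  have := @tile_pos_homo _ _ p (orbit_letter y) p_gt0 0 n (leq0n n).
  rewrite {1}/tile_pos big_ord0 => h; clear - E h t0 s0; lra.
case: n E => [|n] E.
  by move: E; rewrite /tile_pos big_ord0; clear - t0 s0; lra.
have := @tile_pos_homo _ _ p (orbit_letter x) p_gt0 1 n.+1 isT.
rewrite {1}/tile_pos big_ord_recl big_ord0 addr0 /= => h.
have h' : p 0 (orbit_letter x 0) <= tile_pos p (orbit_letter x) n.+1 := h.
have t_le : t <= - (p 0 (orbit_letter x 0) - s) by rewrite -E opprB lerB.
by move: tk; rewrite ltNge (le_trans t_le) // lerN2.
Qed.

Lemma measurable_flow (t : R) :
  @measurable_fun _ _ (borel_suspension p aper) (borel_suspension p aper) setT (flow p aper t).
Proof.
apply: (@measurability _ _ (borel_suspension p aper) (borel_suspension p aper) setT (flow p aper t) (@open (suspension p aper))); first by [].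
move=> _ [B oB <-]; rewrite setTI; apply: sub_sigma_algebra.
have oB' : open ((fun u : X * R => pi_ u) @^-1` B) by [].
suff : open ((fun u : X * R => pi_ u) @^-1` (flow p aper t @^-1` B)) by [].
have -> : (fun u : X * R => pi_ u) @^-1` (flow p aper t @^-1` B) =
    (fun u : X * R => (u.1, u.2 + t)) @^-1` ((fun u : X * R => pi_ u) @^-1` B).
  by apply/seteqP; split=> u /=; rewrite pi_flow.
have ct : continuous (fun u : X * R => (u.1, u.2 + t)).
  apply: continuous_pair => u; first exact: cvg_fst.
  by apply: cvgD; [exact: cvg_snd|exact: cvg_cst].
by move/continuousP: ct; apply.
Qed.

End SuspensionTopology.

(** * Spectral measures *)

Section FiniteMeasureIntegral.
Context d (T : measurableType d) (R : realType) (mu : {finite_measure set T -> \bar R}).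

Lemma bounded_integrable (f : T -> R) (M : R) :
  measurable_fun setT f -> (forall x, `|f x| <= M) -> mu.-integrable setT (EFin \o f).
Proof.
move=> mf fM; apply: measurable_bounded_integrable => //.
  exact: fin_num_fun_lty.
exists M; split; first exact: num_real.
by move=> y My x _ /=; exact: le_trans (fM x) (ltW My).
Qed.

Lemma Rintegral_sum (I : finType) (f : I -> T -> R) :
  (forall i, mu.-integrable setT (EFin \o f i)) ->
  mu.-integrable setT (EFin \o (fun x => \sum_i f i x)) /\
  Rintegral mu setT (fun x => \sum_i f i x) = \sum_i Rintegral mu setT (f i).
Proof.
move=> intf; elim: (index_enum I) => [|i s [IH1 IH2]].
  split; last by under eq_Rintegral do rewrite big_nil; rewrite big_nil Rintegral_cst // mul0r.
  under eq_fun do rewrite big_nil.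
  by apply: (@bounded_integrable _ 0) => // x; rewrite normr0.
split.
  under eq_fun do rewrite big_cons.
  exact: (integrableD measurableT (intf i) IH1).
under eq_Rintegral do rewrite big_cons.
by rewrite RintegralD // IH2 big_cons.
Qed.

Lemma Rintegral_sum2 (I J : finType) (f : I -> J -> T -> R) :
  (forall i j, mu.-integrable setT (EFin \o f i j)) ->
  mu.-integrable setT (EFin \o (fun x => \sum_i \sum_j f i j x)) /\
  Rintegral mu setT (fun x => \sum_i \sum_j f i j x) = \sum_i \sum_j Rintegral mu setT (f i j).
Proof.
move=> intf; have S i := Rintegral_sum (intf i).
have [? ->] := Rintegral_sum (fun i => (S i).1); split=> //.
by apply: eq_bigr => i _; rewrite (S i).2.
Qed.

End FiniteMeasureIntegral.

Lemma sqr_cos_sin_sum (R : realType) (N : nat) (u x : 'I_N -> R) :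
  (\sum_k u k * cos (x k)) ^+ 2 + (\sum_k u k * sin (x k)) ^+ 2 =
  \sum_k \sum_l u k * u l * cos (x k - x l).
Proof.
rewrite !expr2 !big_distrlr /= -big_split; apply: eq_bigr => k _ /=.
rewrite -big_split; apply: eq_bigr => l _ /=.
by rewrite cosB; ring.
Qed.

Section SpectralBound.
Context disp (T : measurableType disp) (R : realType) (mu : probability T R)
  (h : R -> T -> T) (A : set T) (nu : {finite_measure set (measurableTypeR R) -> \bar R}).
Hypothesis hD : forall s t q, h s (h t q) = h (t + s) q.
Hypothesis mh : forall t, measurable_fun setT (h t).
Hypothesis h_inv : forall t B, measurable B -> mu (h t @^-1` B) = mu B.
Hypothesis mA : measurable A.
Hypothesis corr : spectral_measure mu h (fun x => (\1_A x)%:C) nu.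

Let ind (t : R) (x : T) : R := \1_A (h t x).
Let m (t : R) : R := Rintegral mu setT (fun x => ind t x * \1_A x).

Lemma integral_cos_spectral (t : R) :
  Rintegral nu setT (fun w : R => cos (2 * pi * t * w)) = m t.
Proof.
have := congr1 (@complex.Re R) (corr t); rewrite /Cintegral /= => ->.
by apply: eq_Rintegral => x _; rewrite /ind /= oppr0 mulr0 subr0.
Qed.

(** The correlation function of an indicator is real-valued. *)
Lemma integral_sin_spectral (t : R) :
  Rintegral nu setT (fun w : R => sin (2 * pi * t * w)) = 0.
Proof.
have := congr1 (@complex.Im R) (corr t); rewrite /Cintegral /= => ->.
under eq_Rintegral do rewrite oppr0 mulr0 mul0r addr0.
by rewrite Rintegral_cst // mul0r.
Qed.

Let ind01 t x : 0 <= ind t x <= 1.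
Proof. by rewrite /ind indicE; case: (_ \in _); rewrite /= ?lexx ?ler01. Qed.

Let measurable_ind t : measurable_fun setT (ind t).
Proof. apply: measurableT_comp (mh t); exact: measurable_indic. Qed.

(** The integrand is the indicator of the preimage, under [h t], of a set that depends on [s - t]
    only, so invariance applies. *)
Lemma stationary_correlation (s t : R) :
  Rintegral mu setT (fun x => ind s x * ind t x) = m (s - t).
Proof.
have E (f : T -> R) B : measurable B -> (forall x, f x = \1_B x) ->
    Rintegral mu setT f = fine (mu B).
  move=> mB fB; rewrite /Rintegral.
  under eq_integral do rewrite fB.
  by rewrite integral_indic // setIT.
have mH u : measurable (h u @^-1` A).
  by rewrite -[X in measurable X]setTI; exact: mh.
rewrite /m (E _ (h t @^-1` (h (s - t) @^-1` A `&` A))); last first.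
- move=> x; rewrite /ind !indicE -natrM mulnb; congr (nat_of_bool _)%:R.
  by apply/andP/idP; rewrite !inE /= hD (addrC t) subrK.
- by rewrite -[X in measurable X]setTI; apply: mh => //; exact: measurableI.
rewrite h_inv; last exact: measurableI.
rewrite (E _ (h (s - t) @^-1` A `&` A)) //; first exact: measurableI.
move=> x; rewrite /ind !indicE -natrM mulnb; congr (nat_of_bool _)%:R.
by apply/andP/idP; rewrite !inE.
Qed.

Let integrable_cos (a b : R) : nu.-integrable setT (EFin \o (fun w : R => cos (a * w + b))).
Proof.
apply: (@bounded_integrable _ _ _ _ _ 1); last by move=> w; rewrite ler_norml cos_geN1 cos_le1.
apply: measurableT_comp; first exact: continuous_measurable_fun (@continuous_cos R).
by apply: measurable_funD => //; exact: measurable_funM.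
Qed.

Let integrable_cosB (a b c : R) :
  nu.-integrable setT (EFin \o (fun w : R => cos (a * (w - c) - b * (w - c)))).
Proof.
have := integrable_cos (a - b) (- (a - b) * c).
by congr integrable; apply/funext => w; congr (cos _)%:E; ring.
Qed.

Let integrable_ind2 (s t : R) : mu.-integrable setT (EFin \o (fun x => ind s x * ind t x)).
Proof.
apply: (@bounded_integrable _ _ _ _ _ 1); first exact: measurable_funM.
move=> x; have /andP[? ?] := ind01 s x; have /andP[? ?] := ind01 t x.
by rewrite ger0_norm ?mulr_ge0 // -[leRHS]mulr1 ler_pM.
Qed.

Let integrable_ind2Z (s t c : R) :
  mu.-integrable setT (EFin \o (fun x => ind s x * ind t x * c)).
Proof. exact: (integrableZr measurableT c (integrable_ind2 s t)). Qed.

(** In each term the cosine of a difference splits into a cosine part, which integrates to the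
    correlation at [(k - l) tau], and a sine part, whose integral vanishes. *)
Lemma spectral_quadratic_form (N : nat) (tau omega : R) :
  Rintegral nu setT (fun w : R => \sum_(k < N) \sum_(l < N)
     cos (2 * pi * (k%:R * tau) * (w - omega) - 2 * pi * (l%:R * tau) * (w - omega))) =
  Rintegral mu setT (fun x => \sum_(k < N) \sum_(l < N)
     ind (k%:R * tau) x * ind (l%:R * tau) x *
     cos (2 * pi * (k%:R * tau) * omega - 2 * pi * (l%:R * tau) * omega)).
Proof.
rewrite (Rintegral_sum2 _).2; last by move=> k l; exact: integrable_cosB.
rewrite (Rintegral_sum2 _).2; last by move=> k l; exact: integrable_ind2Z.
apply: eq_bigr => k _; apply: eq_bigr => l _; set t := k%:R * tau - l%:R * tau.
have -> : 2 * pi * (k%:R * tau) * omega - 2 * pi * (l%:R * tau) * omega = 2 * pi * t * omega.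
  by rewrite /t; ring.
rewrite RintegralZr // stationary_correlation -/t -integral_cos_spectral.
have -> : (fun w : R => cos (2 * pi * (k%:R * tau) * (w - omega) - 2 * pi * (l%:R * tau) * (w - omega))) =
    (fun w : R => cos (2 * pi * t * w) * cos (2 * pi * t * omega) + sin (2 * pi * t * w) * sin (2 * pi * t * omega)).
  by apply/funext => w; rewrite -cosB; congr cos; rewrite /t; ring.
have ic : nu.-integrable setT (EFin \o (fun w : R => cos (2 * pi * t * w))).
  have := integrable_cos (2 * pi * t) 0.
  by congr integrable; apply/funext => w /=; rewrite addr0.
have is_ : nu.-integrable setT (EFin \o (fun w : R => sin (2 * pi * t * w))).
  have := integrable_cos (2 * pi * t) (- (pi / 2)).
  by congr integrable; apply/funext => w /=; rewrite -sinDpihalf subrK.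
have intZr (f : R -> R) (c : R) : nu.-integrable setT (EFin \o f) ->
    nu.-integrable setT (EFin \o (fun w => f w * c)).
  by move=> intf; exact: (integrableZr measurableT c intf).
rewrite RintegralD ?RintegralZr //; [|exact: intZr..].
by rewrite integral_sin_spectral mul0r addr0.
Qed.

Lemma spectral_interval_bound (N : nat) (tau omega r Bd : R) :
  0 < tau -> (0 < N)%N -> 2 * pi * (N%:R * tau) * r <= 1/2 ->
  (forall x, cabs (\sum_(k < N) (\1_A (h (k%:R * tau) x))%:C *
     expi (- (2 * pi * omega) * tau) ^+ k) ^+ 2 <= Bd) ->
  (nu [set` `[(omega - r)%R, (omega + r)%R]] <= (4 * Bd / N%:R ^+ 2)%:E)%E.
Proof.
move=> tau0 N0 rN HB.
set I := [set` _].
have mI : measurable (I : set (measurableTypeR R)) by exact: measurable_itv.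
pose Q w := \sum_(k < N) \sum_(l < N) cos (2 * pi * (k%:R * tau) * (w - omega) - 2 * pi * (l%:R * tau) * (w - omega)).
(* On the interval all phases are at most 1/2 in absolute value, so each cosine is at least 1/2 by
   the Lipschitz bound; elsewhere a sum of two squares is nonnegative. *)
have Q_ge w : (N%:R / 2) ^+ 2 * \1_I w <= Q w.
  have := sqr_cos_sin_sum (fun=> 1) (fun k : 'I_N => 2 * pi * (k%:R * tau) * (w - omega)).
  under eq_bigr do rewrite mul1r; under [in X in _ + X]eq_bigr do rewrite mul1r.
  under [in RHS]eq_bigr do under eq_bigr do rewrite !mul1r.
  rewrite -/(Q w) => <-; rewrite indicE; case: (boolP (w \in I)) => [|_]; last first.
    by rewrite mulr0 addr_ge0 // sqr_ge0.
  rewrite inE /I /= in_itv /= => /andP[w1 w2]; rewrite mulr1.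
  apply: (@le_trans _ _ ((\sum_(k < N) cos (2 * pi * (k%:R * tau) * (w - omega))) ^+ 2)); last first.
    by rewrite lerDl sqr_ge0.
  suff H : N%:R / 2 <= \sum_(k < N) cos (2 * pi * (k%:R * tau) * (w - omega)).
    by rewrite lerXn2r ?nnegrE // ?(le_trans _ H) // divr_ge0.
  rewrite -[N in leLHS]card_ord -sum1_card natr_sum mulr_suml; apply: ler_sum => k _.
  have wr : `|w - omega| <= r by rewrite ler_distl w1 w2.
  have := cos_lipschitz 0 (2 * pi * (k%:R * tau) * (w - omega)).
  have pi0 := pi_ge0 R.
  have y1 : `|2 * pi * (k%:R * tau) * (w - omega)| <= 1/2.
    apply: le_trans rN; rewrite normrM ler_pM //.
    rewrite ger0_norm ?mulr_ge0 ?(ltW tau0) // ler_wpM2l ?mulr_ge0 //.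
    by rewrite ler_wpM2r ?(ltW tau0) // ler_nat ltnW.
  rewrite cos0 sub0r normrN => h1; have := le_trans h1 y1.
  by rewrite ler_norml => /andP[_]; rewrite lerBlDr -lerBlDl; apply: le_trans; lra.
have [intQ _] := Rintegral_sum2 (fun k l : 'I_N =>
  integrable_cosB (2 * pi * (k%:R * tau)) (2 * pi * (l%:R * tau)) omega).
have Q_le : Rintegral nu setT Q <= Bd.
  rewrite spectral_quadratic_form.
  have [intS _] := Rintegral_sum2 (fun k l : 'I_N => integrable_ind2Z (k%:R * tau) (l%:R * tau)
    (cos (2 * pi * (k%:R * tau) * omega - 2 * pi * (l%:R * tau) * omega))).
  have -> : Bd = Rintegral mu setT (fun=> Bd).
    rewrite Rintegral_cst; last exact: measurableT.
    by have E := @probability_setT _ _ _ mu; transitivity (Bd * fine 1%E); [rewrite mulr1|rewrite -E].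
  apply: le_Rintegral => //.
    by apply: (@bounded_integrable _ _ _ _ _ `|Bd|).
  move=> x _; apply: le_trans (HB x); rewrite sqr_cabs -sqr_cos_sin_sum !raddf_sum /=.
  have E (k : 'I_N) : expi (- (2 * pi * omega) * tau) ^+ k = expi (- (2 * pi * (k%:R * tau) * omega)).
    by rewrite -expiMn; congr expi; rewrite -mulr_natr; ring.
  rewrite le_eqVlt; apply/orP; left; apply/eqP; congr (_ + _).
    by congr (_ ^+ 2); apply: eq_bigr => k _; rewrite E /= cosN mul0r subr0.
  rewrite -sqrrN -sumrN; congr (_ ^+ 2); apply: eq_bigr => k _.
  by rewrite E /= sinN mul0r addr0 mulrN.
have : Rintegral nu setT (fun w => (N%:R / 2) ^+ 2 * \1_I w) <= Bd.
  apply: le_trans Q_le; apply: le_Rintegral => //.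
  apply: (@bounded_integrable _ _ _ _ _ ((N%:R / 2) ^+ 2)).
    by apply: measurable_funM => //; exact: measurable_indic.
  move=> w; rewrite normrM [`|_ ^+ 2|]ger0_norm ?sqr_ge0 // ler_piMr ?sqr_ge0 //.
  by rewrite indicE; case: (_ \in _); rewrite ?normr1 ?normr0.
have intI : nu.-integrable setT (EFin \o (\1_I : R -> R)).
  apply: (@bounded_integrable _ _ _ _ _ 1); first exact: measurable_indic.
  by move=> w; rewrite indicE; case: (_ \in _); rewrite ?normr1 ?normr0.
rewrite RintegralZl // => H.
have nuI : nu I = (Rintegral nu setT (\1_I : R -> R))%:E.
  by rewrite /Rintegral integral_indic // setIT fineK // fin_num_measure.
rewrite nuI lee_fin ler_pdivlMr ?exprn_gt0 ?ltr0n //.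
by move: H; rewrite expr_div_n; lra.
Qed.

End SpectralBound.

(** * Sampling step and spectral measure of intervals *)

Lemma quarter_turn_gap (R : realType) (omega : R) (M : nat) : omega != 0 -> (0 < M)%N ->
  1 <= M%:R * cabs (1 - expi (- (2 * pi * omega) * (4 * `|omega| * M%:R)^-1)).
Proof.
move=> w0 M0; set x := - _ * _.
have Mr : 0 < M%:R :> R by rewrite ltr0n.
have wN : 0 < `|omega| by rewrite normr_gt0.
(* The 4 in the sampling step makes [M] steps a quarter turn. *)
have cx : cos (x *+ M) = 0.
  rewrite -mulr_natr /x.
  have [w|w] := ltrP 0 omega.
    rewrite gtr0_norm //; transitivity (cos (- (pi / 2) : R)); last by rewrite cosN cos_pihalf.
    by congr cos; field; rewrite !gt_eqF.
  have wl : omega < 0 by rewrite lt_neqAle w0.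
  rewrite ltr0_norm //; transitivity (cos ((pi / 2) : R)); last by rewrite cos_pihalf.
  by congr cos; field; rewrite gt_eqF // lt_eqF.
have := one_sub_cosMn x M; rewrite cx subr0 => h.
have c0 := cabs_ge0 (1 - expi x).
rewrite -(@ler_pXn2r _ 2) ?nnegrE ?mulr_ge0 ?(ltW Mr) // expr1n exprMn sqr_cabs_1subexpi.
by lra.
Qed.

(** Dividing by [1 - q] costs a factor [M]. The window of [M ^ 2] samples meets [O(M)] tiles, each
    with a discretization error of order [1 / M], so these errors add up to a constant. *)
Lemma tile_sum_quarter_turn (R : realType) d (p : 'rV[R]_d) (c : nat -> 'I_d) (s omega : R)
    (M : nat) (a : 'I_d) :
  (forall b, 0 < p 0 b) -> 0 <= s -> s < p 0 (c 0%N) -> omega != 0 -> (0 < M)%N ->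
  let tau := (4 * `|omega| * M%:R)^-1 in
  exists m : nat, let w := [seq c j | j <- iota 1 m] in
    wlen p w <= M%:R / (4 * `|omega|) /\
    cabs (tile_sum p c tau (- (2 * pi * omega)) s (M ^ 2) a) <=
      M%:R * (8 + 2 * cabs (wsum p (- (2 * pi * omega)) a w) + 2 * (\sum_b (p 0 b)^-1) / `|omega|).
Proof.
move=> p0 s0 sp w0 M0 tau; set theta := - _; set S := \sum_b _.
have wN : 0 < `|omega| by rewrite normr_gt0.
have Mr : 0 < M%:R :> R by rewrite ltr0n.
have M1 : 1 <= M%:R :> R by rewrite ler1n.
have tau0 : 0 < tau by rewrite invr_gt0 !mulr_gt0.
have S0 : 0 <= S by apply: sumr_ge0 => b _; rewrite invr_ge0 ltW.
have [m [wm bm]] := @tile_sum_bound _ _ p c p0 tau theta s (M ^ 2) a tau0 s0 sp.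
have NT : (M ^ 2)%:R * tau = M%:R / (4 * `|omega|).
  by rewrite natrX /tau; field; rewrite !gt_eqF.
exists m; rewrite -NT; split=> //.
have mS : m%:R <= wlen p [seq c j | j <- iota 1 m] * S.
  rewrite /wlen big_map mulr_suml -[m in m%:R](size_iota 1) -sum1_size natr_sum.
  apply: ler_sum => j _; rewrite mulrC -ler_pdivrMr // div1r /S (bigD1 (c j)) //= lerDl.
  by apply: sumr_ge0 => b _; rewrite invr_ge0 ltW.
have m_le : m%:R <= M%:R / (4 * `|omega|) * S.
  by rewrite (le_trans mS) // ler_wpM2r // -NT.
have thtau : `|theta| * tau <= 2 / M%:R.
  have -> : `|theta| * tau = pi / 2 / M%:R.
    rewrite /theta normrN !normrM (ger0_norm (pi_ge0 R)) (ger0_norm (ler0n R 2)) /tau.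
    by field; rewrite !gt_eqF.
  by rewrite ler_pM2r ?invr_gt0 // ltW // pihalf_lt2.
have mth : m%:R * (4 * (`|theta| * tau)) <= 2 * S / `|omega|.
  apply: (@le_trans _ _ (M%:R / (4 * `|omega|) * S * (4 * (2 / M%:R)))).
    by rewrite ler_pM ?mulr_ge0 ?(ltW tau0) // ler_wpM2l.
  rewrite le_eqVlt; apply/orP; left; apply/eqP; field; by rewrite !gt_eqF.
have gap := quarter_turn_gap w0 M0; rewrite -/tau -/theta in gap.
rewrite cabsM in bm; set u := cabs (1 - _) in bm gap; set v := cabs (tile_sum _ _ _ _ _ _ _) in bm *.
have v0 : 0 <= v by exact: cabs_ge0.
apply: (@le_trans _ _ (M%:R * (u * v))); first by rewrite mulrA ler_peMl.
rewrite ler_wpM2l ?(ltW Mr) // (le_trans bm) //.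
by rewrite lerD2l.
Qed.

Section LetterSpectralBound.
Local Open Scope quotient_scope.
Context (R : realType) (n : nat) (zeta : substitution n.+1) (p : 'rV[R]_n.+1)
  (aper : aperiodic zeta) (mu : probability (borel_suspension p aper) R)
  (a : 'I_n.+1) (nu : {finite_measure set (measurableTypeR R) -> \bar R}).
Hypothesis p_gt0 : forall b, 0 < p 0 b.
Hypothesis mu_inv : flow_invariant mu.
Hypothesis nu_corr : correlation_measure mu a nu.

Lemma letter_spectral_bound (omega gamma K : R) : omega != 0 -> 0 < gamma < 1 -> 0 < K ->
  (forall v ell, in_language zeta v -> 1 <= ell -> wlen p v <= ell ->
     cabs (wsum p (- (2 * pi * omega)) a v) <= K * ell `^ (1 - gamma)) ->
  forall (M : nat) (r : R), (0 < M)%N -> pi * M%:R * r <= `|omega| ->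
  forall D, D = 8 + 2 * (K * (1 + (4 * `|omega|)^-1) `^ (1 - gamma)) + 2 * (\sum_b (p 0 b)^-1) / `|omega| ->
  (nu [set` `[(omega - r)%R, (omega + r)%R]] <= (4 * D ^+ 2 * (M%:R `^ (- gamma)) ^+ 2)%:E)%E.
Proof.
move=> w0 /andP[g0 g1] K0 wB M r M0 Mr D DE.
have wN : 0 < `|omega| by rewrite normr_gt0.
have Mr0 : 0 < M%:R :> R by rewrite ltr0n.
have M1 : 1 <= M%:R :> R by rewrite ler1n.
pose tau : R := (4 * `|omega| * M%:R)^-1.
have tau0 : 0 < tau by rewrite invr_gt0 !mulr_gt0.
set X := M%:R `^ (1 - gamma).
set Y := M%:R `^ (- gamma).
have XY : X = M%:R * Y.
  by rewrite /X /Y powRD ?powRr1 ?(ltW Mr0) //; apply/implyP => _; rewrite gt_eqF.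
have X1 : 1 <= X.
  by rewrite -[leLHS](powRr0 M%:R); apply: ler_powR => //; rewrite subr_ge0 ltW.
have S0 : 0 <= \sum_b (p 0 b)^-1 by apply: sumr_ge0 => b _; rewrite invr_ge0 ltW.
have NE : ((M ^ 2)%:R : R) = M%:R ^+ 2 by rewrite natrX.
have Nt : (M ^ 2)%:R * tau = M%:R / (4 * `|omega|).
  by rewrite NE /tau; field; rewrite !gt_eqF.
(* With [N = M ^ 2] samples the sum is bounded by [D * N * Y], a saving of [Y] over the trivial
   bound. *)
have -> : 4 * D ^+ 2 * Y ^+ 2 = 4 * (D * M%:R ^+ 2 * Y) ^+ 2 / (M ^ 2)%:R ^+ 2.
  by rewrite NE; field; rewrite gt_eqF.
apply: (@spectral_interval_bound _ (borel_suspension p aper) R mu (flow p aper)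
  (letter_set p aper a) nu _ _ mu_inv _ nu_corr (M ^ 2)%N tau) => //.
- exact: flowD.
- exact: measurable_flow.
- exact: measurable_letter_set.
- by rewrite expn_gt0 M0.
- rewrite Nt (_ : _ * r = pi * M%:R * r / `|omega| / 2); last by field; rewrite gt_eqF.
  by rewrite ler_pM2r ?invr_gt0 // ler_pdivrMr // mul1r.
move=> q; have [x [s [qE s0 sp]]] := fundamental_domain p_gt0 q.
set theta := - _.
have -> : \sum_(k < M ^ 2) (\1_(letter_set p aper a) (flow p aper (k%:R * tau) q))%:C *
    expi (theta * tau) ^+ k = tile_sum p (orbit_letter x) tau theta s (M ^ 2) a.
  apply: eq_bigr => k _; congr (_ * _); rewrite qE pi_flow /= indicE.
  have sk : 0 <= s + k%:R * tau by rewrite addr_ge0 // mulr_ge0 // ltW.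
  have L := letter_set_pi aper p_gt0 a x sk.
  have -> : (\pi_(suspension p aper) (x, s + k%:R * tau)%R \in letter_set p aper a) =
      in_tile p (orbit_letter x) a (s + k%:R * tau).
    by case: L => L1 L2; apply/idP/idP => [/set_mem /L1 //|/L2 ?]; apply/mem_set.
  by rewrite rmorph_nat.
have [m [wm tb]] := tile_sum_quarter_turn a p_gt0 s0 sp w0 M0.
rewrite -/tau -/theta in tb; set w := [seq _ | _ <- _] in wm tb.
rewrite lerXn2r ?nnegrE ?cabs_ge0 //.
  have D0 : 0 <= D.
    by rewrite DE !addr_ge0 // ?mulr_ge0 ?powR_ge0 ?invr_ge0 ?(ltW wN) // ltW.
  by rewrite !mulr_ge0 ?powR_ge0.
apply: le_trans tb _.
have wl : in_language zeta w by exact: orbit_language.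
(* The summand 1 gives [1 <= M * e], as the word bound demands; the other one covers the length of
   the window. *)
pose e := 1 + (4 * `|omega|)^-1; have e1 : 1 <= e by rewrite lerDl invr_ge0 mulr_ge0.
have := wB w (M%:R * e) wl; rewrite powRM ?(ltW Mr0) ?(le_trans ler01 e1) // -/X => wb.
have {}wb : cabs (wsum p theta a w) <= K * (X * e `^ (1 - gamma)).
  apply: wb; first by rewrite -[leLHS]mulr1 ler_pM.
  by rewrite (le_trans wm) // ler_pM2l // lerDr.
have -> : D * M%:R ^+ 2 * Y = M%:R * (D * X) by rewrite XY; ring.
rewrite ler_pM2l // DE.
have c1 : 8 <= 8 * X by rewrite ler_peMr.
have c2 : 2 * (\sum_b (p 0 b)^-1) / `|omega| <= 2 * (\sum_b (p 0 b)^-1) / `|omega| * X.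
  by rewrite ler_peMr // !mulr_ge0 // invr_ge0 ltW.
rewrite -/e [leRHS]mulrDl lerD // [leRHS]mulrDl lerD //.
by rewrite -(mulrA 2) ler_pM2l // -mulrA [_ * X]mulrC.
Qed.
End LetterSpectralBound.

Theorem theorem1p1 (R : realType) (d : nat) (zeta : substitution d)
  (alpha : R) (p : 'rV[R]_d)
  (d_ge4 : (4 <= d)%N) (d_even : ~~ odd d)
  (zeta_prim : primitive_subst zeta)
  (zeta_aper : aperiodic zeta)
  (alpha_perron : perron_eigenvalue zeta alpha)
  (alpha_salem : salem_number alpha)
  (alpha_deg : has_degree alpha d)
  (p_roof : roof_vector zeta alpha p)
  (mu : probability (borel_suspension p zeta_aper) R)
  (mu_inv : flow_invariant mu)
  (nu : 'I_d -> {finite_measure set (measurableTypeR R) -> \bar R})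
  (nu_corr : forall a : 'I_d, correlation_measure mu a (nu a))
  (sigma0 : R -> R[i])
  (sigma0_emb : field_embedding (Qadjoin alpha) sigma0)
  (sigma0_alpha : sigma0 alpha = (alpha^-1)%:C) :
  exists c : R, 0 < c /\
    forall A B C : R, 1 < A -> 1 < B -> 1 < C ->
    exists gamma : R, 0 < gamma /\
      forall omega : R,
        Qadjoin alpha `|omega| ->
        B^-1 <= `|omega| <= B ->
        `|sigma0 omega| <= C%:C ->
        (exists (L : nat) (l : 'I_d -> int),
           reduced_form alpha omega L l /\ L%:R <= A) ->
        exists r0 : R, 0 < r0 /\
          forall r : R, 0 < r < r0 ->
          forall a : 'I_d,
            (nu a [set` `[(omega - r)%R, (omega + r)%R]] <= (c * r `^ gamma)%:E)%E.
Proof.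
case: d zeta p d_ge4 d_even zeta_prim zeta_aper alpha_perron alpha_deg p_roof mu mu_inv nu nu_corr
  => [//|n] zeta' p' d4 _ prim aper [_ eig _] deg roof mu' mu'_inv nu' nu'_corr.
have p_gt0 : forall b, 0 < p' 0 b by case: roof.
exists 1; split=> // A B C A1 B1 C1.
have [gamma g01 wsB] := @word_sum_bound R n zeta' alpha p' (ltnW d4) prim eig alpha_salem deg roof
  sigma0 sigma0_emb sigma0_alpha A B C A1 B1 C1.
have /andP[g0 g1] := g01.
exists gamma; split=> // omega _ wB wC wL.
have [K K0 KB] := wsB omega wB wC wL.
have b0 : 0 < `|omega|.
  by case/andP: wB => wB _; rewrite (lt_le_trans _ wB) // invr_gt0 (lt_trans ltr01).
have w0 : omega != 0 by rewrite -normr_gt0.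
set b := `|omega| in b0.
pose D := 8 + 2 * (K * (1 + (4 * b)^-1) `^ (1 - gamma)) + 2 * (\sum_c (p' 0 c)^-1) / b.
pose Q := 4 * D ^+ 2 * ((8 / b) `^ gamma) ^+ 2.
have D4 : 0 <= 4 * D ^+ 2 by apply: mulr_ge0; rewrite ?sqr_ge0.
have Q0 : 0 <= Q by apply: mulr_ge0; rewrite ?sqr_ge0.
have Q1 : 0 < (1 + Q)^-1 by rewrite invr_gt0 ltr_wpDr.
(* The first bound gives [b / (4 * r) > 2], so rounding down loses at most half; the second gives Q
   r^gamma <= 1. *)
exists (Num.min (b / 8) ((1 + Q)^-1 `^ gamma^-1)).
split; first by rewrite lt_min divr_gt0 //= powR_gt0.
move=> r /andP[r0]; rewrite lt_min => /andP[rb rQ] a.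
(* [M] is of order [1 / r]; the 4 leaves room for the factor pi in [pi * M * r <= b]. *)
pose M := Num.truncn (b / (4 * r)).
have r4 : 0 < 4 * r by rewrite mulr_gt0.
have br : 2 < b / (4 * r) by rewrite ltr_pdivlMr //; lra.
have /andP[M_le M_gt] : M%:R <= b / (4 * r) < M.+1%:R by apply: truncn_itv; lra.
have M0 : (0 < M)%N by move: (lt_trans br M_gt); rewrite ltr_nat ltnS => /ltnW.
have Mr : pi * M%:R * r <= b.
  move: M_le; rewrite ler_pdivlMr // => h; have := pihalf_lt2 R; have := pi_gt0 R.
  clear - h b0; nra.
have M_ge : M%:R^-1 <= 8 / b * r.
  rewrite -[leRHS]invrK lef_pV2 ?posrE ?ltr0n ?invr_gt0 ?mulr_gt0 ?invr_gt0 //.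
  have -> : (8 / b * r)^-1 = b / (4 * r) / 2 by field; rewrite !gt_eqF.
  have half (x y : R) : 2 < x -> x < y + 1 -> x / 2 <= y by lra.
  by apply: half br _; rewrite natr1.
have nu_le := letter_spectral_bound p_gt0 mu'_inv (nu'_corr a) w0 g01 K0 (KB a) M0 Mr (erefl D).
apply: (le_trans nu_le); rewrite lee_fin mul1r.
have Y_le : M%:R `^ (- gamma) <= (8 / b) `^ gamma * r `^ gamma.
  rewrite -powRM ?divr_ge0 ?(ltW b0) ?(ltW r0) // -mulN1r powRrM powR_inv1 //.
  have rb0 : 0 <= 8 / b * r by rewrite (le_trans _ M_ge) // invr_ge0.
  by apply: ge0_ler_powR; rewrite ?nnegrE ?(ltW g0) ?invr_ge0.
have rg : Q * r `^ gamma <= 1.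
  apply: (@le_trans _ _ (Q * (1 + Q)^-1)).
    rewrite ler_wpM2l //; apply: (@le_trans _ _ ((((1 + Q)^-1) `^ gamma^-1) `^ gamma)).
      by apply: ge0_ler_powR; rewrite ?nnegrE ?powR_ge0 ?(ltW g0) ?(ltW r0) ?(ltW rQ).
    by rewrite -powRrM mulVf ?gt_eqF // powRr1 // ltW.
  by rewrite ler_pdivrMr ?ltr_wpDr // mul1r lerDr.
apply: (@le_trans _ _ (4 * D ^+ 2 * ((8 / b) `^ gamma * r `^ gamma) ^+ 2)).
  rewrite ler_wpM2l // lerXn2r ?nnegrE ?mulr_ge0 ?powR_ge0 //.
have -> : 4 * D ^+ 2 * ((8 / b) `^ gamma * r `^ gamma) ^+ 2 = (Q * r `^ gamma) * r `^ gamma.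
  by rewrite /Q; ring.
by rewrite ler_piMl ?powR_ge0.
Qed.
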